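(* Let $0<\epsilon<1$, $t\ge0$ an integer and $k$ a positive integer. For each $n$, let $1\le\alpha_n^{(k)}<\cdots<\alpha_n^{(1)}\le n$ and $n+t\ge\beta_n^{(k)}>\cdots>\beta_n^{(1)}\ge1$ be integers, and let $M$ be an $\epsilon$-balanced random $n\times(n+t)$ matrix over $\mathbb{Z}$ having $k$-step stairs of zeros with respect to $\alpha_n^{(i)}$ and $\beta_n^{(i)}$. Suppose that for every $1\le i\le k$, $\lim_{n\to\infty}(n-\alpha_n^{(i)}-\beta_n^{(i)})=\infty$. Let $G$ be a finite abelian group and $T$ a finite set of primes containing all prime divisors of $|G|$. Then $$\lim_{n\to\infty}\mathbb{P}\big(\mathrm{cok}(M)(p)\cong G(p)\text{ for all }p\in T\big)=\frac{1}{|\mathrm{Aut}(G)|\,|G|^t}\prod_{p\in T}\prod_{i=1}^\infty(1-p^{-i-t}).$$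
   Context: For a finite abelian group (or finitely generated abelian group) $A$ and a prime $p$, $A(p)$ denotes its Sylow $p$-subgroup (the $p$-power torsion part). A random integer $\xi$ is $\epsilon$-balanced if for every prime $p$ and every $r\in\mathbb{Z}/p\mathbb{Z}$, $\mathbb{P}(\xi\equiv r\pmod p)\le 1-\epsilon$. A random $n\times(n+t)$ integer matrix $M$ has $k$-step stairs of zeros with respect to $\alpha_n^{(i)},\beta_n^{(i)}$ and is $\epsilon$-balanced if $M_{i,j}=0$ whenever there is $1\le l\le k$ with $1\le i\le\alpha_n^{(l)}$ and $1\le j\le\beta_n^{(l)}$, and all other entries are independent $\epsilon$-balanced random integers. *)

(* Defs.v *)
From HB Require Import structures.
From mathcomp Require Export all_boot all_order all_algebra all_fingroup finmap.
From mathcomp Require Export generic_quotient ring_quotient.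
From mathcomp Require Export all_classical all_reals all_analysis.
Export numFieldNormedType.Exports.

Set Implicit Arguments.
Unset Strict Implicit.
Unset Printing Implicit Defensive.

Import Order.TTheory GRing.Theory Num.Theory.

Local Open Scope classical_set_scope.
Local Open Scope ring_scope.

HB.instance Definition _ := isPointed.Build int 0.

HB.instance Definition _ := @isMeasurable.Build default_measure_display
  int discrete_measurable discrete_measurable0
  discrete_measurableC discrete_measurableU.

Section Cokernel.
Variables (m n : nat) (M : 'M[int]_(m, n)).

(* The image of M acting on column vectors, i.e. M Z^n inside Z^m. *)
Definition col_lattice : {pred 'cV[int]_m} :=
  [pred y | `[< exists x : 'cV[int]_n, y = M *m x >]].

Lemma col_lattice_zmod_closed : zmod_closed col_lattice.
Proof.
split; first by apply/asboolP; exists 0; rewrite mulmx0.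
move=> x y /asboolP[u ->] /asboolP[v ->].
by apply/asboolP; exists (u - v); rewrite mulmxBr.
Qed.

HB.instance Definition _ :=
  GRing.isZmodClosed.Build 'cV[int]_m col_lattice col_lattice_zmod_closed.

Definition cok : zmodType := Quotient.quot col_lattice.

End Cokernel.

Definition ppart (A : zmodType) (p : nat) : set A :=
  [set x | exists k : nat, x *+ (p ^ k)%N = 0].
Arguments ppart A p : clear implicits.

(* Only the restriction of f to X matters, so this is isomorphism of X and Y
   when these are (carriers of) subgroups. *)
Definition subgroup_iso (A B : zmodType) (X : set A) (Y : set B) : Prop :=
  exists2 f : A -> B,
    {in X &, {morph f : x y / x + y}} & set_bij X Y f.

Section RandomIntegers.
Context (R : realType) (d : measure_display) (Omega : measurableType d).
Variable P : probability Omega R.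

Definition balanced (eps : R) (X : Omega -> int) : Prop :=
  forall p : nat, prime p -> forall r : 'F_p,
    (P [set w | (X w)%:~R = r] <= (1 - eps)%:E)%E.

(* Mutual independence of (X i) for i in J: the product rule on every finite
   subfamily. *)
Definition mutually_independent (I : finType) (J : {set I})
    (X : I -> Omega -> int) : Prop :=
  forall K : {set I}, K \subset J ->
  forall B : I -> set int,
    (P (\bigcap_(i in [set` K]) X i @^-1` B i) =
     \prod_(i in K) P (X i @^-1` B i))%E.

End RandomIntegers.

(* Steps are indexed by l = 1, ..., k; the values of alpha and beta at other
   arguments are irrelevant. *)
Definition stairs_shape (k m n : nat) (alpha beta : nat -> nat) : Prop :=
  [/\ (1 <= alpha k)%N /\ (alpha 1 <= m)%N,
      forall l, (1 <= l < k)%N -> (alpha l.+1 < alpha l)%N,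
      (1 <= beta 1)%N /\ (beta k <= n)%N
    & forall l, (1 <= l < k)%N -> (beta l < beta l.+1)%N].

(* Rows and columns are numbered from 0 here, whence the strict inequalities. *)
Definition stairs_zeros (k m n : nat) (alpha beta : nat -> nat) :
    {set 'I_m * 'I_n} :=
  [set ij : 'I_m * 'I_n |
    has (fun l => (ij.1 < alpha l)%N && (ij.2 < beta l)%N) (iota 1 k)]%SET.

Definition balanced_stairs_matrix (R : realType) (d : measure_display)
    (Omega : measurableType d) (P : probability Omega R) (eps : R)
    (k m n : nat) (alpha beta : nat -> nat) (M : Omega -> 'M[int]_(m, n)) :
    Prop :=
  let Z := stairs_zeros k m n alpha beta in
  let entry (ij : 'I_m * 'I_n) (w : Omega) := M w ij.1 ij.2 in
  [/\ forall ij, ij \in Z -> forall w, entry ij w = 0,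
      forall ij, ij \notin Z -> measurable_fun [set: Omega] (entry ij),
      forall ij, ij \notin Z -> balanced P eps (entry ij)
    & mutually_independent P (~: Z)%SET entry].

(* Main.v *)
(** Let [a'] kill [G] and let [a] be a multiple of [a' Q], where [Q] is the
    product of the primes of [T], with prime divisors in [T].  If [G] is the
    cokernel of [M] modulo [a], then the cokernel of [M] has the prescribed
    primary parts, and conversely when this cokernel is finite.

    By Odlyzko's bound, the first [n - r] columns of [M] are with high
    probability independent modulo every [p] in [T]; then Smith reduction yields
    an [r x n] matrix [phi], onto modulo [a] and killing those columns, such that
    the cokernel of [M] modulo [a] is that of [phi A], where [A] consists of the
    last [r + t] columns.  With high probability, no sparse nonzero row vector
    modulo [p] kills the first columns: rows in the zero region are independent
    by Odlyzko's bound again, and the other sparse vectors are handled by a union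
    bound.  So every combination of the rows of [phi] has large support, and
    [phi A] is nearly uniform modulo [a].

    For a uniform [r x (r + t)] matrix, the kernel of a surjection [Z^r -> G] is
    a lattice [B Z^r], and the matrices with that kernel as image are the [B C]
    with [C] onto modulo every [p] in [T], which can be counted exactly.  An
    infinite cokernel gives a row vector, nonzero modulo [p], that kills [phi A]
    modulo a power [p^e] dividing [a], an event of uniform probability at most
    [r / p^e].  It remains to let [n], then [a], then [r] tend to infinity. *)

Require Import Defs.
From mathcomp Require Import zify ring lra fintype finset.
Import Order.TTheory GRing.Theory Num.Theory.
Local Open Scope ring_scope.
Set Implicit Arguments.
Unset Strict Implicit.
Unset Printing Implicit Defensive.

(** * Product measures on finite sets *)

(** Columns are set aside because a uniform square matrix is singular modulo [p] with probability
    bounded away from 0. With [r] columns left out, the error in Odlyzko's bound is of order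
    [(1 - eps) ^+ r] whatever [n] is, hence [r] is fixed before [n] grows. The divergence of
    [n - alpha - beta] is used three times: a column cut by a step keeps more free entries than
    there are columns before it up to the end of the step, the same holds for rows, and the last
    columns contain no fixed zero at all. Balance is assumed modulo primes only, but uniformity is
    needed modulo [a]. The bridge is Nakayama's lemma: a proper subgroup of matrices modulo [a] is
    already proper modulo one prime, so supports over the fields ['F_p] are all that matters. The
    spare factor [Q] of [a] makes a presentation conclusive. If [a'] kills the cokernel modulo
    [a' Q], then [a'] times the cokernel equals [Q] times itself, so it has no [p]-part for [p] in
    [T]; modulo [a'] alone a larger [p]-part could look like that of [G]. After reduction modulo [a]
    all measures are finite products, and conditioning on the first columns is a finite sum. *)

Section ProductWeights.
Variables (R : realFieldType) (I X : finType).

Definition weights (mu : I -> X -> R) : Prop :=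
  (forall i x, 0 <= mu i x) /\ (forall i, \sum_x mu i x = 1).

Definition Wt (mu : I -> X -> R) (f : {ffun I -> X}) : R := \prod_i mu i (f i).

Definition Pr (mu : I -> X -> R) (D : {ffun I -> X} -> Prop) : R :=
  \sum_(f | `[< D f >]) Wt mu f.

Definition merge (J : {set I}) (h f : {ffun I -> X}) : {ffun I -> X} :=
  [ffun i => if i \in J then h i else f i].

Variable mu : I -> X -> R.
Hypothesis muW : weights mu.

Lemma Wt_ge0 f : 0 <= Wt mu f.
Proof. by apply: prodr_ge0 => i _; exact: muW.1. Qed.

Lemma sum_Wt : \sum_f Wt mu f = 1.
Proof.
rewrite /Wt -(bigA_distr_bigA (fun i x => mu i x)) big1 // => i _.
exact: muW.2.
Qed.

Lemma PrE D : Pr mu D = \sum_f Wt mu f * (`[< D f >])%:R.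
Proof.
rewrite /Pr big_mkcond; apply: eq_bigr => f _.
by case: asboolP; rewrite ?mulr1 ?mulr0.
Qed.

Lemma Pr_ge0 D : 0 <= Pr mu D.
Proof. by apply: sumr_ge0 => f _; exact: Wt_ge0. Qed.

Lemma le_Pr (D E : _ -> Prop) : (forall f, D f -> E f) -> Pr mu D <= Pr mu E.
Proof.
move=> DE; rewrite !PrE; apply: ler_sum => f _; apply: ler_wpM2l.
  exact: Wt_ge0.
by case: asboolP => // /DE /asboolT ->.
Qed.

Lemma eq_Pr (D E : _ -> Prop) : (forall f, D f <-> E f) -> Pr mu D = Pr mu E.
Proof. by move=> DE; apply/le_anti; rewrite !le_Pr // => f /DE. Qed.

Lemma Pr_true : Pr mu (fun _ => True) = 1.
Proof.
by rewrite PrE -[RHS]sum_Wt; apply: eq_bigr => f _; rewrite asboolT // mulr1.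
Qed.

Lemma Pr_le1 D : Pr mu D <= 1.
Proof. by rewrite -Pr_true; exact: le_Pr. Qed.

Lemma Pr_or (D E : _ -> Prop) :
  Pr mu (fun f => D f \/ E f) <= Pr mu D + Pr mu E.
Proof.
rewrite !PrE -big_split; apply: ler_sum => f _ /=.
rewrite -mulrDr; apply: ler_wpM2l; first exact: Wt_ge0.
rewrite -natrD ler_nat asbool_or.
by case: asboolP; case: asboolP.
Qed.

Lemma Pr_exists (S : Type) (s : seq S) (A : pred S) (D : S -> _ -> Prop)
    (E : _ -> Prop) :
  (forall f, E f -> has (fun x => A x && `[< D x f >]) s) ->
  Pr mu E <= \sum_(x <- s | A x) Pr mu (D x).
Proof.
elim: s E => [|x s IH] E HE.
  rewrite big_nil; apply: (@le_trans _ _ (Pr mu (fun _ => False))).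
    by apply: le_Pr => f /HE.
  by rewrite PrE big1 // => f _; rewrite asboolF // mulr0.
rewrite big_cons; case: ifP => Ax; last first.
  by apply: IH => f /HE /=; rewrite Ax.
apply: (@le_trans _ _ (Pr mu (fun f => D x f \/
   has (fun x => A x && `[< D x f >]) s))).
  by apply: le_Pr => f /HE /= /orP[/andP[_ /asboolP Df]|Hs]; [left|right].
by apply: le_trans (Pr_or _ _) _; rewrite lerD2l; exact: IH.
Qed.

Lemma mergeK (J : {set I}) h f : merge J (merge J f h) (merge J h f) = f.
Proof. by apply/ffunP => i; rewrite !ffunE; case: (i \in J). Qed.

Lemma Wt_merge (J : {set I}) h f :
  Wt mu (merge J h f) * Wt mu (merge J f h) = Wt mu f * Wt mu h.
Proof.
rewrite /Wt -!big_split; apply: eq_bigr => i _ /=; rewrite !ffunE.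
by case: (i \in J) => //; rewrite mulrC.
Qed.

(** Swapping the [J]-coordinates of two independent copies preserves the product weight. This takes
    the place of conditioning on the coordinates outside [J], with [h] as the fresh sample. *)
Lemma sum_resample (J : {set I}) (F : {ffun I -> X} -> R) :
  \sum_f Wt mu f * F f =
  \sum_f Wt mu f * (\sum_h Wt mu h * F (merge J h f)).
Proof.
transitivity (\sum_(p : {ffun I -> X} * {ffun I -> X})
    Wt mu p.1 * Wt mu p.2 * F p.1).
  rewrite -(pair_bigA _ (fun f h => Wt mu f * Wt mu h * F f)) /=.
  apply: eq_bigr => f _; rewrite -mulr_suml -mulr_sumr sum_Wt.
  by rewrite mulr1.
pose phi (p : {ffun I -> X} * {ffun I -> X}) :=
  (merge J p.2 p.1, merge J p.1 p.2).
have phiK : involutive phi.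
  by move=> [f h]; rewrite /phi /= !mergeK.
rewrite (reindex_inj (inv_inj phiK)) /=.
transitivity (\sum_(p : {ffun I -> X} * {ffun I -> X})
    Wt mu p.1 * Wt mu p.2 * F (merge J p.2 p.1)).
  by apply: eq_bigr => -[f h] _ /=; rewrite Wt_merge.
rewrite -(pair_bigA _ (fun f h => Wt mu f * Wt mu h * F (merge J h f))) /=.
by apply: eq_bigr => f _; rewrite mulr_sumr; apply: eq_bigr => h _; rewrite mulrA.
Qed.

Lemma Pr_resample (J : {set I}) D :
  Pr mu D = \sum_f Wt mu f * Pr mu (fun h => D (merge J h f)).
Proof.
rewrite PrE (sum_resample J); apply: eq_bigr => f _.
by rewrite PrE.
Qed.

Lemma Pr_resample_le (J : {set I}) D c :
  (forall f, Pr mu (fun h => D (merge J h f)) <= c) -> Pr mu D <= c.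
Proof.
move=> H; rewrite (Pr_resample J) -[c]mul1r -sum_Wt mulr_suml.
by apply: ler_sum => f _; apply: ler_wpM2l => //; exact: Wt_ge0.
Qed.

Lemma Pr_box (Y : {set I}) (C : I -> pred X) :
  Pr mu (fun f => forall y, y \in Y -> C y (f y)) =
  \prod_(y in Y) \sum_(x | C y x) mu y x.
Proof.
rewrite [RHS]big_mkcond /=.
transitivity (\prod_i \sum_x mu i x * ((i \in Y) ==> C i x)%:R).
  rewrite bigA_distr_bigA PrE; apply: eq_bigr => f _ /=.
  rewrite big_split /=; congr (_ * _).
  have [H|/existsNP[i /not_implyP[iY /negP nC]]] :=
      pselect (forall y, y \in Y -> C y (f y)).
    by rewrite asboolT // big1 // => i _; case: (boolP (i \in Y)) => //= /H ->.
  rewrite asboolF; last by move/(_ _ iY); apply/negP.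
  by rewrite (bigD1 i) //= iY (negbTE nC) mul0r.
apply: eq_bigr => i _; case: ifP => iY /=; last first.
  by rewrite -[RHS](muW.2 i); apply: eq_bigr => x _; rewrite mulr1.
rewrite [RHS]big_mkcond; apply: eq_bigr => x _.
by case: (C i x); rewrite ?mulr1 ?mulr0.
Qed.

(** Given the coordinates outside [Y], one outcome [h0] in [D] fixes the residues of all other
    outcomes on [Y], so [D] lies in a box. The map [rho] enters because entries are balanced only
    modulo a prime. *)
Lemma Pr_determined (C : eqType) (rho : X -> C) (q : R) (Y : {set I})
    (D : {ffun I -> X} -> Prop) :
  0 <= q ->
  (forall y c, y \in Y -> \sum_(x | rho x == c) mu y x <= q) ->
  (forall f f', D f -> D f' -> (forall i, i \notin Y -> f i = f' i) ->
     forall y, y \in Y -> rho (f y) = rho (f' y)) ->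
  Pr mu D <= q ^+ #|Y|.
Proof.
move=> q0 Hq HD; apply: (Pr_resample_le (J := Y)) => f.
have [[h0 D0]|none] := pselect (exists h, D (merge Y h f)); last first.
  apply: (@le_trans _ _ 0); last exact: exprn_ge0.
  by rewrite PrE big1 // => h _; rewrite asboolF ?mulr0 // => Dh; apply: none; exists h.
apply: (@le_trans _ _ (Pr mu (fun h => forall y, y \in Y ->
    rho (h y) == rho (h0 y)))).
  apply: le_Pr => h Dh y yY; apply/eqP.
  have := HD _ _ Dh D0 _ y yY; rewrite !ffunE yY; apply=> i iY.
  by rewrite !ffunE (negbTE iY).
rewrite (Pr_box Y (fun y x => rho x == rho (h0 y))) -prodr_const.
apply: ler_prod => y yY; rewrite Hq // andbT.
by apply: sumr_ge0 => x _; exact: muW.1.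
Qed.

End ProductWeights.

(** * Odlyzko's bound for rows with prescribed free entries *)

(** [Pv] indexes a maximal independent family of columns of [W]; the other columns, hence the other
    coordinates of a vector of the row space, are combinations of these. *)
Lemma row_space_pivots (F : fieldType) (m N : nat) (W : 'M[F]_(m, N)) :
  exists Pv : {set 'I_N}, (#|Pv| <= \rank W)%N /\
    forall x : 'rV[F]_N, (x <= W)%MS -> (forall i, i \in Pv -> x 0 i = 0) ->
    x = 0.
Proof.
pose fn := maxrankfun W^T.
exists [set fn i | i in 'I_(\rank W^T)]; split.
  by rewrite (leq_trans (leq_imset_card _ _)) // card_ord mxrank_tr.
move=> x /submxP[c ->] Hx.
have /submxP[Z HZ] : (W^T <= rowsub fn W^T)%MS by rewrite eq_maxrowsub.
have H0 : c *m (rowsub fn W^T)^T = 0.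
  apply/rowP => i; rewrite !mxE.
  have /Hx : fn i \in [set fn i | i in 'I_(\rank W^T)] by apply: imset_f.
  by rewrite mxE => E; rewrite -[RHS]E; apply: eq_bigr => k _; rewrite !mxE.
by rewrite -[W]trmxK HZ trmx_mul mulmxA H0 mul0mx.
Qed.

Section Odlyzko.
Variables (R : realFieldType) (I X : finType) (mu : I -> X -> R).
Hypothesis muW : weights mu.
Variables (F : fieldType) (rho : X -> F) (q : R).
Hypothesis q0 : 0 <= q.
Hypothesis q1 : q <= 1.
Variables (m N : nat) (iota : 'I_m -> 'I_N -> I) (S : 'I_m -> {set 'I_N}).
Hypothesis iota_inj : forall j k j' k', iota j k = iota j' k' -> j = j' /\ k = k'.
Hypothesis free : forall j k c, k \in S j ->
  \sum_(x | rho x == c) mu (iota j k) x <= q.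

Definition residue_rows (f : {ffun I -> X}) : 'M[F]_(m, N) :=
  \matrix_(j, k) rho (f (iota j k)).

(** Padding with zero rows keeps one matrix type for all [j], while the row space is that of the
    rows before [j]. *)
Definition first_rows (f : {ffun I -> X}) (j : 'I_m) : 'M[F]_(m, N) :=
  \matrix_(i, k) if (i < j)%N then residue_rows f i k else 0.

Lemma rank_first_rows f j : (\rank (first_rows f j) <= j)%N.
Proof.
have -> : first_rows f j = pid_mx j *m residue_rows f.
  apply/matrixP => i k; rewrite mxE [RHS]mxE (bigD1 i) //= big1 => [|i' ne].
    by rewrite !mxE eqxx /= addr0; case: ifP; rewrite ?mul1r ?mul0r.
  by rewrite !mxE eq_sym val_eqE (negbTE ne) mul0r.
apply: leq_trans (mxrankM_maxl _ _) _; by rewrite rank_pid_mx // ltnW.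
Qed.

(** With the earlier rows fixed, two candidates for row [j] that agree outside [Y] differ by a
    vector of the span vanishing at all pivots, hence by 0. There are at most [j] pivots, and each
    free coordinate off them costs a factor [q]. The truncated subtraction gives the trivial bound 1
    when at most [j] coordinates are free. *)
Lemma Pr_row_in_span j :
  Pr mu (fun f => (row j (residue_rows f) <= first_rows f j)%MS) <=
  q ^+ (#|S j| - j).
Proof.
apply: (Pr_resample_le muW (J := [set iota j k | k in 'I_N])) => f.
have Efirst h : first_rows (merge [set iota j k | k in 'I_N] h f) j =
    first_rows f j.
  apply/matrixP => i k; rewrite !mxE; case: ifP => // ij; rewrite !ffunE.
  case: imsetP => // -[k' _ /iota_inj[E _]].
  by move: ij; rewrite E ltnn.
have [Pv [cPv HPv]] := row_space_pivots (first_rows f j).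
pose Y := [set iota j k | k in S j :\: Pv].
have cY : (#|S j| - j <= #|Y|)%N.
  rewrite card_imset; last by move=> k k' /iota_inj[].
  rewrite cardsD; apply: leq_sub => //.
  apply: leq_trans (rank_first_rows f j).
  by apply: leq_trans cPv; rewrite subset_leq_card // subsetIr.
apply: le_trans (ler_wiXn2l q0 q1 cY).
apply: (Pr_determined muW (rho := rho) q0).
  by move=> y c /imsetP[k /setDP[kS _] ->]; exact: free.
move=> h h' Dh Dh' Ehh' _ /imsetP[k _ ->].
rewrite !Efirst in Dh Dh'.
set x := row j _ in Dh; set x' := row j _ in Dh'.
have xE k1 : x 0 k1 = rho (h (iota j k1)) by rewrite !mxE ffunE imset_f.
have xE' k1 : x' 0 k1 = rho (h' (iota j k1)) by rewrite !mxE ffunE imset_f.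
rewrite -xE -xE'; suff /eqP : x - x' = 0 by rewrite subr_eq0 => /eqP ->.
apply: HPv => [|i iPv]; first by rewrite addmx_sub // eqmx_opp.
rewrite mxE [X in _ + X]mxE xE xE' Ehh' ?subrr //.
by apply/imsetP => -[k1 /setDP[_ nk] /iota_inj[_ E]]; rewrite -E iPv in nk.
Qed.

Lemma Pr_rows_dependent :
  Pr mu (fun f => exists2 u : 'rV[F]_m, u != 0 & u *m residue_rows f = 0) <=
  \sum_j q ^+ (#|S j| - j).
Proof.
apply: (@le_trans _ _ (\sum_j
    Pr mu (fun f => (row j (residue_rows f) <= first_rows f j)%MS))); last first.
  by apply: ler_sum => j _; exact: Pr_row_in_span.
apply: Pr_exists => // f [u /rV0Pn[j0 uj0] u0].
(* The last index in the support of the relation: its row is a combination of the rows before it. *)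
case: (@arg_maxnP _ j0 (fun j => u 0 j != 0) val uj0) => j uj jmax.
apply/hasP; exists j; first by rewrite mem_index_enum.
apply/asboolP.
have Hu (i : 'I_m) : (j < i)%N -> u 0 i = 0.
  by move=> ji; apply/eqP; apply/negPn/negP => /jmax; rewrite /= leqNgt ji.
apply/submxP; exists (- (u 0 j)^-1 *: u); apply/rowP => k.
rewrite !mxE; apply: (mulfI uj); rewrite mulr_sumr.
under eq_bigr => i _ do rewrite !mxE !mulrA mulrN divff // mulN1r.
move/rowP: u0 => /(_ k); rewrite !mxE (bigD1 j) //= !mxE => /eqP.
rewrite addr_eq0 => /eqP ->.
rewrite [RHS](bigD1 j) //= ltnn mulr0 add0r -sumrN; apply: eq_bigr => i ij.
rewrite !mxE mulNr; case: ltngtP => [_|ji|/val_inj E] //; first by rewrite Hu ?mul0r.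
by rewrite E eqxx in ij.
Qed.

End Odlyzko.

(** * Equidistribution of random sums *)

Section Equidistribution.
Variables (R : realFieldType) (I X : finType) (mu : I -> X -> R).
Hypothesis muW : weights mu.
Variables (H : finZmodType) (g : I -> H) (vl : X -> nat) (T : seq nat) (eps : R).
Hypothesis eps0 : 0 < eps.
Hypothesis eps1 : eps <= 1.
Variable J0 : {set I}.
Hypothesis bal : forall i p c, i \in J0 -> p \in T ->
  \sum_(x | (vl x %% p == c)%N) mu i x <= 1 - eps.

Definition psum (J : {set I}) (f : {ffun I -> X}) : H :=
  \sum_(i in J) g i *+ vl (f i).

Definition law (J : {set I}) (h : H) : R := Pr mu (fun f => psum J f = h).

Lemma law_ge0 J h : 0 <= law J h. Proof. exact: Pr_ge0. Qed.

Lemma law_le1 J h : law J h <= 1. Proof. exact: Pr_le1. Qed.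

Lemma sum_psum J (F : H -> R) :
  \sum_f Wt mu f * F (psum J f) = \sum_h law J h * F h.
Proof.
rewrite (partition_big (psum J) predT) //=; apply: eq_bigr => h _.
rewrite /law PrE mulr_suml [LHS]big_mkcond; apply: eq_bigr => f _ /=.
case: eqP => [<-|ne]; first by rewrite asboolT // mulr1.
by rewrite asboolF // mulr0 mul0r.
Qed.

Lemma sum_law J : \sum_h law J h = 1.
Proof.
rewrite -[RHS](sum_Wt muW); under [RHS]eq_bigr => f _ do rewrite -[Wt _ _]mulr1.
by rewrite (sum_psum J (fun=> 1)); apply: eq_bigr => h _; rewrite mulr1.
Qed.

Lemma law_disjointU (B J : {set I}) h : [disjoint B & J] ->
  law (B :|: J) h = \sum_y law B y * law J (h - y).
Proof.
move=> dBJ; rewrite /law (Pr_resample muW B).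
transitivity (\sum_f Wt mu f * law B (h - psum J f)).
  apply: eq_bigr => f _; congr (_ * _); apply: eq_Pr => // h'.
  have -> : psum (B :|: J) (merge B h' f) = psum B h' + psum J f.
    rewrite /psum (eq_bigl [predU B & J]) => [|i]; last by rewrite !inE.
    rewrite bigU //=; congr (_ + _); apply: eq_bigr => i iB.
      by rewrite ffunE iB.
    by rewrite ffunE (disjointFl dBJ iB).
  by split=> [<-|->]; rewrite ?addrK ?subrK.
rewrite (sum_psum J (fun y => law B (h - y))).
rewrite (reindex_inj (can_inj (subKr h))) /=.
by apply: eq_bigr => y _; rewrite subKr mulrC.
Qed.

(** Doeblin's argument: [law B] contains [kappa] times the counting measure, which contributes the
    same constant at every point and drops out of the difference. The rest has mass
    [1 - kappa * #|H|%:R] and averages the oscillation of [law J]. *)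
Lemma law_contract (B J : {set I}) (kappa delta : R) : [disjoint B & J] ->
  (forall h, kappa <= law B h) ->
  (forall h h', `|law J h - law J h'| <= delta) ->
  forall h h', `|law (B :|: J) h - law (B :|: J) h'| <=
    (1 - kappa * #|H|%:R) * delta.
Proof.
move=> dBJ Hk Hd h h'.
have shift k : law (B :|: J) k =
    kappa + \sum_y (law B y - kappa) * law J (k - y).
  rewrite law_disjointU //.
  under [in RHS]eq_bigr => y _ do rewrite mulrBl.
  rewrite sumrB -mulr_sumr.
  have -> : \sum_y law J (k - y) = 1.
    by rewrite -(sum_law J) [RHS](reindex_inj (can_inj (subKr k))).
  by rewrite mulr1 addrC subrK.
rewrite !shift opprD addrACA subrr add0r -sumrB.
apply: le_trans (ler_norm_sum _ _ _) _.
rewrite -[X in _ <= (X - _) * _](sum_law B) mulr_natr -sumr_const -sumrB.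
rewrite mulr_suml; apply: ler_sum => y _.
rewrite -mulrBr normrM ger0_norm ?subr_ge0 //.
by apply: ler_wpM2l; rewrite ?subr_ge0.
Qed.

(** Values of the [i]-th variable that differ modulo [p] move a sum into different cosets of [K];
    balance modulo [p] provides two such values. *)
Definition separates (K : {set H}) (p : nat) (i : I) : Prop :=
  forall x y : nat, (x != y %[mod p])%N -> g i *+ x - g i *+ y \notin K.

(** [K] runs over the proper subgroups of [H], and the prime may depend on [K]. *)
Definition spread (J : {set I}) (m : nat) : Prop :=
  forall K : {set H}, 0 \in K -> {in K &, forall x y, x - y \in K} ->
  K != [set: H] ->
  exists2 p, p \in T & (m <= #|[set i in J | `[< separates K p i >]]|)%N.

Let k0 : R := eps / #|X|%:R.

Lemma exists_ge_average (P : pred X) (F : X -> R) (c : R) : 0 < c ->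
  c <= \sum_(x | P x) F x -> exists2 x, P x & c / #|X|%:R <= F x.
Proof.
move=> c0 Hc; apply/not_exists2P => HF.
have X0 : (0 < #|X|)%N.
  rewrite lt0n; apply/eqP => /card0_eq X0.
  by move: Hc; rewrite big_pred0 ?leNgt ?c0 // => x; have := X0 x; rewrite inE.
suff : \sum_(x | P x) F x < c by rewrite ltNge Hc.
have X0' : 0 < #|X|%:R :> R by rewrite ltr0n.
have HF' x : P x -> F x < c / #|X|%:R.
  by move=> Px; case: (HF x) => // /negP; rewrite -ltNge.
have [x Px|P0] := pickP P; last by rewrite big_pred0.
have -> : c = \sum_(x : X) c / #|X|%:R.
  by rewrite sumr_const -[RHS]mulr_natr divfK // gt_eqF.
rewrite (bigD1 x) //= [ltRHS](bigD1 x) //=; apply: ltr_leD; first exact: HF'.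
rewrite big_mkcond [leRHS]big_mkcond; apply: ler_sum => y _.
case: (eqVneq y x); rewrite ?andbF // andbT => _; case: ifP => Py.
  by apply: ltW; exact: HF'.
by apply: divr_ge0; apply: ltW.
Qed.

(** The total mass gives one atom. Balance leaves mass at least [eps] outside its residue class,
    which gives the other; averaging over [X] turns mass [eps] into an atom of size [k0]. *)
Lemma two_atoms i p : i \in J0 -> p \in T ->
  exists x y, [/\ k0 <= mu i x, k0 <= mu i y & (vl x != vl y %[mod p])%N].
Proof.
move=> iJ pT.
have [|x _ Hx] := @exists_ge_average predT (mu i) eps eps0.
  by rewrite muW.2.
have [|y Hy Hy'] :=
    @exists_ge_average (fun y => vl y %% p != vl x %% p)%N (mu i) eps eps0.
  have := bal (vl x %% p)%N iJ pT; have := muW.2 i.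
  rewrite (bigID (fun y => vl y %% p == vl x %% p)%N) /= => <-.
  lra.
by exists y, x.
Qed.

Lemma law_set0 h : law set0 h = (h == 0)%:R.
Proof.
rewrite /law; case: eqP => [->|ne].
  rewrite -[RHS](Pr_true muW); apply: eq_Pr => // f.
  by rewrite /psum big_set0.
rewrite PrE big1 // => f _; rewrite asboolF ?mulr0 // /psum big_set0.
by move=> E; apply: ne.
Qed.

Lemma law_set1 i x : mu i x <= law [set i] (g i *+ vl x).
Proof.
apply: (@le_trans _ _
    (Pr mu (fun f => forall y, y \in [set i] -> f y == x))).
  rewrite (Pr_box muW [set i] (fun _ y => y == x)) big_set1.
  by rewrite big_pred1_eq.
apply: le_Pr => // f Hf; rewrite /psum big_set1.
by rewrite (eqP (Hf i _)) // inE.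
Qed.

Let k0_ge0 : 0 <= k0. Proof. by rewrite divr_ge0 // ltW. Qed.

Let k0_le1 : k0 <= 1.
Proof.
have [E|] := posnP #|X|; first by rewrite /k0 E invr0 mulr0 ler01.
rewrite -(ltr0n R) => X0; rewrite ler_pdivrMr // mul1r (le_trans eps1) //.
by rewrite ler1n -(ltr0n R).
Qed.

(** The threshold loses one factor [k0] per index, so that a new index with an atom of size [k0]
    translates likely values to likely values. *)
Definition likely (B : {set I}) : {set H} := [set h | k0 ^+ #|B| <= law B h].

Lemma likely_setU1 (B : {set I}) i x h : i \notin B -> k0 <= mu i x ->
  h \in likely B -> h + g i *+ vl x \in likely (i |: B).
Proof.
move=> iB Hx; rewrite !inE cardsU1 iB exprS => hB.
rewrite law_disjointU; last by rewrite disjoints1.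
rewrite (bigD1 (g i *+ vl x)) //= addrK ler_wpDr //.
  by apply: sumr_ge0 => y _; apply: mulr_ge0; exact: law_ge0.
apply: ler_pM => //; first exact: exprn_ge0.
exact: le_trans (law_set1 _ _).
Qed.

(* The set of likely values of a partial sum is not invariant under every
   difference of two likely values of the next term, so it grows until it is
   everything. *)
Lemma likely_grow (J : {set I}) k : J \subset J0 -> spread J #|H| ->
  exists B : {set I}, [/\ B \subset J, (#|B| <= k)%N &
    (k < #|likely B|)%N \/ likely B = [set: H]].
Proof.
move=> sJ HJ; elim: k => [|k [B [BJ cB HB]]].
  exists set0; rewrite sub0set cards0; split=> //; left.
  by apply/card_gt0P; exists 0; rewrite inE law_set0 eqxx cards0 expr0.
have [HT|nT] := eqVneq (likely B) [set: H].
  by exists B; split=> //; [exact: leqW|right].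
case: HB => [kB|/eqP]; last by rewrite (negbTE nT).
(* The stabilizer of the likely values under translation: a proper subgroup, because these values
   are neither none nor all of [H]. *)
pose K := [set k : H | [set s + k | s in likely B] == likely B].
have KP z : z \in K -> forall s, (s \in likely B) = (s + z \in likely B).
  by rewrite inE => /eqP E s; rewrite -{2}E (mem_imset _ _ (@addIr _ z)).
have K0 : 0 \in K.
  by rewrite inE; under eq_imset do rewrite addr0; rewrite imset_id.
have KB : {in K &, forall x y, x - y \in K}.
  move=> x y xK yK; rewrite inE eqEcard card_imset ?leqnn ?andbT; last exact: addIr.
  apply/fintype.subsetP => _ /imsetP[s sB ->].
  by rewrite (KP y yK) addrA subrK -(KP x xK).
have KT : K != [set: H].
  apply: contra nT => /eqP KT; apply/eqP/setP => z; rewrite in_setT.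
  have /card_gt0P[s sB] : (0 < #|likely B|)%N by apply: leq_trans kB.
  have := KP (z - s); rewrite KT in_setT => /(_ isT s).
  by rewrite sB [s + _]addrC subrK => <-.
have [p pT Hp] := HJ K K0 KB KT.
set S := [set i in J | _] in Hp.
(* At most [k] indices have been used and [k < #|H|], so some separating index is new. *)
have /subsetPn[i iS iB] : ~~ (S \subset B).
  apply: contraL (leq_ltn_trans cB kB) => /subset_leq_card SB.
  by rewrite -leqNgt (leq_trans (max_card _)) // (leq_trans Hp) // (leq_trans SB).
move: iS; rewrite inE => /andP[iJ /asboolP Hi].
have [x [y [Hx Hy nxy]]] := two_atoms (fintype.subsetP sJ _ iJ) pT.
exists (i |: B); split.
- by rewrite subUset sub1set iJ.
- by rewrite cardsU1 iB ltnS.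
left; rewrite ltnNge; apply: contra (Hi _ _ nxy) => cB'.
have E z : k0 <= mu i z -> [set s + g i *+ vl z | s in likely B] = likely (i |: B).
  move=> Hz; apply/eqP; rewrite eqEcard; apply/andP; split.
    by apply/fintype.subsetP => _ /imsetP[s sB ->]; exact: likely_setU1.
  rewrite card_imset ?(leq_trans cB') //; exact: addIr.
rewrite inE eqEcard card_imset ?leqnn ?andbT; last exact: addIr.
apply/fintype.subsetP => _ /imsetP[s sB ->].
have : s + g i *+ vl x \in likely (i |: B) by apply: likely_setU1.
by rewrite -(E y Hy) => /imsetP[s' s'B]; rewrite addrA => ->; rewrite addrK.
Qed.

Let kappa : R := k0 ^+ #|H|.

(** At most [#|H|] indices make every value likely, with probability at least [kappa]. Removing them
    costs at most [#|H|] of the spread, so a spread of [s * #|H|] pays for [s] contractions. *)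
Lemma law_osc s (J : {set I}) : J \subset J0 -> spread J (s * #|H|) ->
  forall h h', `|law J h - law J h'| <= (1 - kappa * #|H|%:R) ^+ s.
Proof.
elim: s J => [|s IH] J sJ HJ h h'.
  rewrite expr0 ler_norml.
  have := law_ge0 J h; have := law_ge0 J h'; have := law_le1 J h.
  by have := law_le1 J h'; lra.
have HJ1 : spread J #|H|.
  move=> K K0 KB KT; have [p pT Hp] := HJ K K0 KB KT; exists p => //.
  by apply: leq_trans Hp; rewrite mulSn leq_addr.
have [B [BJ cB HB]] := likely_grow #|H| sJ HJ1.
have {}HB : likely B = [set: H].
  by case: HB => //; rewrite ltnNge max_card.
rewrite -[J](setID J B) setIC (setIidPl BJ) exprS.
apply: law_contract.
- by rewrite -setI_eq0 setIDA setIC setDIl setDv setI0.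
- move=> y; have : y \in likely B by rewrite HB inE.
  by rewrite inE; apply: le_trans; exact: ler_wiXn2l.
apply: IH; first exact: fintype.subset_trans (subsetDl _ _) sJ.
move=> K K0 KB KT; have [p pT Hp] := HJ K K0 KB KT; exists p => //.
rewrite -(leq_add2l #|H|) -mulSn; apply: leq_trans Hp _.
set S := [set i in J | _].
apply: (@leq_trans (#|B| + #|S :\: B|)).
  by rewrite -(cardsID B S) leq_add2r subset_leq_card // subsetIr.
apply: leq_add => //; apply: subset_leq_card.
by apply/fintype.subsetP => i; rewrite !inE => /and3P[-> -> ->].
Qed.

Lemma equidistribution s (J : {set I}) h : J \subset J0 -> spread J (s * #|H|) ->
  `|law J h - #|H|%:R^-1| <= (1 - kappa * #|H|%:R) ^+ s.
Proof.
move=> sJ HJ.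
have H0 : 0 < #|H|%:R :> R by rewrite ltr0n; apply/card_gt0P; exists 0.
have -> : law J h - #|H|%:R^-1 = #|H|%:R^-1 * \sum_h' (law J h - law J h').
  rewrite sumrB sum_law sumr_const -[law J h *+ _]mulr_natr mulrBr mulr1 mulrCA.
  by rewrite mulVf ?mulr1 // gt_eqF.
rewrite normrM gtr0_norm ?invr_gt0 // ler_pdivrMl //.
apply: le_trans (ler_norm_sum _ _ _) _.
rewrite mulr_natl -sumr_const; apply: ler_sum => h' _.
exact: law_osc.
Qed.

End Equidistribution.

(** * Presentations and block reduction *)

Section Presentations.
Variable a : nat.

Definition lin (G : zmodType) n (g : {ffun 'I_n -> G}) (x : 'cV[int]_n) : G :=
  \sum_i g i *~ x i 0.

Lemma linB (G : zmodType) n (g : {ffun 'I_n -> G}) : {morph lin g : x y / x - y}.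
Proof.
move=> x y; rewrite /lin -sumrB; apply: eq_bigr => i _.
by rewrite !mxE mulrzBr.
Qed.

Lemma lin0 (G : zmodType) n (g : {ffun 'I_n -> G}) : lin g 0 = 0.
Proof. by have := linB g 0 0; rewrite !subrr. Qed.

Lemma linN (G : zmodType) n (g : {ffun 'I_n -> G}) : {morph lin g : x / - x}.
Proof. by move=> x; have := linB g 0 x; rewrite lin0 !sub0r. Qed.

Lemma linD (G : zmodType) n (g : {ffun 'I_n -> G}) : {morph lin g : x y / x + y}.
Proof. by move=> x y; have := linB g x (- y); rewrite linN !opprK. Qed.

Lemma linZ (G : zmodType) n (g : {ffun 'I_n -> G}) (c : int) x :
  lin g (c *: x) = lin g x *~ c.
Proof.
rewrite /lin mulrz_suml; apply: eq_bigr => i _.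
by rewrite !mxE mulrC mulrzA.
Qed.

Lemma lin_sum (G : zmodType) n (g : {ffun 'I_n -> G}) (I : Type) (s : seq I) P F :
  lin g (\sum_(i <- s | P i) F i) = \sum_(i <- s | P i) lin g (F i).
Proof. exact: (big_morph _ (linD g) (lin0 g)). Qed.

Lemma lin_mulmx (G : zmodType) n m (g : {ffun 'I_n -> G}) (L : 'M[int]_(n, m)) x :
  lin g (L *m x) = lin [ffun j => lin g (col j L)] x.
Proof.
rewrite {2}/lin; under eq_bigr => j _ do rewrite ffunE -linZ.
rewrite -lin_sum; congr (lin g _); apply/colP => i; rewrite summxE mxE.
by apply: eq_bigr => j _; rewrite !mxE mulrC.
Qed.

Lemma lin_delta (G : zmodType) n (g : {ffun 'I_n -> G}) i :
  lin g (delta_mx i 0) = g i.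
Proof.
rewrite /lin (bigD1 i) //= big1 => [|j ji]; rewrite !mxE ?eqxx ?addr0 //.
by rewrite (negbTE ji).
Qed.

(* [lin g] identifies [G] with the cokernel of [A] modulo [a]. *)
Definition presents (G : zmodType) n N (g : {ffun 'I_n -> G})
    (A : 'M[int]_(n, N)) : Prop :=
  (forall y, exists x, lin g x = y) /\
  (forall x, lin g x = 0 <-> exists u v, x = A *m u + a%:Z *: v).

Definition presentable (G : zmodType) n N (A : 'M[int]_(n, N)) : Prop :=
  exists g : {ffun 'I_n -> G}, presents g A.

(** The trace modulo [a] of a row vector that kills [A], as an infinite cokernel provides. The
    second condition excludes trivial solutions such as multiples of [a] when [p] divides [a]. *)
Definition degenerate p n N (A : 'M[int]_(n, N)) : Prop :=
  exists v : 'rV[int]_n, (exists w, v *m A = a%:Z *: w) /\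
    ~ (exists w, v = p%:Z *: w).

Lemma presents_congr (G : zmodType) n N (g : {ffun 'I_n -> G})
    (A B : 'M[int]_(n, N)) :
  presents g A -> presents g (A + a%:Z *: B).
Proof.
case=> gs gk; split=> // x; rewrite gk; split=> -[u [v ->]].
  by exists u, (v - B *m u); rewrite mulmxDl -scalemxAl scalerBr -addrA
    (addrC (a%:Z *: (B *m u))) subrK.
exists u, (v + B *m u).
by rewrite mulmxDl -scalemxAl scalerDr -addrA (addrC (a%:Z *: v)).
Qed.

Lemma degenerate_congr p n N (A B : 'M[int]_(n, N)) :
  degenerate p A -> degenerate p (A + a%:Z *: B).
Proof.
case=> v [[w vA] nv]; exists v; split => //; exists (w + v *m B).
by rewrite mulmxDr vA -scalemxAr scalerDr.
Qed.

Lemma presentable_mulL (G : zmodType) n N (L : 'M[int]_n) (A : 'M[int]_(n, N)) :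
  L \in unitmx -> presentable G A -> presentable G (L *m A).
Proof.
move=> Lu [g [gs gk]]; exists [ffun j => lin g (col j (invmx L))]; split.
  by move=> y; have [x <-] := gs y; exists (L *m x); rewrite -lin_mulmx mulKmx.
move=> x; rewrite -lin_mulmx gk; split=> -[u [v]] E.
  exists u, (L *m v).
  by rewrite -[x](mulKVmx Lu) E mulmxDr mulmxA scalemxAr.
exists u, (invmx L *m v).
by rewrite E mulmxDr -mulmxA mulKmx // scalemxAr.
Qed.

Lemma degenerate_mulL p n N (L : 'M[int]_n) (A : 'M[int]_(n, N)) :
  L \in unitmx -> degenerate p A -> degenerate p (L *m A).
Proof.
move=> Lu [v [[w vA] nv]]; exists (v *m invmx L); split.
  by exists w; rewrite mulmxA mulmxKV.
case=> w' E; apply: nv; exists (w' *m L).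
by rewrite -[v](mulmxKV Lu) E -scalemxAl.
Qed.

Section Block.
Variables (b r N : nat) (B B' E : 'M[int]_b).
Hypothesis BB' : B *m B' = 1%:M + a%:Z *: E.
Variables (C : 'M[int]_(b, N)) (U : 'M[int]_(r, N)).

Let B_onto x : exists y z : 'cV[int]_b, x = B *m y + a%:Z *: z.
Proof.
exists (B' *m x), (- (E *m x)); rewrite mulmxA BB' mulmxDl mul1mx.
by rewrite -scalemxAl scalerN addrK.
Qed.

(** The block [B] is onto modulo [a], so the relations kill the first [b] generators, and [C] only
    adds terms in these. *)
Lemma presentable_block (G : zmodType) :
  presentable G (block_mx B C 0 U) <-> presentable G U.
Proof.
split=> -[g [gs gk]].
  have lin_l x : lin g (col_mx x 0) = 0.
    have [y [z ->]] := B_onto x; apply/gk.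
    exists (col_mx y 0), (col_mx z 0).
    by rewrite mul_block_col !mul0mx !mulmx0 !addr0 scale_col_mx add_col_mx
       scaler0 addr0.
  have lin_r x : lin [ffun i => g (rshift b i)] x = lin g (col_mx 0 x).
    rewrite /lin [RHS]big_split_ord /= [X in X + _]big1 ?add0r => [|i _].
      by apply: eq_bigr => i _; rewrite ffunE col_mxEd.
    by rewrite col_mxEu mxE mulr0z.
  have lin_v x : lin g x = lin g (col_mx 0 (dsubmx x)).
    rewrite -[in LHS](vsubmxK x).
    have -> : col_mx (usubmx x) (dsubmx x) =
        col_mx (usubmx x) 0 + col_mx 0 (dsubmx x).
      by rewrite add_col_mx addr0 add0r.
    by rewrite linD lin_l add0r.
  exists [ffun i => g (rshift b i)]; split.
    by move=> y; have [x <-] := gs y; exists (dsubmx x); rewrite lin_r -lin_v.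
  move=> x; rewrite lin_r gk; split=> -[u [v E1]].
    exists (dsubmx u), (dsubmx v); move: E1.
    rewrite -{1}[u]vsubmxK -{1}[v]vsubmxK mul_block_col mul0mx add0r.
    by rewrite scale_col_mx add_col_mx => /eq_col_mx[_ ->].
  apply/gk; rewrite E1.
  have -> : col_mx 0 (U *m u + a%:Z *: v) =
     (block_mx B C 0 U *m col_mx 0 u + a%:Z *: col_mx 0 v) - col_mx (C *m u) 0.
    rewrite mul_block_col !mul0mx !mulmx0 !add0r scale_col_mx add_col_mx scaler0.
    by rewrite addr0 opp_col_mx add_col_mx subrr oppr0 addr0.
  rewrite linB lin_l subr0; apply/gk.
  by exists (col_mx 0 u), (col_mx 0 v).
pose g' : {ffun 'I_(b + r) -> G} :=
  [ffun i => if split i is inr j then g j else 0].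
have lin_v x : lin g' x = lin g (dsubmx x).
  rewrite /lin big_split_ord /= big1 ?add0r => [|i _].
    apply: eq_bigr => i _; rewrite ffunE mxE.
    by have -> : split (rshift b i) = inr i := unsplitK (inr i).
  rewrite ffunE; have -> : split (lshift r i) = inl i := unsplitK (inl i).
  by rewrite mul0rz.
exists g'; split.
  move=> y; have [x <-] := gs y; exists (col_mx 0 x).
  by rewrite lin_v col_mxKd.
move=> x; rewrite lin_v gk; split=> -[u [v E1]].
  have [y [z Hyz]] := B_onto (usubmx x - C *m u).
  exists (col_mx y u), (col_mx z v).
  rewrite mul_block_col mul0mx add0r scale_col_mx add_col_mx -E1.
  by rewrite addrAC -Hyz subrK vsubmxK.
exists (dsubmx u), (dsubmx v); move: E1.
rewrite -{1}[u]vsubmxK -{1}[v]vsubmxK mul_block_col mul0mx add0r.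
by rewrite scale_col_mx add_col_mx => ->; rewrite col_mxKd.
Qed.

(** Multiplication by [B'] shows that the left part of [v] is a multiple of [a], hence of [p]; so
    the right part must be nonzero modulo [p]. *)
Lemma degenerate_block p : (p %| a)%N ->
  degenerate p (block_mx B C 0 U) -> degenerate p U.
Proof.
move=> /dvdnP[a' Ea] [v [[w]]].
rewrite -[v]hsubmxK -[w]hsubmxK mul_row_block scale_row_mx mulmx0 addr0.
move=> /eq_row_mx[E1 E2] nv.
have E3 : lsubmx v = a%:Z *: (lsubmx w *m B' - lsubmx v *m E).
  rewrite scalerBr scalemxAl -E1 -mulmxA BB' mulmxDr mulmx1.
  by rewrite -scalemxAr addrK.
set x := lsubmx w *m B' - _ in E3.
exists (rsubmx v); split.
  exists (rsubmx w - x *m C).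
  by rewrite scalerBr -E2 E3 -scalemxAl addrAC subrr add0r.
case=> w' Ew'; apply: nv; exists (row_mx (a'%:Z *: x) w').
by rewrite scale_row_mx scalerA -PoszM mulnC -Ea -E3 -Ew'.
Qed.

End Block.

End Presentations.

(** * Smith reduction of independent columns *)

Lemma coprimez_primes (a : nat) (d : int) : (0 < a)%N ->
  (forall p, prime p -> (p %| a)%N -> ~~ (p%:Z %| d)%Z) -> coprimez d a.
Proof.
move=> a0 H; rewrite /coprimez /gcdz -[_ == _]/(gcdn _ _ == 1%N).
apply: contraT => ne1.
have g1 : (1 < gcdn `|d| a)%N.
  by rewrite ltn_neqAle eq_sym ne1 gcdn_gt0 a0 orbT.
have [g_d g_a] := (dvdn_gcdl `|d| a, dvdn_gcdr `|d| a).
have := H _ (pdiv_prime g1) (dvdn_trans (pdiv_dvd _) g_a).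
by rewrite dvdzE /= (dvdn_trans (pdiv_dvd _) g_d).
Qed.

Lemma intr_Fp_eq0 (p : nat) (d : int) : prime p ->
  (d%:~R == 0 :> 'F_p) = (p%:Z %| d)%Z.
Proof. by move=> pp; rewrite (dvdz_pcharf (pchar_Fp pp)). Qed.

(** [phi] is the lower block of the inverse of the left Smith factor of [A0]. Independence modulo
    the primes dividing [a] makes the diagonal entries units modulo [a], so the upper block can be
    cancelled. *)
Lemma smith_reduction (a b r : nat) (A0 : 'M[int]_(b + r, b)) : (0 < a)%N ->
  (forall p, prime p -> (p %| a)%N -> forall c : 'cV['F_p]_b,
     map_mx intr A0 *m c = 0 -> c = 0) ->
  exists phi : 'M[int]_(r, b + r),
  [/\ phi *m A0 = 0,
      forall p, prime p -> forall u : 'rV['F_p]_r, u *m map_mx intr phi = 0 -> u = 0,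
      forall (G : zmodType) N (A1 : 'M[int]_(b + r, N)),
        presentable a G (row_mx A0 A1) <-> presentable a G (phi *m A1)
    & forall p N (A1 : 'M[int]_(b + r, N)), (p %| a)%N ->
        degenerate a p (row_mx A0 A1) -> degenerate a p (phi *m A1)].
Proof.
move=> a0 HA0; have [L Lu [Q Qu [d _ EA]]] := int_Smith_normal_form A0.
pose dv : 'rV[int]_b := \row_j d`_j.
have {}EA : A0 = L *m (col_mx (diag_mx dv *m Q) 0).
  rewrite EA -mulmxA; congr (_ *m _); rewrite -[RHS]mul1mx.
  have -> : \matrix_(i < b + r, j < b) (d`_i *+ (i == j :> nat)) =
      col_mx (diag_mx dv) 0.
    apply/matrixP => i j; rewrite !mxE; case: splitP => i' Ei; rewrite !mxE.
      by rewrite Ei -val_eqE.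
    by rewrite Ei; case: eqP => // E; have := ltn_ord j; rewrite -E; lia.
  by rewrite mul_col_mx mul0mx mul1mx.
have cop j : coprimez (dv 0 j) a.
  (* If [p] divided the [j]-th diagonal entry, [A0] would kill the [j]-th column of [invmx Q] modulo
     [p]. *)
  apply: coprimez_primes => // p pp pa; apply/negP => pd.
  have mapu m (V : 'M[int]_m) : V \in unitmx ->
      map_mx intr V *m map_mx intr (invmx V) = 1%:M :> 'M['F_p]_m.
    by move=> Vu; rewrite -map_mxM mulmxV // map_mx1.
  have : map_mx intr (invmx Q) *m delta_mx j 0 = 0 :> 'cV['F_p]_b.
    apply: (HA0 p pp pa); rewrite EA map_mxM -mulmxA map_col_mx map_mx0.
    rewrite mul_col_mx mul0mx [map_mx _ (_ *m _)]map_mxM -mulmxA.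
    rewrite (mulmxA (map_mx _ Q)) mapu // mul1mx.
    suff -> : map_mx intr (diag_mx dv) *m delta_mx j 0 = 0 :> 'cV['F_p]_b.
      by rewrite col_mx0 mulmx0.
    apply/colP => i; rewrite !mxE big1 // => k _; rewrite !mxE.
    case: (eqVneq k j) => [->|]; last by rewrite mulr0.
    case: (eqVneq i j) => [->|_]; last by rewrite mulr0n mul0r.
    rewrite mulr1n; apply/eqP; rewrite mulf_eq0 intr_Fp_eq0 //.
    by rewrite mxE in pd; rewrite pd.
  move/(congr1 (mulmx (map_mx intr Q))); rewrite mulmxA mapu // mul1mx mulmx0.
  by move/colP/(_ j); rewrite !mxE !eqxx => /eqP; rewrite oner_eq0.
have /choice[uv Huv] : forall j, exists uv : int * int,
    uv.1 * dv 0 j + uv.2 * a = 1 by move=> j; exact/coprimezP.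
pose B := diag_mx dv *m Q.
(* The Bezout coefficients invert the diagonal modulo [a]. *)
pose B' := invmx Q *m diag_mx (\row_j (uv j).1).
have BB' : B *m B' = 1%:M + a%:Z *: - diag_mx (\row_j (uv j).2).
  rewrite /B /B' mulmxA mulmxK //; apply/matrixP => i j.
  rewrite mul_diag_mx !mxE; case: (eqVneq i j) => [->|_]; last first.
    by rewrite !mulr0n oppr0 !mulr0 addr0.
  rewrite !mulr1n mulrN; apply/eqP; rewrite eq_sym subr_eq; apply/eqP.
  by rewrite -(Huv j) !mxE mulrC [(uv j).2 * _]mulrC.
exists (dsubmx (invmx L)); split.
- by rewrite EA mulmxA mul_dsub_mx mulVmx // mul_dsub_mx mul1mx col_mxKd.
- move=> p pp u u0.
  have : row_mx 0 u *m map_mx intr (invmx L) = 0 :> 'rV['F_p]_(b + r).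
    rewrite -[invmx L]vsubmxK map_col_mx mul_row_col mul0mx add0r.
    exact: u0.
  move/(congr1 (mulmxr (map_mx intr L))); rewrite /= -mulmxA -map_mxM mulVmx //.
  by rewrite map_mx1 mulmx1 mul0mx => /(congr1 rsubmx); rewrite row_mxKr linear0.
- move=> G N A1.
  have E1 : invmx L *m row_mx A0 A1 =
      block_mx B (usubmx (invmx L *m A1)) 0 (dsubmx (invmx L) *m A1).
    rewrite mul_mx_row EA mulKmx // mul_dsub_mx.
    by rewrite block_mxEh vsubmxK.
  rewrite -(presentable_block BB' (usubmx (invmx L *m A1))) -E1.
  split; first by apply: presentable_mulL; rewrite unitmx_inv.
  by move/(presentable_mulL Lu); rewrite mulKVmx.
move=> p N A1 pa.
have E1 : invmx L *m row_mx A0 A1 =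
    block_mx B (usubmx (invmx L *m A1)) 0 (dsubmx (invmx L) *m A1).
  rewrite mul_mx_row EA mulKmx // mul_dsub_mx.
  by rewrite block_mxEh vsubmxK.
move=> /(@degenerate_mulL a p _ _ (invmx L)).
rewrite unitmx_inv E1 => /(_ Lu); exact: (degenerate_block BB').
Qed.

(** * Residues modulo [a] and detection of proper subgroups modulo a prime *)

Section Residues.
Variable a : nat.
Hypothesis a1 : (1 < a)%N.

Definition liftmx m n (U : 'M['Z_a]_(m, n)) : 'M[int]_(m, n) :=
  map_mx (fun x : 'Z_a => (x : nat)%:Z) U.

(** Defined on representatives, so compatibility with sums has to come from [p %| a]. *)
Definition Zp_red (p : nat) (x : 'Z_a) : 'F_p := (x : nat)%:R.

Lemma Zp_nat_natr (x : 'Z_a) : (x : nat)%:R = x.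
Proof. by rewrite -[RHS]natr_Zp. Qed.

Lemma intr_modz (S : nzRingType) (z : int) : a%:R = 0 :> S ->
  z%:~R = `|(z %% a)%Z|%N%:R :> S.
Proof.
move=> aS; have aN : (a != 0)%N by rewrite -lt0n ltnW.
rewrite {1}(divz_eq z a) rmorphD rmorphM /= -[a%:Z%:~R]pmulrn aS mulr0 add0r.
by rewrite -{1}(@gez0_abs (z %% a)%Z) ?modz_ge0.
Qed.

Lemma Zp_red_intr p (z : int) : prime p -> (p %| a)%N ->
  Zp_red p z%:~R = z%:~R.
Proof.
move=> pp pa; have p0 : p%:R = 0 :> 'F_p by exact: pchar_Fp_0.
have redn (k : nat) : Zp_red p k%:R = k%:R.
  rewrite /Zp_red val_Zp_nat // {2}(divn_eq k a) natrD natrM.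
  by rewrite -(divnK pa) [X in _ * X]natrM p0 !mulr0 add0r divnK.
have a0 : a%:R = 0 :> 'Z_a by exact: pchar_Zp.
have a0' : a%:R = 0 :> 'F_p by rewrite -(divnK pa) natrM p0 mulr0.
by rewrite (intr_modz _ a0) (intr_modz _ a0') redn.
Qed.

Lemma Zp_redB p (x y : 'Z_a) : prime p -> (p %| a)%N ->
  Zp_red p (x - y) = Zp_red p x - Zp_red p y.
Proof.
move=> pp pa; have -> : x - y = ((x : nat)%:Z - (y : nat)%:Z)%:~R.
  by rewrite rmorphB /= -!pmulrn !Zp_nat_natr.
by rewrite Zp_red_intr // rmorphB.
Qed.

Lemma Zp_redM p (x : 'Z_a) n : prime p -> (p %| a)%N ->
  Zp_red p (x *+ n) = Zp_red p x *+ n.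
Proof.
move=> pp pa; have -> : x *+ n = ((x : nat)%:Z * n%:Z)%:~R.
  by rewrite rmorphM /= -!pmulrn !Zp_nat_natr mulr_natr.
by rewrite Zp_red_intr // rmorphM /= -!pmulrn mulr_natr.
Qed.

Lemma Zp_red_eq0 p (x : 'Z_a) : prime p -> (p %| a)%N -> Zp_red p x = 0 ->
  x = (x %/ p)%:R *+ p.
Proof.
move=> pp pa /eqP; rewrite /Zp_red -(dvdn_pcharf (pchar_Fp pp)) => px.
by rewrite -[LHS]Zp_nat_natr -{1}(divnK px) natrM mulr_natr.
Qed.

Lemma Zp_mulrn_a (x : 'Z_a) : x *+ a = 0.
Proof. by rewrite -mulr_natr pchar_Zp ?mulr0. Qed.

Lemma liftmx_intr m n (A : 'M[int]_(m, n)) :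
  exists C, liftmx (map_mx intr A) = A + a%:Z *: C.
Proof.
exists (\matrix_(i, j) - (A i j %/ a)%Z); apply/matrixP => i j; rewrite !mxE.
have aN : (a != 0)%N by rewrite -lt0n ltnW.
rewrite mulrN; apply/eqP; rewrite eq_sym subr_eq; apply/eqP.
rewrite [LHS](divz_eq _ a) addrC mulrC; congr (_ + _).
have a0 : a%:R = 0 :> 'Z_a by exact: pchar_Zp.
rewrite (intr_modz _ a0) val_Zp_nat // modn_small ?gez0_abs ?modz_ge0 //.
by rewrite -ltz_nat gez0_abs ?modz_ge0 // ltz_pmod // ltz_nat ltnW.
Qed.

Variable T : seq nat.
Hypothesis T_prime : forall p, p \in T -> prime p.
Hypothesis T_dvd : forall p, p \in T -> (p %| a)%N.
Hypothesis T_all : forall p, prime p -> (p %| a)%N -> p \in T.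

Section Annihilator.
Variables (r N : nat) (K : {set 'M['Z_a]_(r, N)}).
Hypothesis K0 : 0 \in K.
Hypothesis KB : {in K &, forall x y, x - y \in K}.

Let KD : {in K &, forall x y, x + y \in K}.
Proof.
move=> x y xK yK; rewrite -[y]opprK KB //.
by rewrite -sub0r KB.
Qed.

Let KM x n : x \in K -> x *+ n \in K.
Proof. by move=> xK; elim: n => [|n IH]; rewrite ?mulr0n // mulrS KD. Qed.

(** Nakayama's lemma by induction on the divisors [d] of [a], removing one prime at a time; for
    [d = a] the remainder [h' *+ a] vanishes. *)
Lemma nakayama_Zp : (forall p, p \in T -> forall h, exists2 k, k \in K &
    exists h', h = k + h' *+ p) -> forall h, h \in K.
Proof.
move=> HK.
have main d : (d %| a)%N -> forall h, exists2 k, k \in K & exists h', h = k + h' *+ d.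
  elim/ltn_ind: d => d IH da h.
  have [d1|d1] := leqP d 1.
    have -> : d = 1%N.
      by case: d d1 da {IH} => [|[|]] // _; rewrite dvd0n => /eqP E; move: a1; rewrite {1}E.
    by exists 0 => //; exists h; rewrite add0r.
  have pp := pdiv_prime d1; have pd := pdiv_dvd d.
  have pT : pdiv d \in T by rewrite T_all // (dvdn_trans pd).
  have [k kK [h' ->]] := HK _ pT h.
  have [||k' k'K [h'' ->]] := IH (d %/ pdiv d)%N _ _ h'.
  - by rewrite ltn_Pdiv ?prime_gt1 // ltnW.
  - by apply: dvdn_trans da; apply/dvdnP; exists (pdiv d); rewrite mulnC divnK.
  exists (k + k' *+ pdiv d); first by rewrite KD ?KM.
  by exists h''; rewrite mulrnDl -mulrnA divnK // addrA.
move=> h; have [k kK [h' ->]] := main a (dvdnn a) h.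
have -> : h' *+ a = 0; last by rewrite addr0.
by apply/matrixP => i j; rewrite mulmxnE Zp_mulrn_a mxE.
Qed.

(** By Nakayama, [K] stays proper modulo some [p], and over a field a proper subspace is killed by a
    nonzero linear form, written here as a trace pairing with [u]. *)
Lemma proper_annihilator : K != [set: _] ->
  exists2 p, p \in T & exists2 u : 'M['F_p]_(r, N), u != 0 &
    forall k, k \in K -> \tr (map_mx (Zp_red p) k *m u^T) = 0.
Proof.
move=> KT; apply/not_exists2P => Hno.
case/negP: KT; apply/eqP/setP => h; rewrite in_setT; apply: nakayama_Zp => p pT {}h.
have pp := T_prime pT; have pa := T_dvd pT.
(* These rows span the reduction of [K]; elements outside [K] contribute zero rows. *)
pose Wr (i : 'I_#|{: 'M['Z_a]_(r, N)}|) : 'rV['F_p]_(r * N) :=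
  if enum_val i \in K then mxvec (map_mx (Zp_red p) (enum_val i)) else 0.
pose W := \matrix_i Wr i.
have rowW k : k \in K -> (mxvec (map_mx (Zp_red p) k) <= W)%MS.
  move=> kK; have -> : mxvec (map_mx (Zp_red p) k) = row (enum_rank k) W.
    by rewrite rowK /Wr enum_rankK kK.
  exact: row_sub.
have [|nsub] := boolP (mxvec (map_mx (Zp_red p) h) <= W)%MS.
  case/submxP => c Ec.
  (* The coefficients in ['F_p] are lifted to natural numbers, so that the combination is formed
     inside [K]. *)
  pose k := \sum_i (if enum_val i \in K then enum_val i else 0) *+ (c 0 i : nat).
  have kK : k \in K.
    rewrite /k; apply: (big_ind (fun x => x \in K)) => // i _.
    by apply: KM; case: ifP.
  have redk : map_mx (Zp_red p) h = map_mx (Zp_red p) k.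
    apply: (can_inj mxvecK); rewrite Ec mulmx_sum_row /k.
    have redD (x y : 'M['Z_a]_(r, N)) : map_mx (Zp_red p) (x - y) =
        map_mx (Zp_red p) x - map_mx (Zp_red p) y.
      by apply/matrixP => i j; rewrite !mxE Zp_redB.
    have red0 : map_mx (Zp_red p) (0 : 'M['Z_a]_(r, N)) = 0.
      by have := redD 0 0; rewrite !subrr.
    have redA (x y : 'M['Z_a]_(r, N)) : map_mx (Zp_red p) (x + y) =
        map_mx (Zp_red p) x + map_mx (Zp_red p) y.
      by rewrite -[in RHS](addrK y x) redD subrK.
    rewrite (big_morph _ redA red0) linear_sum; apply: eq_bigr => i _.
    rewrite rowK /Wr; case: ifP => _; last first.
      by rewrite mul0rn red0 scaler0 linear0.
    rewrite -[in LHS](natr_Zp (c 0 i)) scaler_nat -linearMn /=; congr mxvec.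
    apply/matrixP => i' j'; rewrite [RHS]mxE !mulmxnE mxE Zp_redM //.
  pose hk := h - k.
  exists k => //; exists (\matrix_(i, j) (hk i j %/ p)%N%:R).
  apply/matrixP => i j; rewrite !mxE mulmxnE mxE -(@Zp_red_eq0 p) //.
    by rewrite !mxE addrC subrK.
  by rewrite !mxE Zp_redB //; move/matrixP/(_ i j): redk; rewrite !mxE => ->; rewrite subrr.
exfalso; move: nsub; rewrite submxE => /eqP nz.
have [j nzj] : exists j, (mxvec (map_mx (Zp_red p) h) *m cokermx W) 0 j != 0.
  by apply/rV0Pn/eqP.
pose u : 'M['F_p]_(r, N) := vec_mx (col j (cokermx W))^T.
have trE (k : 'M['F_p]_(r, N)) : \tr (k *m u^T) = (mxvec k *m cokermx W) 0 j.
  rewrite /mxtrace mxE (reindex _ (curry_mxvec_bij _ _)) /=.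
  under eq_bigr => i _ do rewrite mxE.
  by rewrite pair_bigA; apply: eq_bigr => -[i i'] _ /=; rewrite mxvecE !mxE.
case: (Hno p) => [/(_ pT)//|[]]; exists u.
  apply: contra nzj => /eqP u0; rewrite -trE u0 trmx0 mulmx0 mxtrace0 //.
move=> k kK; rewrite trE.
by have := rowW k kK; rewrite submxE => /eqP ->; rewrite mxE.
Qed.

End Annihilator.

End Residues.

Definition row_supp (F : nmodType) n (v : 'rV[F]_n) : {set 'I_n} :=
  [set i | v 0 i != 0].

Lemma eq_natr_Fp p (x y : nat) : prime p ->
  (x%:R == y%:R :> 'F_p) = (x == y %[mod p])%N.
Proof.
move=> pp; rewrite -subr_eq0.
have -> : x%:R - y%:R = (x%:Z - y%:Z)%:~R :> 'F_p by rewrite rmorphB.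
by rewrite -(dvdz_pcharf (pchar_Fp pp)) -eqz_mod_dvd !modz_nat eqz_nat.
Qed.

(** * Comparison with a uniform matrix *)

Section Coupling.
Variables (R : realFieldType) (a : nat).
Hypothesis a1 : (1 < a)%N.
Variable T : seq nat.
Hypothesis T_prime : forall p, p \in T -> prime p.
Hypothesis T_dvd : forall p, p \in T -> (p %| a)%N.
Hypothesis T_all : forall p, prime p -> (p %| a)%N -> p \in T.
Variables (b r N : nat).
Notation I := ('I_(b + r) * 'I_(b + N))%type.
Notation H := 'M['Z_a]_(r, N).
Variable mu : I -> 'Z_a -> R.
Hypothesis muW : weights mu.
Variable eps : R.
Hypothesis eps0 : 0 < eps.
Hypothesis eps1 : eps <= 1.
Let J0 : {set I} := [set ij : I | (b <= ij.2)%N].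
Hypothesis bal : forall i p c, i \in J0 -> p \in T ->
  \sum_(x : 'Z_a | (x %% p == c)%N) mu i x <= 1 - eps.

Definition mx_of (f : {ffun I -> 'Z_a}) : 'M[int]_(b + r, b + N) :=
  liftmx (\matrix_(i, j) f (i, j)).

(** The contribution of entry [(i, rshift b l)] to [phi A]: column [i] of [phi], placed in column
    [l]. Entries of the first [b] columns contribute 0. *)
Let g (phi : 'M[int]_(r, b + r)) (ij : I) : H :=
  \matrix_(k, l) ((phi k ij.1)%:~R *+ (ij.2 == rshift b l)).

Let psum_phi phi f :
  psum (g phi) (fun x : 'Z_a => x : nat) J0 f =
  map_mx intr (phi *m rsubmx (mx_of f)).
Proof.
apply/matrixP => k l; rewrite /psum summxE !mxE.
rewrite big_mkcond; transitivity (\sum_i \sum_j (if (i, j) \in J0 then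
    (g phi (i, j) *+ (f (i, j) : nat)) k l else 0)).
  by rewrite pair_bigA; apply: eq_bigr => -[].
rewrite rmorph_sum.
apply: eq_bigr => i _; rewrite (bigD1 (rshift b l)) //= big1 => [|j jl].
  by rewrite inE /= leq_addr addr0 mulmxnE !mxE eqxx mulr1n rmorphM /=
     -pmulrn mulr_natr.
by case: ifP => // _; rewrite mulmxnE mxE /= (negbTE jl) mulr0n mul0rn.
Qed.

(** A proper [K] is killed by a trace pairing with some nonzero [u] modulo some [p]. If column [l0]
    of [u] is nonzero, entry [(i, rshift b l0)] separates [K] as soon as the combination of the rows
    of [phi] with that column as coefficients is nonzero at [i]. The support of this combination
    counts such [i]. *)
Lemma code_spread (phi : 'M[int]_(r, b + r)) m :
  (forall p, p \in T -> forall u : 'rV['F_p]_r, u != 0 ->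
    (m <= #|row_supp (u *m map_mx intr phi)|)%N) ->
  spread (g phi) T J0 m.
Proof.
move=> Hphi K K0 KB KT.
have [p pT [u /matrix0Pn[k0 [l0 u0]] Hu]] :=
  proper_annihilator a1 T_prime T_dvd T_all K0 KB KT.
have pp := T_prime pT; have pa := T_dvd pT.
exists p => //; pose w := (col l0 u)^T *m map_mx intr phi.
have /(Hphi p pT)Hm : (col l0 u)^T != 0.
  by apply: contraNneq u0 => /rowP/(_ k0); rewrite !mxE => ->.
apply: leq_trans Hm _.
rewrite -(card_imset _ (f := fun i => (i, rshift b l0))); last by move=> i j [].
apply: subset_leq_card; apply/fintype.subsetP => _ /imsetP[i wi ->].
rewrite /row_supp inE in wi; rewrite inE; apply/andP; split; first by rewrite inE /= leq_addr.
apply/asboolP => x y nxy; apply/negP => /Hu.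
have -> : map_mx (@Zp_red a p) (g phi (i, rshift b l0) *+ x - g phi (i, rshift b l0) *+ y) =
    (x%:R - y%:R) *: \matrix_(k, l) ((phi k i)%:~R *+ (l == l0)).
  apply/matrixP => k l; rewrite !mxE Zp_redB // !mulmxnE !Zp_redM // !mxE /=.
  rewrite Zp_redM // Zp_red_intr // mulrBl !mulr_natl.
  by rewrite (inj_eq (@rshift_inj _ _)) eq_sym.
rewrite -scalemxAl linearZ /=; apply/eqP; rewrite mulf_neq0 //.
  by rewrite subr_eq0 eq_natr_Fp.
suff -> : \tr (\matrix_(k, l) ((phi k i)%:~R *+ (l == l0)) *m u^T) = w 0 i.
  exact: wi.
rewrite mxE; apply: eq_bigr => k _; rewrite !mxE (bigD1 l0) //= big1 => [|l ll].
  by rewrite !mxE eqxx mulr1n addr0 mulrC.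
by rewrite !mxE (negbTE ll) mulr0n mul0r.
Qed.

Let kappa : R := (eps / #|'Z_a|%:R) ^+ #|H|.
Let delta (s : nat) : R := (1 - kappa * #|H|%:R) ^+ s.

Lemma kappa_card : 0 <= 1 - kappa * #|H|%:R.
Proof.
rewrite subr_ge0 /kappa.
have X2 : (1 < #|'Z_a|)%N by rewrite card_ord.
have X0 : 0 < #|'Z_a|%:R :> R by rewrite ltr0n ltnW.
(* It is enough that [eps / #|'Z_a|%:R] is at most one half and that [#|H| <= 2 ^ #|H|]. *)
apply: (@le_trans _ _ (2^-1 ^+ #|H| * #|H|%:R)).
  apply: ler_wpM2r => //; apply: lerXn2r; rewrite ?nnegrE ?invr_ge0 ?ler0n //.
    by rewrite divr_ge0 // ltW.
  rewrite ler_pdivrMr // (le_trans eps1) // ler_pdivlMl ?ltr0n // mulr1.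
  by rewrite ler_nat.
rewrite exprVn ler_pdivrMl ?exprn_gt0 ?ltr0n // mulr1 -natrX ler_nat.
exact: ltnW (ltn_expl _ _).
Qed.

Definition ufrac (D : H -> Prop) : R := #|[set U | `[< D U >]]|%:R / #|H|%:R.

Lemma ufrac_ge0 D : 0 <= ufrac D.
Proof. by rewrite divr_ge0. Qed.

Lemma ufrac_le1 D : ufrac D <= 1.
Proof.
rewrite /ufrac ler_pdivrMr ?mul1r ?ler_nat ?max_card //.
by rewrite ltr0n; apply/card_gt0P; exists 0.
Qed.

Lemma coupling (phi : 'M[int]_(r, b + r)) s (D : H -> Prop) :
  (forall p, p \in T -> forall u : 'rV['F_p]_r, u != 0 ->
    (s * #|H| <= #|row_supp (u *m map_mx intr phi)|)%N) ->
  `|Pr mu (fun f => D (map_mx intr (phi *m rsubmx (mx_of f)))) - ufrac D| <=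
  #|H|%:R * delta s.
Proof.
move=> Hphi; pose vl (x : 'Z_a) : nat := x.
have -> : Pr mu (fun f => D (map_mx intr (phi *m rsubmx (mx_of f)))) =
    \sum_(U | `[< D U >]) law mu (g phi) vl J0 U.
  rewrite PrE [RHS]big_mkcond.
  transitivity (\sum_f Wt mu f * (`[< D (psum (g phi) vl J0 f) >])%:R).
    by apply: eq_bigr => f _; rewrite psum_phi.
  rewrite (sum_psum mu (g phi) vl J0 (fun U => (`[< D U >])%:R)).
  by apply: eq_bigr => U _; case: `[< _ >]; rewrite ?mulr1 ?mulr0.
have -> : ufrac D = \sum_(U | `[< D U >]) #|H|%:R^-1.
  rewrite /ufrac sumr_const -[RHS]mulr_natl; congr (_%:R * _).
  by apply: eq_card => U; rewrite inE.
rewrite -sumrB; apply: le_trans (ler_norm_sum _ _ _) _.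
have osc U : `|law mu (g phi) vl J0 U - #|H|%:R^-1| <= delta s.
  exact: (equidistribution muW eps0 eps1 bal U (fintype.subxx _) (code_spread Hphi)).
have d0 : 0 <= delta s by apply: le_trans (osc 0).
have -> : #|H|%:R * delta s = \sum_(U : H) delta s.
  by rewrite sumr_const mulr_natl.
rewrite big_mkcond; apply: ler_sum => U _.
by case: ifP.
Qed.

(** The first condition feeds [smith_reduction]. The second applies to the vectors [u *m phi], which
    kill the first columns, and gives the supports required by [coupling]. *)
Definition good m (f : {ffun I -> 'Z_a}) : Prop := forall p, p \in T ->
  (forall c : 'cV['F_p]_b, map_mx intr (lsubmx (mx_of f)) *m c = 0 -> c = 0) /\
  (forall v : 'rV['F_p]_(b + r), v != 0 ->
     v *m map_mx intr (lsubmx (mx_of f)) = 0 -> (m <= #|row_supp v|)%N).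

(** [phi] depends only on the first [b] columns of [f], so it stays fixed while the last columns are
    resampled from [h]; this is what allows [coupling] to be applied conditionally. *)
Lemma good_reduction m (f : {ffun I -> 'Z_a}) : good m f ->
  exists phi : 'M[int]_(r, b + r),
  [/\ forall p, p \in T -> forall u : 'rV['F_p]_r, u != 0 ->
        (m <= #|row_supp (u *m map_mx intr phi)|)%N,
      forall (G : zmodType) h, presentable a G (mx_of (merge J0 h f)) <->
        presentable a G (liftmx (map_mx intr (phi *m rsubmx (mx_of h)) : H))
    & forall p h, (p %| a)%N -> degenerate a p (mx_of (merge J0 h f)) ->
        degenerate a p (liftmx (map_mx intr (phi *m rsubmx (mx_of h)) : H))].
Proof.
move=> gf; have a0 : (0 < a)%N by exact: ltnW.
have [phi [phi0 phiI phiP phiD]] := @smith_reduction a b r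
  (lsubmx (mx_of f)) a0 (fun p pp pa => (gf p (T_all pp pa)).1).
have E h : mx_of (merge J0 h f) = row_mx (lsubmx (mx_of f)) (rsubmx (mx_of h)).
  apply/matrixP => i j; rewrite !mxE; case: splitP => j' Ej; rewrite !mxE ffunE inE /= Ej.
    by rewrite leqNgt ltn_ord /=; congr (f (_, _) : nat)%:Z; apply: val_inj.
  by rewrite leq_addr; congr (h (_, _) : nat)%:Z; apply: val_inj.
exists phi; split.
- move=> p pT u u0; apply: (gf p pT).2.
    by apply: contraNneq u0 => /(phiI p (T_prime pT)) ->.
  by rewrite -mulmxA -map_mxM phi0 map_mx0 mulmx0.
- move=> G h; rewrite E phiP.
  have [C ->] := liftmx_intr a1 (phi *m rsubmx (mx_of h)).
  split=> -[k Hk]; exists k; first exact: presents_congr.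
  have := presents_congr (- C) Hk.
  by rewrite scalerN addrK.
move=> p h pa; rewrite E => /(phiD p _ _ pa).
have [C ->] := liftmx_intr a1 (phi *m rsubmx (mx_of h)).
exact: degenerate_congr.
Qed.

(** Conditionally on the first columns, good ones are handled by [coupling] and bad ones are charged
    their whole probability. *)
Lemma presentable_near_uniform (G : zmodType) s :
  `|Pr mu (fun f => presentable a G (mx_of f)) -
    ufrac (fun U => presentable a G (liftmx U))| <=
  #|H|%:R * delta s + Pr mu (fun f => ~ good (s * #|H|) f).
Proof.
rewrite (Pr_resample muW J0) -[ufrac _]mul1r -{1}(sum_Wt muW) mulr_suml -sumrB.
apply: le_trans (ler_norm_sum _ _ _) _.
rewrite [X in _ + X]PrE -[X in X + _]mul1r -{1}(sum_Wt muW) mulr_suml -big_split /=.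
apply: ler_sum => f _; rewrite -mulrBr normrM ger0_norm ?Wt_ge0 // -mulrDr.
apply: ler_wpM2l; first exact: Wt_ge0.
have d0 : 0 <= #|H|%:R * delta s.
  by rewrite mulr_ge0 // exprn_ge0 // kappa_card.
case: asboolP => [_|/contrapT /good_reduction[phi [Hphi HG _]]].
  rewrite /= ler_norml; apply/andP; split.
    have := ufrac_le1 (fun U => presentable a G (liftmx U)).
    by have := Pr_ge0 muW (fun h => presentable a G (mx_of (merge J0 h f))); lra.
  have := ufrac_ge0 (fun U => presentable a G (liftmx U)).
  by have := Pr_le1 muW (fun h => presentable a G (mx_of (merge J0 h f))); lra.
rewrite /= addr0 (eq_Pr muW (HG G)).
exact: (coupling (fun U => presentable a G (liftmx U)) Hphi).
Qed.

Lemma degenerate_near_uniform p s : (p %| a)%N ->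
  Pr mu (fun f => degenerate a p (mx_of f)) <=
  ufrac (fun U => degenerate a p (liftmx U)) +
  (#|H|%:R * delta s + Pr mu (fun f => ~ good (s * #|H|) f)).
Proof.
move=> pa.
have d0 : 0 <= #|H|%:R * delta s.
  by rewrite mulr_ge0 // exprn_ge0 // kappa_card.
have u0 := ufrac_ge0 (fun U => degenerate a p (liftmx U)).
set c := #|H|%:R * _ in d0 *; set u := ufrac _ in u0 *.
rewrite (Pr_resample muW J0) addrA -[u + c]mul1r -(sum_Wt muW) mulr_suml.
rewrite [X in _ + X]PrE -big_split /=; apply: ler_sum => f _; rewrite -mulrDr.
apply: ler_wpM2l; first exact: Wt_ge0.
case: asboolP => [_|/contrapT /good_reduction[phi [Hphi _ HD]]].
  by rewrite /=; apply: le_trans (Pr_le1 muW _) _; lra.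
rewrite /= addr0.
apply: le_trans (le_Pr muW (fun h => HD p h pa)) _.
have := coupling (fun U => degenerate a p (liftmx U)) Hphi.
rewrite -/c -/u => /(le_trans (ler_norm _)); rewrite lerBlDr addrC.
exact.
Qed.

End Coupling.

(** * Rank and sparse kernel vectors of the first columns of a staircase matrix *)

Lemma geometric_tail (R : realFieldType) (q : R) (m B : nat) : 0 <= q -> q < 1 ->
  \sum_(j < m | (j < B)%N) q ^+ (B - j) <= (1 - q)^-1.
Proof.
move=> q0 q1; have q1' : 0 < 1 - q by rewrite subr_gt0.
rewrite -[leRHS]mul1r ler_pdivlMr //.
(* The form that passes through the induction; its step amounts to [0 <= (1 - q) ^+ 2]. *)
suff : (\sum_(j < m | (j < B)%N) q ^+ (B - j)) * (1 - q) <= q ^+ (B - m).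
  by move/le_trans; apply; rewrite exprn_ile1 // ltW.
elim: m => [|m IH]; first by rewrite big_ord0 mul0r exprn_ge0.
rewrite big_mkcond big_ord_recr -big_mkcond /=; case: ifP => mB; last first.
  rewrite addr0; apply: le_trans IH _.
  have -> : (B - m.+1 = 0)%N by lia.
  by have -> : (B - m = 0)%N by lia.
have E : (B - m = (B - m.+1).+1)%N by lia.
rewrite E exprS in IH *; have := exprn_ge0 (B - m.+1) q0.
move: IH; set s := \sum_(_ < _ | _) _; set x := q ^+ _ => IH x0.
rewrite mulrDl; apply: le_trans (lerD IH (lexx _)) _.
have : 0 <= x * (1 - q) ^+ 2 by rewrite mulr_ge0 // sqr_ge0.
by rewrite expr2; lra.
Qed.

(** Induction on [m]: one more nonzero coordinate is a choice of position and value, and [None]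
    stands for no change, whence the successor in the base. *)
Lemma card_sparse (F : finNzRingType) n m :
  (#|[set v : 'rV[F]_n | (#|row_supp v| <= m)%N]| <= (n * #|F|).+1 ^ m)%N.
Proof.
elim: m => [|m IH].
  rewrite expn0; apply: (@leq_trans #|[set (0 : 'rV[F]_n)]|); last by rewrite cards1.
  apply: subset_leq_card.
  apply/fintype.subsetP => v; rewrite !inE leqn0 cards_eq0 => /eqP/setP E.
  by apply/eqP/rowP => i; have := E i; rewrite !inE mxE => /negbFE/eqP.
pose add1 (x : 'rV[F]_n * option ('I_n * F)) : 'rV[F]_n :=
  x.1 + if x.2 is Some ic then ic.2 *: delta_mx 0 ic.1 else 0.
set B := [set v : 'rV[F]_n | (#|row_supp v| <= m)%N] in IH.
apply: (@leq_trans #|add1 @: setX B [set: option ('I_n * F)]|); last first.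
  apply: leq_trans (leq_imset_card _ _) _.
  rewrite cardsX cardsT card_option card_prod card_ord expnSr.
  by rewrite leq_mul2r IH orbT.
apply: subset_leq_card; apply/fintype.subsetP => v; rewrite inE => cv.
have [E|[i iv]] := set_0Vmem (row_supp v).
  apply/imsetP; exists (v, None); last by rewrite /add1 addr0.
  by rewrite !inE E cards0.
apply/imsetP; exists (v - v 0 i *: delta_mx 0 i, Some (i, v 0 i)); last first.
  by rewrite /add1 subrK.
rewrite !inE andbT -ltnS; apply: leq_trans cv; apply: proper_card.
apply/properP; split; last first.
  by exists i => //; rewrite !inE !mxE !eqxx mulr1 subrr eqxx.
apply/fintype.subsetP => j; rewrite !inE !mxE eqxx /=.
by case: (eqVneq j i) => [->|]; rewrite ?mulr1 ?subrr ?eqxx // mulr0 subr0.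
Qed.

Lemma card_ord_lt n c : (#|[set i : 'I_n | (i < c)%N]| <= c)%N.
Proof.
have [nc|cn] := leqP n c; first by rewrite (leq_trans (max_card _)) ?card_ord.
apply: (@leq_trans #|[set widen_ord (ltnW cn) j | j in 'I_c]|); last first.
  by rewrite (leq_trans (leq_imset_card _ _)) ?card_ord.
apply: subset_leq_card; apply/fintype.subsetP => i; rewrite inE => ic.
by apply/imsetP; exists (Ordinal ic) => //; apply: val_inj.
Qed.

Lemma sum_seq_le_const (R : realFieldType) (A : eqType) (s : seq A) (F : A -> R) c :
  {in s, forall l, F l <= c} -> \sum_(l <- s) F l <= (size s)%:R * c.
Proof.
elim: s => [|x s IH] H; first by rewrite big_nil mul0r.
rewrite big_cons /= -natr1 mulrDl mul1r addrC lerD ?H ?mem_head //.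
by apply: IH => l ls; rewrite H // inE ls orbT.
Qed.

Section Stairs.
Variables (R : realFieldType) (a : nat).
Hypothesis a1 : (1 < a)%N.
Variable T : seq nat.
Hypothesis T_prime : forall p, p \in T -> prime p.
Variables (b r N : nat).
Notation I := ('I_(b + r) * 'I_(b + N))%type.
Variable mu : I -> 'Z_a -> R.
Hypothesis muW : weights mu.
Variable q : R.
Hypothesis q0 : 0 <= q.
Hypothesis q1 : q < 1.
Variables (k : nat) (alpha beta : nat -> nat) (w : nat).
Hypothesis rw : (r <= w)%N.
Hypothesis gap : forall l, (1 <= l <= k)%N ->
  (alpha l + beta l + w <= b + r)%N.

Definition stairs_free (i j : nat) : bool :=
  all (fun l => ~~ ((i < alpha l) && (j < beta l)))%N (seq.iota 1 k).

Hypothesis bal : forall (ij : I) p c, stairs_free ij.1 ij.2 -> p \in T ->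
  \sum_(x : 'Z_a | (x %% p == c)%N) mu ij x <= q.

Let bal_Fp (ij : I) p (c : 'F_p) : stairs_free ij.1 ij.2 -> p \in T ->
  \sum_(x : 'Z_a | (x : nat)%:R == c) mu ij x <= q.
Proof.
move=> fij pT; rewrite -(natr_Zp c).
under eq_bigl => x do rewrite eq_natr_Fp ?T_prime //.
exact: bal.
Qed.

(* The longest row or column of zeros through a given index is cut by a single
   step, and summing over all steps avoids singling it out. *)
Lemma stairs_free_bound (m n j : nat) (al be : nat -> nat) (S : {set 'I_n}) :
  (forall i, i \notin S -> has (fun l => (i < al l) && (j < be l))%N (seq.iota 1 k)) ->
  q ^+ (#|S| - m) <=
  (if has (fun l => j < be l)%N (seq.iota 1 k) then 0 else q ^+ (n - m)) +
  \sum_(l <- seq.iota 1 k | (j < be l)%N) q ^+ (n - al l - m).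
Proof.
move=> HS; case: ifP => Hhas; last first.
  have -> : S = [set: _].
    apply/setP => i; rewrite inE; apply: contraFT Hhas => /HS.
    by apply: sub_has => l /andP[].
  rewrite cardsT card_ord lerDl.
  by apply: sumr_ge0 => l _; exact: exprn_ge0.
rewrite add0r.
have [l [lk jl Hl]] : exists l, [/\ l \in seq.iota 1 k, (j < be l)%N &
    forall l', l' \in seq.iota 1 k -> (j < be l')%N -> (al l' <= al l)%N].
  have /hasP[l0 l0k jl0] := Hhas.
  pose s := [seq l <- seq.iota 1 k | (j < be l)%N].
  have l0s : l0 \in s by rewrite mem_filter jl0.
  pose x0 := Ordinal (etrans (index_mem l0 s) l0s).
  case: (@arg_maxnP _ x0 predT (fun x : 'I_(size s) => al (nth 0%N s x)) isT) => x _ Hx.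
  have : nth 0%N s x \in s by rewrite mem_nth.
  rewrite mem_filter => /andP[jx xk]; exists (nth 0%N s x); split=> // l' l'k jl'.
  have l's : l' \in s by rewrite mem_filter jl'.
  have := Hx (Ordinal (etrans (index_mem l' s) l's)) isT.
  by rewrite /= nth_index.
rewrite (big_rem l) //= jl.
apply: (@le_trans _ _ (q ^+ (n - al l - m))); last first.
  by rewrite lerDl; apply: sumr_ge0 => l' _; exact: exprn_ge0.
apply: ler_wiXn2l => //; first exact: ltW.
apply: leq_sub2r; rewrite leq_subLR {1}(esym (card_ord n)) -(cardsC S).
rewrite addnC leq_add2r.
apply: (@leq_trans #|[set i : 'I_n | (i < al l)%N]|).
  apply: subset_leq_card; apply/fintype.subsetP => i; rewrite !inE => /HS.
  by case/hasP => l' l'k /andP[il' jl']; exact: leq_trans (Hl l' l'k jl').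
exact: card_ord_lt.
Qed.

(** Odlyzko's bound for the columns in order. A column meeting no step has exponent [r + (b - j)]. A
    step covering column [j] contributes exponent at least [w + (beta l - j)], by the gap
    hypothesis. Both families sum as geometric series. *)
Lemma Pr_columns_dependent p : p \in T ->
  Pr mu (fun f => exists2 c : 'cV['F_p]_b, c != 0 &
    map_mx intr (lsubmx (mx_of f)) *m c = 0) <=
  (1 - q)^-1 * (q ^+ r + k%:R * q ^+ w).
Proof.
move=> pT; pose io (j : 'I_b) (i : 'I_(b + r)) : I := (i, lshift N j).
pose S (j : 'I_b) := [set i : 'I_(b + r) | stairs_free i j].
pose rho (x : 'Z_a) : 'F_p := (x : nat)%:R.
apply: (@le_trans _ _ (\sum_j q ^+ (#|S j| - j))).
  have io_inj j i j' i' : io j i = io j' i' -> j = j' /\ i = i'.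
    by case=> -> /val_inj ->.
  have free j i (c : 'F_p) : i \in S j -> \sum_(x | rho x == c) mu (io j i) x <= q.
    by rewrite inE => fij; apply: bal_Fp.
  apply: le_trans (Pr_rows_dependent muW q0 (ltW q1) io_inj free).
  apply: le_Pr => // f [c c0 Hc]; exists c^T.
    by rewrite -trmx0 (inj_eq trmx_inj).
  apply: trmx_inj; rewrite trmx_mul trmxK trmx0 -[RHS]Hc; congr (_ *m _).
  by apply/matrixP => i j; rewrite !mxE.
apply: (@le_trans _ _ (\sum_(j < b) (q ^+ (b + r - j) +
    \sum_(l <- seq.iota 1 k) if (j < beta l)%N then q ^+ (b + r - alpha l - j) else 0))).
  apply: ler_sum => j _.
  apply: le_trans (@stairs_free_bound j (b + r) j alpha beta (S j) _) _.
    move=> i; rewrite inE /stairs_free -has_predC; apply: sub_has => l /=.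
    by rewrite negbK.
  rewrite big_mkcond lerD2r; case: ifP => // _; exact: exprn_ge0.
rewrite big_split /= mulrDr; apply: lerD.
  apply: (@le_trans _ _ (q ^+ r * \sum_(j < b | (j < b)%N) q ^+ (b - j))).
    rewrite mulr_sumr; under [leRHS]eq_bigl => j do rewrite ltn_ord.
    apply: ler_sum => j _; rewrite -exprD; apply: ler_wiXn2l => //; first exact: ltW.
    by have := ltn_ord j; lia.
  by rewrite mulrC ler_wpM2r ?exprn_ge0 // geometric_tail.
rewrite exchange_big /= mulrCA -[X in X%:R * _](size_iota 1 k).
apply: sum_seq_le_const => l; rewrite mem_iota add1n ltnS => /gap gl.
rewrite -big_mkcond /= mulrC; apply: (@le_trans _ _
    (q ^+ w * \sum_(j < b | (j < beta l)%N) q ^+ (beta l - j))).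
  rewrite mulr_sumr; apply: ler_sum => j jl; rewrite -exprD.
  by apply: ler_wiXn2l => //; [exact: ltW|lia].
by apply: ler_wpM2l; rewrite ?exprn_ge0 // geometric_tail.
Qed.

Definition zero_row (i : nat) : bool := has (fun l => i < alpha l)%N (seq.iota 1 k).

(** The rows meeting the zeros are the first [A] ones, [A] the largest [alpha l], and Odlyzko's
    bound is applied to them with the roles of [alpha] and [beta] exchanged. Only [b] columns are
    available instead of [b + r], so the gap drops from [w] to [w - r]. *)
Lemma Pr_zero_rows_dependent p : p \in T ->
  Pr mu (fun f => exists2 v : 'rV['F_p]_(b + r), v != 0 &
    (forall i, v 0 i != 0 -> zero_row i) /\
    v *m map_mx intr (lsubmx (mx_of f)) = 0) <=
  (1 - q)^-1 * (k%:R * q ^+ (w - r)).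
Proof.
move=> pT; pose A := \max_(l <- seq.iota 1 k) alpha l.
have zrA i : zero_row i = (i < A)%N.
  apply/hasP/idP => [[l lk il]|].
    by apply: leq_trans il _; rewrite /A (big_rem l) //= leq_maxl.
  move=> iA; apply/hasP; apply: contraLR iA; rewrite -all_predC -leqNgt => /allP H.
  rewrite /A; apply/bigmax_leqP_seq => l lk _.
  by have := H l lk; rewrite /= -leqNgt.
have An : (A <= b + r)%N.
  apply/bigmax_leqP_seq => l; rewrite mem_iota add1n ltnS => /gap; lia.
pose wd := widen_ord An.
pose io (i : 'I_A) (j : 'I_b) : I := (wd i, lshift N j).
pose S (i : 'I_A) := [set j : 'I_b | stairs_free i j].
pose rho (x : 'Z_a) : 'F_p := (x : nat)%:R.
apply: (@le_trans _ _ (\sum_i q ^+ (#|S i| - i))).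
  have io_inj i j i' j' : io i j = io i' j' -> i = i' /\ j = j'.
    by case=> Ei /val_inj ->; split=> //; apply: val_inj.
  have free i j (c : 'F_p) : j \in S i -> \sum_(x | rho x == c) mu (io i j) x <= q.
    by rewrite inE => fij; apply: bal_Fp.
  apply: le_trans (Pr_rows_dependent muW q0 (ltW q1) io_inj free).
  apply: le_Pr => // f [v v0 [Hv vA]]; exists (\row_i v 0 (wd i)).
    have /rV0Pn[i vi] := v0; have := Hv i vi; rewrite zrA => iA.
    apply/rV0Pn; exists (Ordinal iA); rewrite mxE.
    by have -> : wd (Ordinal iA) = i by apply: val_inj.
  apply/rowP => j; have := congr1 (fun x : 'rV_b => x 0 j) vA; rewrite !mxE => E.
  rewrite -[RHS]E (bigID (fun i : 'I_(b + r) => (i < A)%N)) /=.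
  rewrite [X in _ = _ + X]big1 ?addr0 => [|i]; last first.
    by rewrite -zrA => nz; rewrite (contraNeq (Hv i) nz) mul0r.
  rewrite (big_ord_narrow An) /=; apply: eq_bigr => i _.
  by rewrite !mxE.
apply: (@le_trans _ _ (\sum_(i < A)
    \sum_(l <- seq.iota 1 k) if (i < alpha l)%N then q ^+ (b - beta l - i) else 0)).
  apply: ler_sum => i _.
  apply: le_trans (@stairs_free_bound i b i beta alpha (S i) _) _.
    move=> j; rewrite inE /stairs_free -has_predC; apply: sub_has => l /=.
    by rewrite negbK andbC.
  have -> : has (fun l => i < alpha l)%N (seq.iota 1 k) by rewrite -/(zero_row i) zrA.
  by rewrite add0r -big_mkcond.
rewrite exchange_big /= mulrCA -[X in X%:R * _](size_iota 1 k).
apply: sum_seq_le_const => l; rewrite mem_iota add1n ltnS => /gap gl.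
rewrite -big_mkcond /= mulrC; apply: (@le_trans _ _
    (q ^+ (w - r) * \sum_(i < A | (i < alpha l)%N) q ^+ (alpha l - i))).
  rewrite mulr_sumr; apply: ler_sum => i il; rewrite -exprD.
  by apply: ler_wiXn2l => //; [exact: ltW|lia].
by apply: ler_wpM2l; rewrite ?exprn_ge0 // geometric_tail.
Qed.

(** Row [i0] lies below all steps, so its entries are all balanced. Given the other rows, each of
    the [b] columns forces the residue of its entry in row [i0]. *)
Lemma Pr_kills p (v : 'rV['F_p]_(b + r)) i0 : p \in T ->
  v 0 i0 != 0 -> ~~ zero_row i0 ->
  Pr mu (fun f => v *m map_mx intr (lsubmx (mx_of f)) = 0) <= q ^+ b.
Proof.
move=> pT vi zi; pose rho (x : 'Z_a) : 'F_p := (x : nat)%:R.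
pose Y : {set I} := [set (i0, lshift N j) | j in 'I_b].
have cY : #|Y| = b by rewrite card_imset ?card_ord // => j j' [/val_inj].
rewrite -[X in _ ^+ X]cY; apply: (Pr_determined muW (rho := rho) q0).
  move=> y c /imsetP[j _ ->]; apply: bal_Fp => //=.
  rewrite /stairs_free; apply: contraR zi; rewrite -has_predC /zero_row.
  by apply: sub_has => l /=; rewrite negbK => /andP[].
move=> f f' Df Df' E _ /imsetP[j _ ->].
have ent h : (v *m map_mx intr (lsubmx (mx_of h))) 0 j =
    v 0 i0 * rho (h (i0, lshift N j)) +
    \sum_(i | i != i0) v 0 i * rho (h (i, lshift N j)).
  by rewrite mxE (bigD1 i0) //=; congr (_ + _); [|apply: eq_bigr => i _];
    rewrite !mxE.
have Ej : v 0 i0 * rho (f (i0, lshift N j)) = v 0 i0 * rho (f' (i0, lshift N j)).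
  have := ent f; have := ent f'; rewrite Df Df' mxE => E1 E2.
  have Es : \sum_(i | i != i0) v 0 i * rho (f (i, lshift N j)) =
      \sum_(i | i != i0) v 0 i * rho (f' (i, lshift N j)).
    apply: eq_bigr => i ii; rewrite E //; apply/imsetP => -[j' _ [Ei _]].
    by rewrite Ei eqxx in ii.
  by apply: (addIr (\sum_(i | i != i0) v 0 i * rho (f (i, lshift N j)))); rewrite -E2 Es -E1.
exact: (mulfI vi).
Qed.

Lemma Pr_sparse_kernel p m : p \in T ->
  Pr mu (fun f => exists2 v : 'rV['F_p]_(b + r), v != 0 &
    v *m map_mx intr (lsubmx (mx_of f)) = 0 /\ (#|row_supp v| <= m)%N) <=
  (1 - q)^-1 * (k%:R * q ^+ (w - r)) + (((b + r) * p).+1 ^ m)%:R * q ^+ b.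
Proof.
move=> pT; have pp := T_prime pT.
pose D (v : 'rV['F_p]_(b + r)) (f : {ffun I -> 'Z_a}) :=
  v *m map_mx intr (lsubmx (mx_of f)) = 0 /\ exists2 i0, v 0 i0 != 0 & ~~ zero_row i0.
apply: (@le_trans _ _ (Pr mu (fun f =>
   (exists2 v : 'rV['F_p]_(b + r), v != 0 & (forall i, v 0 i != 0 -> zero_row i) /\
     v *m map_mx intr (lsubmx (mx_of f)) = 0) \/
   (exists2 v, (#|row_supp v| <= m)%N & D v f)))).
  apply: le_Pr => // f [v v0 [vA vm]].
  have [H|/existsNP[i /not_implyP[vi /negP zi]]] :=
      pselect (forall i, v 0 i != 0 -> zero_row i); first by left; exists v.
  by right; exists v => //; split=> //; exists i.
apply: le_trans (Pr_or muW _ _) _; apply: lerD; first exact: Pr_zero_rows_dependent.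
pose B := [set v : 'rV['F_p]_(b + r) | (#|row_supp v| <= m)%N].
apply: (@le_trans _ _ (\sum_(v in B) Pr mu (D v))).
  apply: Pr_exists => // f [v vm Dv]; apply/hasP; exists v; first exact: mem_index_enum.
  by rewrite inE vm asboolT.
apply: (@le_trans _ _ (\sum_(v in B) q ^+ b)).
  apply: ler_sum => v _.
  have [[i0 vi zi]|none] := pselect (exists2 i0, v 0 i0 != 0 & ~~ zero_row i0).
    by apply: le_trans (Pr_kills pT vi zi); apply: le_Pr => // f [].
  rewrite PrE big1 ?exprn_ge0 // => f _; rewrite asboolF ?mulr0 // => -[_ []//].
  by move=> i0 vi zi; apply: none; exists i0.
rewrite sumr_const -[leLHS]mulr_natl ler_wpM2r ?exprn_ge0 // ler_nat.
by have := card_sparse 'F_p (b + r) m; rewrite card_Fp.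
Qed.

Lemma Pr_not_good m :
  Pr mu (fun f => ~ good T m f) <=
  \sum_(p <- T) ((1 - q)^-1 * (q ^+ r + k%:R * q ^+ w) +
    ((1 - q)^-1 * (k%:R * q ^+ (w - r)) + (((b + r) * p).+1 ^ m)%:R * q ^+ b)).
Proof.
pose D p (f : {ffun I -> 'Z_a}) := (exists2 c : 'cV['F_p]_b, c != 0 &
    map_mx intr (lsubmx (mx_of f)) *m c = 0) \/
  (exists2 v : 'rV['F_p]_(b + r), v != 0 &
    v *m map_mx intr (lsubmx (mx_of f)) = 0 /\ (#|row_supp v| <= m)%N).
apply: (@le_trans _ _ (\sum_(p <- T) Pr mu (D p))).
  apply: Pr_exists => // f /existsNP[p /not_implyP[pT ng]].
  apply/hasP; exists p => //; apply/asboolP; apply: contrapT => nD; apply: ng; split.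
    move=> c Hc; apply/eqP; apply: contrapT => /negP c0; apply: nD; left.
    by exists c.
  move=> v v0 vA; rewrite leqNgt; apply/negP => vm; apply: nD; right.
  by exists v => //; split => //; exact: ltnW.
rewrite big_seq [leRHS]big_seq; apply: ler_sum => p pT.
apply: le_trans (Pr_or muW _ _) _; apply: lerD.
  exact: Pr_columns_dependent.
exact: Pr_sparse_kernel.
Qed.

End Stairs.

(** * Counting presentations by uniform matrices *)

Section AutTorsor.
Variables (a n N : nat) (G : finZmodType) (A : 'M[int]_(n, N)).

Lemma lin_comp_additive (s : G -> G) (g : {ffun 'I_n -> G}) x :
  {morph s : u v / u + v} -> lin [ffun i => s (g i)] x = s (lin g x).
Proof.
move=> sD; have s0 : s 0 = 0 by apply: (addIr (s 0)); rewrite -sD !add0r.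
have sN y : s (- y) = - s y.
  by apply: (addIr (s y)); rewrite -sD !addNr s0.
have sn y k : s (y *+ k) = s y *+ k.
  by elim: k => [|k IH]; rewrite ?mulr0n // !mulrS sD IH.
rewrite /lin (big_morph s sD s0); apply: eq_bigr => i _; rewrite ffunE.
by case: (x i 0) => k; rewrite -?NegzE ?sN ?sn // -?pmulrn ?nmulrn ?sN ?sn.
Qed.

(** Two presenters of [A] are onto with the same kernel, so they differ by a unique automorphism of
    [G]. *)
Lemma card_presenters (g0 : {ffun 'I_n -> G}) : presents a g0 A ->
  #|[set g : {ffun 'I_n -> G} | `[< presents a g A >]]| = #|Aut [set: G]|.
Proof.
case=> gs gk; pose phi (s : {perm G}) := [ffun i => s (g0 i)].
have AutD s : s \in Aut [set: G] -> {morph s : u v / u + v}.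
  move=> sA u v; have := Aut_morphic sA => /morphicP; rewrite -!FinRing.zmodMgE.
  by move=> ->; rewrite ?in_setT.
rewrite -(@card_in_imset _ _ phi [pred s in Aut [set: G]]); last first.
  move=> s s' sA s'A E; apply/permP => y; have [x <-] := gs y.
  by rewrite -!lin_comp_additive; [rewrite -/(phi s) E|exact: AutD|exact: AutD].
apply: eq_card => g; rewrite inE; apply/asboolP/imsetP; last first.
  case=> s sA ->; have sD := AutD _ sA; split.
    move=> y; have [x Ex] := gs ((s^-1)%g y).
    by exists x; rewrite lin_comp_additive // Ex permKV.
  move=> x; rewrite lin_comp_additive // -gk; split=> [E|->].
    apply: (@perm_inj _ s); rewrite E.
    by apply: (addIr (s 0)); rewrite -sD !add0r.
  by apply: (addIr (s 0)); rewrite -sD !add0r.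
case=> hs hk; have /choice[x Hx] := gs.
have Eh u v : lin g0 u = lin g0 v -> lin g u = lin g v.
  move=> E; apply/eqP; rewrite -subr_eq0 -linB; apply/eqP/hk/gk.
  by rewrite linB E subrr.
have Eh' u v : lin g u = lin g v -> lin g0 u = lin g0 v.
  move=> E; apply/eqP; rewrite -subr_eq0 -linB; apply/eqP/gk/hk.
  by rewrite linB E subrr.
pose sf y := lin g (x y).
have sf_inj : injective sf by move=> y y' /Eh'; rewrite !Hx.
have sfD : {morph sf : u v / u + v}.
  by move=> u v; rewrite /sf -linD; apply: Eh; rewrite linD !Hx.
exists (perm sf_inj).
  rewrite unfold_in /= inE; apply/andP; split.
    by apply/fintype.subsetP => y _; rewrite in_setT.
  by apply/morphicP => u v _ _; rewrite !permE FinRing.zmodMgE sfD.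
apply/ffunP => i; rewrite ffunE permE /sf -[g i]lin_delta; apply: Eh.
by rewrite Hx lin_delta.
Qed.

End AutTorsor.

Lemma card_fibers (A B : finZmodType) (f : A -> B) (E : pred B) :
  {morph f : x y / x - y} ->
  (#|[set x | E (f x)]| = #|[set x | (f x == 0)%R]| * #|[set y in f @: A | E y]|)%N.
Proof.
move=> fB; rewrite -sum1_card (partition_big f (fun y => (y \in f @: A) && E y)) /=.
  rewrite mulnC -sum_nat_const; apply: eq_big => [y|y]; first by rewrite inE.
  case/andP => /imsetP[x0 _ ->] Ex0; rewrite sum1_card.
  have f0 : f 0 = 0 by have := fB 0 0; rewrite !subrr.
  rewrite -[RHS](card_imset _ (@addIr _ x0)); apply: eq_card => x.
  rewrite -topredE /= inE; apply/andP/imsetP => [[_ /eqP Ex]|[z]].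
    by exists (x - x0); rewrite ?subrK // inE fB Ex subrr.
  rewrite inE => /eqP fz ->.
  have -> : f (z + x0) = f x0.
    have fN z' : f (- z') = - f z' by have := fB 0 z'; rewrite f0 !sub0r.
    by rewrite -[x0 in LHS]opprK fB fN fz sub0r opprK.
  by rewrite Ex0 eqxx.
by move=> x; rewrite inE => Ex; rewrite imset_f.
Qed.

(** For [h + (f - h) *+ u], membership in [X] sees only [f] and membership in [Y] only [h], so the
    two are independent. Recording [f - h] as well makes the gluing map a bijection. *)
Lemma card_crt (A : finZmodType) (u : nat) (X Y : {set A}) :
  (forall f h, (h + (f - h) *+ u \in X) = (f \in X)) ->
  (forall f h, (h + (f - h) *+ u \in Y) = (h \in Y)) ->
  (#|X| * #|Y| = #|X :&: Y| * #|A|)%N.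
Proof.
move=> HX HY; pose phi (fh : A * A) := (fh.2 + (fh.1 - fh.2) *+ u, fh.1 - fh.2).
have phi_inj : injective phi.
  move=> [f h] [f' h'] [E1 E2]; move: E1; rewrite E2 => /addIr E1.
  by move: E2; rewrite E1 => /addIr ->.
rewrite -cardsX -[in RHS]cardsT -cardsX -(card_imset _ phi_inj).
have phi_bij : bijective phi := injF_bij phi_inj.
case: phi_bij => psi phiK psiK; apply: eq_card => kd.
apply/imsetP/idP => [[[f h]]|].
  by rewrite inE /= => /andP[fX hY] ->; rewrite !inE /= HX HY fX hY.
rewrite !inE andbT => /andP[kX kY]; exists (psi kd); last by rewrite psiK.
have := psiK kd; case: (psi kd) => f h; rewrite /phi /= => E.
by move: kX kY; rewrite -E /= HX HY inE /= => -> ->.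
Qed.

(** Rows are added one at a time, each outside the span of the rows already chosen. *)
Lemma card_row_free (F : finFieldType) r N :
  #|[set C : 'M[F]_(r, N) | row_free C]| = \prod_(i < r) (#|F| ^ N - #|F| ^ i)%N.
Proof.
elim: r => [|r IH].
  rewrite big_ord0 -[RHS](expn0 #|F|) -[X in (_ ^ X)%N](mul0n N) -card_mx.
  rewrite -cardsT; apply: eq_card => C; rewrite !inE /row_free.
  by rewrite eqn_leq rank_leq_row.
pose phi (xC : 'rV[F]_N * 'M[F]_(r, N)) : 'M[F]_(1 + r, N) := col_mx xC.1 xC.2.
have phi_bij : bijective phi.
  exists (fun C : 'M[F]_(1 + r, N) => (usubmx C, dsubmx C)) => [[x C]|C].
    by rewrite /phi /= col_mxKu col_mxKd.
  by rewrite /phi /= vsubmxK.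
have freeE x (C : 'M[F]_(r, N)) : row_free (phi (x, C)) = row_free C && ~~ (x <= C)%MS.
  rewrite /row_free /phi /= -addsmxE; have [xC|nxC] := boolP (x <= C)%MS.
    rewrite andbF (addsmx_idPr xC); apply/negbTE; rewrite neq_ltn.
    by rewrite add1n ltnS rank_leq_row.
  rewrite andbT; have x0 : x != 0 by apply: contraNneq nxC => ->; exact: sub0mx.
  have cap0 : (x :&: C)%MS = 0.
    apply/eqP; rewrite -mxrank_eq0 -leqn0 -ltnS.
    have rx : \rank x = 1%N by rewrite rank_rV x0.
    rewrite -[X in (_ < X)%N]rx ltn_neqAle mxrankS ?capmxSl // andbT.
    apply: contra nxC => /eqP rk.
    have : (x <= x :&: C)%MS by rewrite -(geq_leqif (mxrank_leqif_sup (capmxSl _ _))) rk.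
    by move/submx_trans; apply; exact: capmxSr.
  rewrite mxrank_disjoint_sum // rank_rV x0 /= !add1n eqSS //.
rewrite -(@card_imset _ _ (fun C : 'M[F]_(1 + r, N) => C)) //.
have -> : [set C | row_free (C : 'M[F]_(1 + r, N))] =
    phi @: [set xC | row_free (phi xC)].
  apply/setP => C; rewrite inE; apply/idP/imsetP => [rC|[xC]]; last first.
    by rewrite inE => rC ->.
  case: phi_bij => psi _ psiK; exists (psi C); rewrite ?inE psiK //.
rewrite imset_id card_imset; last exact: bij_inj.
rewrite -sum1_card (eq_bigl (fun xC : 'rV[F]_N * 'M[F]_(r, N) =>
   row_free xC.2 && ~~ (xC.1 <= xC.2)%MS)); last first.
  by case=> x C; rewrite inE freeE.
rewrite (partition_big snd (fun C : 'M[F]_(r, N) => row_free C)) /=; last first.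
  by case=> x C /andP[].
transitivity (\sum_(C : 'M[F]_(r, N) | row_free C) (#|F| ^ N - #|F| ^ r))%N; last first.
  rewrite big_ord_recr /= -IH sum_nat_const; congr (_ * _)%N.
  by apply: eq_card => C; rewrite inE.
apply: eq_bigr => C rC.
rewrite (reindex_onto (fun x => (x, C)) fst) /=; last first.
  by case=> x C' /= /andP[_ /eqP ->].
transitivity #|~: [set x : 'rV[F]_N | (x <= C)%MS]|.
  rewrite -sum1_card; apply: eq_bigl => x; rewrite !inE /= rC !eqxx !andbT //.
have -> : [set x : 'rV[F]_N | (x <= C)%MS] = [set y *m C | y in 'rV[F]_r].
  apply/setP => x; rewrite inE; apply/submxP/imsetP => [[y ->]|[y _ ->]]; by exists y.
have := cardsC [set y *m C | y in 'rV[F]_r].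
rewrite card_imset; last exact: row_free_inj.
by rewrite !card_mx !mul1n => <-; rewrite addKn.
Qed.

Lemma lin_mulrn_eq0 (G : zmodType) (c n : nat) (g : {ffun 'I_n -> G}) x :
  (forall y : G, y *+ c = 0) -> lin g (c%:Z *: x) = 0.
Proof. by move=> cG; rewrite linZ -pmulrn cG. Qed.

Lemma lin_congr (G : zmodType) (c n : nat) (g : {ffun 'I_n -> G}) x z :
  (forall y : G, y *+ c = 0) -> lin g (x + c%:Z *: z) = lin g x.
Proof. by move=> cG; rewrite linD lin_mulrn_eq0 // addr0. Qed.

Lemma map_liftmx (a : nat) m n (U : 'M['Z_a]_(m, n)) : map_mx intr (liftmx U) = U.
Proof. by apply/matrixP => i j; rewrite !mxE -pmulrn Zp_nat_natr. Qed.

Lemma map_intr_Zp_eq0 (a : nat) m n (A : 'M[int]_(m, n)) : (1 < a)%N ->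
  map_mx intr A = 0 :> 'M['Z_a]_(m, n) -> exists C, A = a%:Z *: C.
Proof.
move=> a1 A0; have [C] := liftmx_intr a1 A; rewrite A0.
have -> : liftmx (0 : 'M['Z_a]_(m, n)) = 0 by apply/matrixP => i j; rewrite !mxE.
by move=> /eqP; rewrite eq_sym addr_eq0 => /eqP ->; exists (- C); rewrite scalerN.
Qed.

(** The kernel contains all multiples of [a], so these and finitely many representatives generate
    it; the Smith form cuts the generators down to [r]. *)
Lemma kernel_lattice (G : zmodType) (a r : nat) (g : {ffun 'I_r -> G}) :
  (1 < a)%N -> (forall y : G, y *+ a = 0) ->
  exists B : 'M[int]_r, forall x, lin g x = 0 <-> exists y, x = B *m y.
Proof.
move=> a1 aG; pose m := #|{: 'cV['Z_a]_r}|.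
(* One column per residue class; classes outside the kernel give the zero column. *)
pose ker_col (i : 'I_m) : 'cV[int]_r :=
  if lin g (liftmx (enum_val i)) == 0 then liftmx (enum_val i) else 0.
pose K : 'M[int]_(r, r + m) := row_mx a%:Z%:M (\matrix_(i, j) ker_col j i 0).
have KP x : lin g x = 0 <-> exists y, x = K *m y.
  split=> [x0|[y ->]].
    have [C EC] := liftmx_intr a1 x.
    have k0 : lin g (liftmx (map_mx intr x : 'cV['Z_a]_r)) = 0.
      by rewrite EC lin_congr.
    exists (col_mx (- C) (delta_mx (enum_rank (map_mx intr x)) 0)).
    rewrite mul_row_col mul_scalar_mx scalerN.
    have -> : (\matrix_(i, j) ker_col j i 0) *m delta_mx (enum_rank (map_mx intr x)) 0 =
        x + a%:Z *: C.
      rewrite -EC -colE; apply/colP => i; rewrite mxE [LHS]mxE /ker_col enum_rankK.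
      by rewrite k0 eqxx.
    by rewrite addrC addrK.
  rewrite -[y]vsubmxK mul_row_col mul_scalar_mx linD lin_mulrn_eq0 // add0r.
  rewrite lin_mulmx {1}/lin big1 // => j _; rewrite ffunE.
  have -> : col j (\matrix_(i, j) ker_col j i 0) = ker_col j.
    by apply/colP => i; rewrite !mxE.
  have -> : lin g (ker_col j) = 0; last by rewrite mul0rz.
  by rewrite /ker_col; case: eqP => // _; exact: lin0.
have [L Lu [Q Qu [d _ EK]]] := int_Smith_normal_form K.
pose dv : 'rV[int]_r := \row_j d`_j.
have ED : \matrix_(i < r, j < r + m) (d`_i *+ (i == j :> nat)) = row_mx (diag_mx dv) 0.
  apply/matrixP => i j; rewrite !mxE; case: splitP => j' Ej; rewrite !mxE.
    by rewrite Ej -val_eqE.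
  by rewrite Ej; case: eqP => // E; have := ltn_ord i; rewrite E; lia.
exists (L *m diag_mx dv) => x; rewrite KP EK ED; split=> -[y ->].
  exists (usubmx (Q *m y)).
  by rewrite -!mulmxA -{1}[Q *m y]vsubmxK mul_row_col mul0mx addr0.
exists (invmx Q *m col_mx y 0).
by rewrite -!mulmxA mulKVmx // mul_row_col mul0mx addr0.
Qed.

Lemma row_free_inj0 (F : fieldType) m n (A : 'M[F]_(m, n)) :
  (forall u : 'rV_m, u *m A = 0 -> u = 0) -> row_free A.
Proof.
move=> H; rewrite -kermx_eq0; apply/eqP/row_matrixP => i; rewrite row0.
by apply: H; rewrite -row_mul mulmx_ker row0.
Qed.

Section KernelCount.
Variable a : nat.
Hypothesis a1 : (1 < a)%N.
Variable T : seq nat.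
Hypothesis T_prime : forall p, p \in T -> prime p.
Hypothesis T_dvd : forall p, p \in T -> (p %| a)%N.
Hypothesis T_all : forall p, prime p -> (p %| a)%N -> p \in T.
Variables (G : finZmodType) (a' Qd : nat).
Hypothesis aE : a = (a' * Qd)%N.
Hypothesis a'G : forall y : G, y *+ a' = 0.
Hypothesis T_Qd : forall p, p \in T -> (p %| Qd)%N.

Let aG (y : G) : y *+ a = 0. Proof. by rewrite aE mulrnA a'G mul0rn. Qed.

(** Right inverses of [C] modulo each [p] in [T] supply the hypothesis of Nakayama's lemma for the
    image of [C] modulo [a]. *)
Lemma row_free_onto r N (C : 'M[int]_(r, N)) :
  (forall p, p \in T -> row_free (map_mx intr C : 'M['F_p]_(r, N))) ->
  forall y : 'cV[int]_r, exists u z, y = C *m u + a%:Z *: z.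
Proof.
move=> HC y; pose Ca : 'M['Z_a]_(r, N) := map_mx intr C.
pose K := [set h : 'cV['Z_a]_r | [exists u, h == Ca *m u]].
have KP (h : 'cV['Z_a]_r) : reflect (exists u, h = Ca *m u) (h \in K).
  by rewrite inE; apply: (iffP existsP) => -[u /eqP Eu]; exists u.
have K0 : 0 \in K by apply/KP; exists 0; rewrite mulmx0.
have KB : {in K &, forall x y, x - y \in K}.
  by move=> _ _ /KP[u ->] /KP[v ->]; apply/KP; exists (u - v); rewrite mulmxBr.
have HK p : p \in T -> forall h, exists2 k, k \in K & exists h', h = k + h' *+ p.
  move=> pT h; have pp := T_prime pT; have pa := T_dvd pT.
  have /row_freeP[X CX] := HC p pT.
  pose ui : 'cV[int]_N := map_mx (fun x : 'F_p => (x : nat)%:Z)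
     (X *m map_mx (@Zp_red a p) h).
  have uiE : map_mx intr ui = X *m map_mx (@Zp_red a p) h.
    by apply/colP => i; rewrite [LHS]mxE [X in X%:~R]mxE -pmulrn natr_Zp.
  pose k := map_mx intr (C *m ui) : 'cV['Z_a]_r.
  exists k; first by apply/KP; exists (map_mx intr ui); rewrite /k map_mxM.
  pose hk := h - k; exists (\matrix_(i, j) (hk i j %/ p)%N%:R).
  have hkE i j : hk i j = h i j - k i j by rewrite !mxE.
  apply/matrixP => i j; rewrite [RHS]mxE mulmxnE [X in _ + X *+ _]mxE.
  rewrite -(@Zp_red_eq0 a p) //; first by rewrite hkE [RHS]addrC subrK.
  rewrite hkE.
  rewrite Zp_redB //; have -> : k i j = ((C *m ui) i j)%:~R by rewrite mxE.
  rewrite Zp_red_intr //.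
  have := congr1 (fun M : 'cV_r => M i j) (map_mxM (intr : int -> 'F_p) C ui).
  by rewrite uiE mulmxA CX mul1mx !mxE => <-; rewrite subrr.
have /KP[u Eu] := nakayama_Zp a1 T_all K0 KB HK (map_mx intr y).
have [|z Ez] := @map_intr_Zp_eq0 a _ _ (y - C *m liftmx u) a1.
  by rewrite map_mxB map_mxM map_liftmx Eu subrr.
by exists (liftmx u), z; rewrite -Ez addrC subrK.
Qed.

Section FixedMap.
Variables (r N : nat) (g : {ffun 'I_r -> G}).
Hypothesis g_onto : forall y, exists x, lin g x = y.
Variable B : 'M[int]_r.
Hypothesis kerB : forall x, lin g x = 0 <-> exists y, x = B *m y.

(** Since [a'] kills [G], the lattice contains all multiples of [a']. So [B] divides a nonzero
    scalar matrix and its determinant is nonzero. *)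
Lemma lattice_inj (z : 'cV[int]_r) : B *m z = 0 -> z = 0.
Proof.
move=> Bz; have a'0 : (0 < a')%N by move: a1; rewrite aE; case: (a').
have /choice[Y HY] : forall j : 'I_r, exists y : 'cV[int]_r,
    a'%:Z *: delta_mx j 0 = B *m y.
  by move=> j; apply/kerB; rewrite lin_mulrn_eq0.
pose B' : 'M[int]_r := \matrix_(i, j) Y j i 0.
have BB' : B *m B' = a'%:Z%:M.
  apply/matrixP => i j; have := congr1 (fun M : 'cV_r => M i 0) (HY j).
  rewrite !mxE eqxx andbT mulr_natr => ->; apply: eq_bigr => k _.
  by rewrite !mxE.
have dB : \det B != 0.
  have : \det B * \det B' != 0.
    by rewrite -det_mulmx BB' det_scalar expf_neq0 // eqz_nat -lt0n.
  by rewrite mulf_eq0 negb_or => /andP[].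
have : \det B *: z = 0 by rewrite -mul_scalar_mx -mul_adj_mx -mulmxA Bz mulmx0.
by move/eqP; rewrite scalemx_eq0 (negbTE dB) /= => /eqP.
Qed.

(** For the direct implication, a lattice vector [B *m delta_mx i 0] is [B *m C *m y] plus [Qd]
    times [a'%:Z *: v], and the latter lies in the lattice. Cancelling [B] leaves [C] onto modulo
    [Qd], hence modulo every [p] in [T]: here the spare factor is spent. *)
Lemma presents_mul (C : 'M[int]_(r, N)) :
  presents a g (B *m C) <->
  forall p, p \in T -> row_free (map_mx intr C : 'M['F_p]_(r, N)).
Proof.
split=> [[_ gk] p pT|HC]; last first.
  split=> // x; split=> [/kerB[y ->]|[u [v ->]]].
    have [u [z ->]] := row_free_onto HC y.
    by exists u, (B *m z); rewrite mulmxDr mulmxA scalemxAr.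
  by rewrite lin_congr // -mulmxA; apply/kerB; exists (C *m u).
have pp := T_prime pT; apply: row_free_inj0 => u uC.
apply/rowP => i; rewrite mxE.
have /gk[y [v Ev]] : lin g (B *m delta_mx i 0) = 0.
  by apply/kerB; exists (delta_mx i 0).
have /kerB[w Ew] : lin g (a'%:Z *: v) = 0 by rewrite lin_mulrn_eq0.
have /lattice_inj/eqP : B *m (delta_mx i 0 - C *m y - Qd%:Z *: w) = 0.
  rewrite !mulmxBr Ev mulmxA -scalemxAr -Ew scalerA -PoszM mulnC -aE.
  by rewrite addrAC addrK subrr.
rewrite -addrA -opprD subr_eq0 => /eqP Ei.
have := congr1 (fun M : 'cV[int]_r => (u *m map_mx intr M) 0 0) Ei.
rewrite map_mxD map_mxM mulmxDr mulmxA uC mul0mx add0r.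
have -> : map_mx intr (delta_mx i 0 : 'cV[int]_r) = delta_mx i 0 :> 'cV['F_p]_r.
  by apply/colP => k; rewrite !mxE; case: eqP.
rewrite -colE mxE => ->; rewrite mxE big1 // => k _; rewrite !mxE.
rewrite -[X in _ * X]/((Qd%:Z * w k 0)%:~R) intrM -[Qd%:Z%:~R]pmulrn.
have /eqP -> : Qd%:R == 0 :> 'F_p by rewrite -(dvdn_pcharf (pchar_Fp pp)) T_Qd.
by rewrite mul0r mulr0.
Qed.

Notation Om := 'M['Z_a]_(r, N).

Let beta (C : Om) : Om := map_mx intr B *m C.

Let gamma (U : Om) : 'rV[G]_N := \row_j lin g (col j (liftmx U)).

Let presents_beta C : presents a g (liftmx (beta C)) <->
  forall p, p \in T -> row_free (map_mx (@Zp_red a p) C).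
Proof.
have E : beta C = map_mx intr (B *m liftmx C) by rewrite map_mxM map_liftmx.
have [D HD] := liftmx_intr a1 (B *m liftmx C).
have E2 p : map_mx intr (liftmx C) = map_mx (@Zp_red a p) C.
  by apply/matrixP => i j; rewrite !mxE -pmulrn.
transitivity (presents a g (B *m liftmx C)).
  rewrite E HD; split; last exact: presents_congr.
  by move/(presents_congr (- D)); rewrite scalerN addrK.
by rewrite presents_mul; split=> H p pT; have := H p pT; rewrite E2.
Qed.

Let gammaB : {morph gamma : U V / U - V}.
Proof.
move=> U V; apply/rowP => j; rewrite !mxE -linB.
have [|z Ez] := @map_intr_Zp_eq0 a _ _
    (col j (liftmx (U - V)) - (col j (liftmx U) - col j (liftmx V))) a1.
  by rewrite !map_mxB !map_col !map_liftmx linearB /= subrr.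
by rewrite -[col j (liftmx (U - V))](subrK (col j (liftmx U) - col j (liftmx V))) Ez
  addrC lin_congr.
Qed.

Let gamma_beta U : (gamma U == 0) = (U \in beta @: [set: Om]).
Proof.
apply/eqP/imsetP => [U0|[C _ ->]].
  have /choice[Y HY] : forall j : 'I_N, exists y, col j (liftmx U) = B *m y.
    by move=> j; apply/kerB; have := congr1 (fun h : 'rV_N => h 0 j) U0; rewrite !mxE.
  exists (map_mx intr (\matrix_(i, j) Y j i 0)) => //.
  rewrite /beta -map_mxM -[LHS]map_liftmx; congr map_mx.
  apply/matrixP => i j; have := congr1 (fun M : 'cV_r => M i 0) (HY j).
  by rewrite !mxE => ->; apply: eq_bigr => k _; rewrite !mxE.
apply/rowP => j; rewrite !mxE.
have E : beta C = map_mx intr (B *m liftmx C) by rewrite map_mxM map_liftmx.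
have [D HD] := liftmx_intr a1 (B *m liftmx C).
rewrite E HD linearD linearZ /= lin_congr // colE -mulmxA.
by apply/kerB; exists (liftmx C *m delta_mx j 0).
Qed.

Let gamma_onto h : h \in gamma @: [set: Om].
Proof.
have /choice[x Hx] : forall j : 'I_N, exists x, lin g x = h 0 j by move=> j; exact: g_onto.
apply/imsetP; exists (map_mx intr (\matrix_(i, j) x j i 0)) => //.
apply/rowP => j; rewrite mxE -Hx.
have [D ->] := liftmx_intr a1 (\matrix_(i, j) x j i 0 : 'M[int]_(r, N)).
rewrite linearD linearZ /= lin_congr //; congr (lin g _).
by apply/colP => i; rewrite !mxE.
Qed.

(** The maps [beta] and [gamma] form an exact sequence with [gamma] onto ['rV[G]_N]. As [beta] is an
    endomorphism of a finite group, its kernel is as large as its cokernel, [#|G| ^ N]. Each [U]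
    presented by [g] is thus [beta C] for exactly that many [C]. *)
Lemma card_presented :
  (#|[set U : Om | `[< presents a g (liftmx U) >]]| * #|G| ^ N =
   #|[set C : Om | `[< forall p, p \in T -> row_free (map_mx (@Zp_red a p) C) >]]|)%N.
Proof.
have betaB : {morph beta : U V / U - V} by move=> U V; rewrite /beta mulmxBr.
have gamma_im : gamma @: [set: Om] = [set: _].
  by apply/setP => h; rewrite gamma_onto in_setT.
have imT (A : finZmodType) (f : Om -> A) :
    [set y in f @: [pred x : Om | true] | predT y] = f @: [set: Om].
  apply/setP => y; rewrite inE andbT.
  by apply/imsetP/imsetP => -[x _ ->]; exists x.
have ker_gamma : #|[set U | (gamma U == 0)%R]| = #|beta @: [set: Om]|.
  by apply: eq_card => U; rewrite inE gamma_beta.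
have cbeta : (#|[set C | (beta C == 0)%R]| = #|G| ^ N)%N.
  have := card_fibers predT gammaB; rewrite (card_fibers predT betaB) !imT.
  rewrite ker_gamma gamma_im cardsT card_mx mul1n [RHS]mulnC => /eqP.
  rewrite eqn_pmul2r; first by move/eqP.
  by apply/card_gt0P; exists (beta 0); rewrite imset_f.
rewrite mulnC -cbeta.
have -> : [set U : Om | `[< presents a g (liftmx U) >]] =
    [set U in beta @: [pred x : Om | true] | `[< presents a g (liftmx U) >]].
  apply/setP => U; rewrite !inE; case: asboolP; rewrite ?andbF // => -[_ gk].
  rewrite andbT; apply/esym.
  suff : U \in beta @: [set: Om] by case/imsetP => C _ ->; rewrite imset_f.
  rewrite -gamma_beta; apply/eqP/rowP => j; rewrite !mxE; apply/gk.
  by exists (delta_mx j 0), 0; rewrite scaler0 addr0 -colE.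
rewrite -(card_fibers (fun U => `[< presents a g (liftmx U) >]) betaB).
apply: eq_card => C; rewrite !inE; apply/asboolP/asboolP => /presents_beta //.
Qed.

End FixedMap.

Lemma card_presented_onto r N (g : {ffun 'I_r -> G}) :
  (forall y, exists x, lin g x = y) ->
  (#|[set U : 'M['Z_a]_(r, N) | `[< presents a g (liftmx U) >]]| * #|G| ^ N =
   #|[set C : 'M['Z_a]_(r, N) |
      `[< forall p, p \in T -> row_free (map_mx (@Zp_red a p) C) >]]|)%N.
Proof.
move=> g_onto; have [B kerB] := kernel_lattice g a1 aG.
exact: (card_presented N g_onto kerB).
Qed.

End KernelCount.

(** * Probabilities for uniform matrices modulo [a] *)

Lemma card_le_cover (X Y : finType) (A : {set X}) (s : {set Y}) (F : Y -> {set X}) :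
  (forall x, x \in A -> exists2 y, y \in s & x \in F y) ->
  (#|A| <= \sum_(y in s) #|F y|)%N.
Proof.
move=> H; apply: (@leq_trans (\sum_(x in A) \sum_(y in s | x \in F y) 1)).
  rewrite -sum1_card; apply: leq_sum => x /H[y ys xy].
  by rewrite (bigD1 y) ?ys //=.
rewrite (exchange_big_dep (mem s)) //=; last by move=> x y _ /andP[].
apply: leq_sum => y ys; rewrite -sum1_card [leqLHS]big_mkcond [leqRHS]big_mkcond.
by apply: leq_sum => x _; rewrite ys; case: (x \in F y); rewrite ?andbT ?andbF //; case: ifP.
Qed.

Section UniformFractions.
Variables (R : realFieldType) (a : nat).
Hypothesis a1 : (1 < a)%N.
Variable T : seq nat.
Hypothesis T_uniq : uniq T.
Hypothesis T_prime : forall p, p \in T -> prime p.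
Hypothesis T_dvd : forall p, p \in T -> (p %| a)%N.
Hypothesis T_all : forall p, prime p -> (p %| a)%N -> p \in T.
Variables (r N : nat).
Hypothesis rN : (r <= N)%N.
Notation Om := 'M['Z_a]_(r, N).

(** For a prime [p], the proportion of matrices of rank [r] among the [r] by [N] matrices over
    ['F_p]. *)
Definition free_fraction (p : nat) : R := \prod_(i < r) (1 - p%:R ^+ i / p%:R ^+ N).

Let red (p : nat) (C : Om) := map_mx (@Zp_red a p) C.

Let redB p : p \in T -> {morph red p : U V / U - V}.
Proof.
move=> pT U V; apply/matrixP => i j.
by rewrite !mxE (Zp_redB a1) ?T_prime ?T_dvd.
Qed.

Let redM p C n : p \in T -> red p (C *+ n) = red p C *+ n.
Proof.
move=> pT; apply/matrixP => i j.
by rewrite mulmxnE !mxE mulmxnE (Zp_redM a1) ?T_prime ?T_dvd.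
Qed.

Let redD p : p \in T -> {morph red p : U V / U + V}.
Proof.
move=> pT U V; have := redB pT (U + V) V; rewrite addrK => ->.
by rewrite subrK.
Qed.

Let red_onto p (D : 'M['F_p]_(r, N)) : p \in T -> D \in red p @: [set: Om].
Proof.
move=> pT; pose Z : 'M[int]_(r, N) := map_mx (fun x : 'F_p => (x : nat)%:Z) D.
apply/imsetP; exists (map_mx intr Z) => //; apply/matrixP => i j.
by rewrite [RHS]mxE [X in Zp_red p X]mxE (Zp_red_intr a1) ?T_prime ?T_dvd // mxE
  -pmulrn natr_Zp.
Qed.

Lemma card_row_free_red p : p \in T ->
  #|[set C : Om | row_free (red p C)]|%:R = #|Om|%:R * free_fraction p.
Proof.
move=> pT; have pp := T_prime pT.
have imT E : [set y in red p @: [pred x : Om | true] | E y] = [set y | E y].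
  apply/setP => y; rewrite !inE.
  have -> // : y \in red p @: [pred x : Om | true].
  by have /imsetP[C _ ->] := red_onto y pT; rewrite imset_f.
have := card_fibers predT (redB pT); rewrite imT => E1.
have := card_fibers (@row_free _ r N) (redB pT); rewrite imT => ->.
have cOm : #|Om| = (#|[set x | (red p x == 0)%R]| * p ^ (r * N))%N.
  have <- : #|[set y : 'M['F_p]_(r, N) | predT y]| = (p ^ (r * N))%N.
    by rewrite -[X in (X ^ _)%N](card_Fp pp) -card_mx; apply: eq_card => y; rewrite !inE.
  by rewrite -E1; apply: eq_card => x; rewrite !inE.
rewrite cOm !natrM -mulrA; congr (_ * _).
rewrite card_row_free (card_Fp pp) natr_prod natrX mulnC exprM.
rewrite /free_fraction -[X in _ ^+ X](card_ord r) -prodr_const -big_split /=.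
apply: eq_bigr => i _; rewrite natrB; last first.
  by rewrite leq_exp2l ?prime_gt1 // (leq_trans _ rN) // ltnW.
rewrite mulrBr mulr1 !natrX mulrCA divff ?mulr1 //.
by rewrite expf_neq0 // pnatr_eq0 -lt0n prime_gt0.
Qed.

(** Reductions modulo distinct primes are independent: a Chinese remainder [u], 1 modulo the new
    prime and 0 modulo the previous ones, is fed to [card_crt]. *)
Lemma card_row_free_all :
  #|[set C : Om | `[< forall p, p \in T -> row_free (red p C) >]]|%:R =
  #|Om|%:R * \prod_(p <- T) free_fraction p.
Proof.
suff main s : uniq s -> {subset s <= T} ->
    #|[set C : Om | `[< forall p, p \in s -> row_free (red p C) >]]|%:R =
    #|Om|%:R * \prod_(p <- s) free_fraction p by exact: main.
elim: s => [|p s IH] /=.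
  move=> _ _; rewrite big_nil mulr1 -cardsT; congr (_%:R); apply: eq_card => C.
  by rewrite !inE; apply/asboolP.
case/andP => ps us sT; have pT : p \in T by rewrite sT ?mem_head.
have sT' : {subset s <= T} by move=> x xs; rewrite sT // inE xs orbT.
pose X := [set C : Om | row_free (red p C)].
pose Y := [set C : Om | `[< forall p, p \in s -> row_free (red p C) >]].
pose m := (\prod_(p' <- s) p')%N.
have cop : coprime p m.
  rewrite /m big_seq; apply: (big_ind (fun x => coprime p x)).
  - exact: coprimen1.
  - by move=> x1 x2 px1 px2; rewrite coprimeMr px1.
  move=> x xs; have pp := T_prime pT; have px := T_prime (sT' _ xs).
  by rewrite prime_coprime // dvdn_prime2 //; apply: contra ps => /eqP ->.
have [u [u_p u_m]] : exists u : nat, (u = 1 %[mod p])%N /\ (u = 0 %[mod m])%N.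
  exists (chinese p m 1 0); by split; rewrite ?chinese_modl ?chinese_modr.
have red_u : forall p1 n C f h, p1 \in T -> u%:R = n%:R :> 'F_p1 ->
    C = h + (f - h) *+ u -> red p1 C = red p1 h + (red p1 f - red p1 h) *+ n.
  move=> p1 n C f h.
  move=> xT un ->; rewrite redD // redM // redB //; congr (_ + _).
  by apply/matrixP => i j; rewrite !mulmxnE -[LHS]mulr_natr un mulr_natr.
have uX f h : red p (h + (f - h) *+ u) = red p f.
  have un : u%:R = 1%:R :> 'F_p by apply/eqP; rewrite eq_natr_Fp ?T_prime // u_p.
  by rewrite (red_u p 1%N _ f h pT un erefl) mulr1n addrC subrK.
have uY p1 f h : p1 \in s -> red p1 (h + (f - h) *+ u) = red p1 h.
  move=> p1s; have p1T := sT' _ p1s.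
  have p1m : (p1 %| m)%N by rewrite /m (big_rem p1) //= dvdn_mulr.
  have un : u%:R = 0%:R :> 'F_p1.
    apply/eqP; rewrite eq_natr_Fp ?T_prime //.
    by rewrite -(modn_dvdm u p1m) u_m mod0n mod0n.
  by rewrite (red_u p1 0%N _ f h p1T un erefl) mulr0n addr0.
have HX f h : (h + (f - h) *+ u \in X) = (f \in X) by rewrite !inE uX.
have HY f h : (h + (f - h) *+ u \in Y) = (h \in Y).
  by rewrite !inE; apply/asboolP/asboolP => H p0 p0s; have := H p0 p0s; rewrite uY.
have := congr1 (fun n : nat => n%:R : R) (card_crt HX HY).
have -> : X :&: Y = [set C : Om |
    `[< forall p0, p0 \in p :: s -> row_free (red p0 C) >]].
  apply/setP => C; rewrite !inE; apply/andP/asboolP.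
    by case=> fp /asboolP fs p0; rewrite inE => /orP[/eqP ->|/fs].
  move=> H; split; first by rewrite H ?mem_head.
  by apply/asboolP => p0 p0s; rewrite H // inE p0s orbT.
rewrite !natrM card_row_free_red // IH // => E.
have Om0 : #|Om|%:R != 0 :> R.
  by rewrite pnatr_eq0 -lt0n; apply/card_gt0P; exists 0.
by apply: (mulIf Om0); rewrite -E big_cons; ring.
Qed.

Section Sur.
Variable G : finZmodType.

Definition onto (g : {ffun 'I_r -> G}) : Prop := forall y, exists x, lin g x = y.

Definition onto_fraction : R :=
  #|[set g : {ffun 'I_r -> G} | `[< onto g >]]|%:R / #|G|%:R ^+ r.

Let G0 : 0 < #|G|%:R :> R.
Proof. by rewrite ltr0n; apply/card_gt0P; exists 0. Qed.

Lemma onto_fraction_le1 : onto_fraction <= 1.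
Proof.
rewrite /onto_fraction ler_pdivrMr ?exprn_gt0 // mul1r -natrX ler_nat.
by rewrite (leq_trans (max_card _)) // card_ffun card_ord.
Qed.

(** If [g] is not onto, the image of [lin g] is a proper subgroup, with at most half of the
    elements. The union bound runs over all subsets of that size, of which there are at most
    [2 ^ #|G|]. *)
Lemma onto_fraction_ge : 1 - 2 ^+ #|G| / 2 ^+ r <= onto_fraction.
Proof.
have two0 m : 0 < 2 ^+ m :> R by rewrite exprn_gt0 // ltr0n.
pose P := [set K : {set G} | (2 * #|K| <= #|G|)%N].
have cP : (#|P| <= 2 ^ #|G|)%N.
  by rewrite -cardsT -card_powerset powersetT subset_leq_card // subsetT.
pose S := [set g : {ffun 'I_r -> G} | `[< onto g >]].
have cS : (#|~: S| <= \sum_(K in P) #|[set g : {ffun 'I_r -> G} | g \in ffun_on K]|)%N.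
  apply: card_le_cover => g; rewrite !inE => /asboolPn /existsNP[y Hy].
  pose K := [set z | `[< exists x, lin g x = z >]].
  exists K; last first.
    rewrite inE; apply/ffun_onP => i; rewrite inE; apply/asboolP.
    by exists (delta_mx i 0); rewrite lin_delta.
  (* The image misses [y], so its translate by [y] is disjoint from it. *)
  have dK : K :&: [set y + z | z in K] = set0.
    apply/setP => v; rewrite !inE; apply/negbTE/negP => /andP[/asboolP[x Ex] /imsetP[z]].
    rewrite inE => /asboolP[x' Ex'] Ev; apply: Hy; exists (x - x').
    by rewrite linB Ex Ex' Ev addrK.
  rewrite inE mul2n -addnn -[X in (_ + X <= _)%N](card_imset _ (@addrI _ y)).
  rewrite -cardsUI dK cards0 addn0; exact: max_card.
have {}cS : #|~: S|%:R <= 2 ^+ #|G| * (#|G|%:R ^+ r / 2 ^+ r) :> R.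
  apply: (@le_trans _ _ (\sum_(K in P) (#|G|%:R ^+ r / 2 ^+ r))); last first.
    rewrite sumr_const -[leLHS]mulr_natl; apply: ler_wpM2r.
      by rewrite divr_ge0 ?exprn_ge0.
    by rewrite -natrX ler_nat.
  apply: le_trans (_ : _ <= \sum_(K in P) (#|K|%:R ^+ r : R)) _.
    move: cS; rewrite -(ler_nat R) natr_sum => /le_trans; apply.
    apply: ler_sum => K _; rewrite -natrX ler_nat.
    rewrite -[r in leqRHS]card_ord -card_ffun_on; apply: subset_leq_card.
    by apply/fintype.subsetP => f; rewrite inE.
  apply: ler_sum => K; rewrite inE => cK.
  rewrite ler_pdivlMr // -exprMn mulrC -natrM; apply: lerXn2r; rewrite ?nnegrE ?ler0n //.
  by rewrite ler_nat.
have E : #|S|%:R = #|G|%:R ^+ r - #|~: S|%:R :> R.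
  by rewrite -[X in _ ^+ X]card_ord -natrX -card_ffun -(cardsC S) natrD addrK.
rewrite /onto_fraction -/S E ler_pdivlMr ?exprn_gt0 // mulrBl mul1r lerD2l lerN2.
by rewrite mulrAC -mulrA.
Qed.

Variables a' Qd : nat.
Hypothesis aE : a = (a' * Qd)%N.
Hypothesis a'G : forall y : G, y *+ a' = 0.
Hypothesis T_Qd : forall p, p \in T -> (p %| Qd)%N.

(** Double counting of the pairs [(U, g)] with [g] presenting [U]: by [card_presenters] for fixed
    [U], by [card_presented_onto] for fixed [g]. *)
Lemma ufrac_presentable :
  ufrac R (fun U : Om => presentable a G (liftmx U)) =
  onto_fraction * (#|Aut [set: G]|%:R * #|G|%:R ^+ (N - r))^-1 *
  \prod_(p <- T) free_fraction p.
Proof.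
pose PU := [set U : Om | `[< presentable a G (liftmx U) >]].
have Om0 : 0 < #|Om|%:R :> R.
  by rewrite ltr0n; apply/card_gt0P; exists 0.
have A0 : 0 < #|Aut [set: G]|%:R :> R.
  by rewrite ltr0n; apply/card_gt0P; exists 1%g; rewrite group1.
have E1 : (\sum_(U : Om) \sum_(g : {ffun 'I_r -> G} | `[< presents a g (liftmx U) >]) 1 =
    #|PU| * #|Aut [set: G]|)%N.
  rewrite -sum_nat_const [RHS]big_mkcond; apply: eq_bigr => U _; rewrite inE.
  case: asboolP => [[g Hg]|nP].
    by rewrite -(card_presenters Hg) -sum1_card; apply: eq_bigl => g'; rewrite inE.
  by rewrite big_pred0 // => g; apply/asboolP => Hg; apply: nP; exists g.
have E2 : (\sum_(U : Om) \sum_(g : {ffun 'I_r -> G} | `[< presents a g (liftmx U) >]) 1 =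
    \sum_(g : {ffun 'I_r -> G} | `[< onto g >])
      #|[set U : Om | `[< presents a g (liftmx U) >]]|)%N.
  rewrite (exchange_big_dep predT) //= [RHS]big_mkcond; apply: eq_bigr => g _.
  case: asboolP => [og|ng]; last by rewrite big_pred0 // => U; apply/asboolP => -[].
  by rewrite -sum1_card; apply: eq_bigl => U; rewrite inE.
have E3 : #|PU|%:R * #|Aut [set: G]|%:R * #|G|%:R ^+ N =
    #|[set g : {ffun 'I_r -> G} | `[< onto g >]]|%:R *
    (#|Om|%:R * \prod_(p <- T) free_fraction p) :> R.
  rewrite -natrM -E1 E2 -natrX -natrM big_distrl /= -card_row_free_all -natrM.
  congr (_%:R); rewrite -sum_nat_const; apply: eq_big => [g|g /asboolP og].
    by rewrite inE.
  exact: (card_presented_onto a1 T_prime T_dvd T_all aE a'G T_Qd N og).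
have GN : #|G|%:R ^+ N = #|G|%:R ^+ r * #|G|%:R ^+ (N - r) :> R.
  by rewrite -exprD subnKC.
have Gr := exprn_gt0 r G0; have GNr := exprn_gt0 (N - r) G0.
have -> : ufrac R (fun U : Om => presentable a G (liftmx U)) = #|PU|%:R / #|Om|%:R by [].
rewrite /onto_fraction; move: E3; rewrite GN.
set S := #|[set g : {ffun 'I_r -> G} | `[< onto g >]]|%:R; set F := \prod_(_ <- _) _ => E3.
have nz : #|Aut [set: G]|%:R * (#|G|%:R ^+ r * #|G|%:R ^+ (N - r)) != 0 :> R.
  by rewrite gt_eqF // !mulr_gt0.
have -> : #|PU|%:R = S * (#|Om|%:R * F) /
    (#|Aut [set: G]|%:R * (#|G|%:R ^+ r * #|G|%:R ^+ (N - r))).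
  by rewrite -E3 -[X in X / _]mulrA mulfK.
by field; rewrite !gt_eqF.
Qed.

End Sur.

(** What the vanishing of [v *m U] modulo [md] becomes after division by a coordinate [v 0 i] that
    is a unit modulo [md]; [y] lists the other coefficients, reduced modulo [md]. *)
Definition divisible_combination (md : nat) (i : 'I_r) (y : {ffun 'I_r.-1 -> 'I_md})
    (U : Om) : Prop :=
  forall j, exists z, U i j + \sum_k U (lift i k) j *+ (y k : nat) = z *+ md.

(* Adding to row [i] the vectors with entries in [0, md) moves the event below
   to disjoint sets of the same size. *)
Lemma card_divisible_combination (md : nat) (i : 'I_r) (y : {ffun 'I_r.-1 -> 'I_md}) :
  (md %| a)%N ->
  (#|[set U : Om | `[< divisible_combination i y U >]]| * md ^ N <= #|Om|)%N.
Proof.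
move=> mda; set E := [set U | _].
pose chi (U : Om) j := U i j + \sum_k U (lift i k) j *+ (y k : nat).
pose phi (Us : Om * {ffun 'I_N -> 'I_md}) : Om :=
  \matrix_(k, j) (Us.1 k j + (Us.2 j : nat)%:R *+ (k == i)).
have chi_phi U s j : chi (phi (U, s)) j = chi U j + (s j : nat)%:R.
  rewrite /chi !mxE eqxx mulr1n addrAC; congr (_ + _ + _).
  apply: eq_bigr => k _; rewrite !mxE [_ == i]eq_sym (negbTE (neq_lift i k)) mulr0n.
  by rewrite addr0.
have a0 : a%:R = 0 :> 'Z_a by exact: pchar_Zp.
have phi_inj : {in setX E [set: _] &, injective phi}.
  move=> [U s] [U' s']; rewrite !inE !andbT => /asboolP EU /asboolP EU' Eq.
  have Es : s = s'.
    apply/ffunP => j; apply: val_inj => /=.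
    have := congr1 (chi ^~ j) Eq; rewrite !chi_phi.
    have [z Ez] := EU j; have [z' Ez'] := EU' j.
    have -> : chi U j = z *+ md := Ez.
    have -> : chi U' j = z' *+ md := Ez'.
    move=> Ezz.
    have {}Ezz : (z * md + s j)%N%:R = (z' * md + s' j)%N%:R :> 'Z_a.
      by rewrite !natrD !natrM !Zp_nat_natr !mulr_natr.
    have := congr1 (fun x : 'Z_a => (x : nat) %% md)%N Ezz.
    rewrite !val_Zp_nat // !modn_dvdm // !modnMDl !modn_small //.
  congr (_, _) => //; apply/matrixP => k j.
  have := congr1 (fun M : Om => M k j) Eq; rewrite Es !mxE; exact: addIr.
rewrite -[X in (_ * X ^ _)%N](card_ord md) -[X in (_ * _ ^ X)%N](card_ord N).
by rewrite -card_ffun -cardsT -cardsX -(card_in_imset phi_inj) max_card.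
Qed.

(** There are [r] choices of a unit coordinate and [md ^ r.-1] choices of the other coefficients,
    each of probability at most [md%:R ^- N]. As [r <= N], at least one factor [md] remains in the
    denominator. *)
Lemma ufrac_degenerate p e : prime p -> (p ^ e %| a)%N ->
  ufrac R (fun U : Om => degenerate a p (liftmx U)) <= r%:R / p%:R ^+ e.
Proof.
move=> pp; set md := (p ^ e)%N => mda.
have md0 : (0 < md)%N by rewrite expn_gt0 prime_gt0.
have a0 : a%:R = 0 :> 'Z_a by exact: pchar_Zp.
pose E (iy : 'I_r * {ffun 'I_r.-1 -> 'I_md}) :=
  [set U : Om | `[< divisible_combination iy.1 iy.2 U >]].
pose D := [set U : Om | `[< degenerate a p (liftmx U) >]].
have cov : (#|D| <= \sum_(iy in [set: 'I_r * {ffun 'I_r.-1 -> 'I_md}]) #|E iy|)%N.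
  apply: card_le_cover => U; rewrite inE => /asboolP[v [[w vU] nv]].
  pose vv k : int := v 0 k.
  have [i pvi] : exists i, ~~ (p %| vv i)%Z.
    apply: contrapT => H; apply: nv; exists (\row_i (vv i %/ p)%Z).
    apply/rowP => i; rewrite !mxE mulrC divzK //.
    by apply: contrapT => /negP ndv; apply: H; exists i.
  have /coprimezP[[c d] /= cd] : coprimez (vv i) md.
    apply: coprimez_primes => // p' pp' p'md; have := p'md.
    rewrite Euclid_dvdX // => /andP[]; rewrite dvdn_prime2 // => /eqP -> _ //.
  pose y : {ffun 'I_r.-1 -> 'I_md} :=
    [ffun k => Ordinal (ltn_pmod `|(c * vv (lift i k) %% md)%Z| md0)].
  exists (i, y); rewrite ?in_setT // inE; apply/asboolP => j /=.
  have Hk k : exists t, (y k : nat)%:Z = c * vv (lift i k) + t * md%:Z.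
    exists (- (c * vv (lift i k) %/ md)%Z); rewrite ffunE /=.
    have mdz : (md%:Z != 0) by rewrite eqz_nat -lt0n.
    have lt : (`|(c * vv (lift i k) %% md)%Z| < md)%N.
      by rewrite -ltz_nat gez0_abs ?modz_ge0 // ltz_pmod // ltz_nat.
    rewrite modn_small // gez0_abs ?modz_ge0 //.
    by rewrite {2}(divz_eq (c * vv (lift i k)) md) mulNr addrAC subrr add0r.
  have /choice[t Ht] := Hk.
  have Zj : c * \sum_k vv k * (U k j : nat)%:Z = c * (a%:Z * w 0 j).
    congr (c * _); have := congr1 (fun M : 'rV[int]_N => M 0 j) vU; rewrite !mxE => <-.
    by apply: eq_bigr => k _; rewrite mxE.
  pose u k : int := (U k j : nat)%:Z.
  have [Y HS] : exists Y, u i + \sum_k u (lift i k) * (y k : nat)%:Z = a%:Z * (c * w 0 j) + md%:Z * Y.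
    exists (d * u i + \sum_k t k * u (lift i k)).
    rewrite mulrCA -Zj (bigD1_ord i) //= mulrDr mulrDr addrACA.
    rewrite !mulr_sumr -big_split /=; congr (_ + _).
      by rewrite -[LHS]mul1r -cd; ring.
    by apply: eq_bigr => k _; rewrite Ht /u; ring.
  exists Y%:~R; have := congr1 (fun x : int => x%:~R : 'Z_a) HS.
  rewrite !intrD !intrM -[a%:Z%:~R]pmulrn a0 mul0r add0r -[md%:Z%:~R]pmulrn mulr_natl.
  move=> HZ; apply: etrans HZ; rewrite -pmulrn Zp_nat_natr rmorph_sum; congr (_ + _).
  apply: eq_bigr => k _; rewrite -[RHS]/((u (lift i k) * (y k : nat)%:Z)%:~R).
  by rewrite intrM -!pmulrn Zp_nat_natr mulr_natr.
have Om0 : 0 < #|Om|%:R :> R by rewrite ltr0n; apply/card_gt0P; exists 0.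
have md0' : 0 < md%:R :> R by rewrite ltr0n.
have -> : ufrac R (fun U : Om => degenerate a p (liftmx U)) = #|D|%:R / #|Om|%:R by [].
rewrite -natrX -/md ler_pdivrMr // mulrAC ler_pdivlMr // -!natrM ler_nat.
have [r0|r0] := posnP r.
  rewrite [X in (_ <= X * _)%N]r0 mul0n leqn0 muln_eq0; apply/orP; left.
  rewrite -leqn0; apply: leq_trans cov _; rewrite big1 // => -[i y0] _.
  by have := ltn_ord i; rewrite {2}r0.
have ENr : (md ^ N = md ^ r.-1 * md * md ^ (N - r))%N.
  by rewrite -expnSr prednK // -expnD subnKC.
rewrite -(leq_pmul2r (m := md ^ r.-1)); last by rewrite expn_gt0 md0.
apply: (@leq_trans (#|D| * md ^ N)).
  by rewrite -mulnA leq_mul2l ENr [(md * _)%N]mulnC leq_pmulr ?orbT // expn_gt0 md0.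
apply: (@leq_trans (\sum_(iy in [set: 'I_r * {ffun 'I_r.-1 -> 'I_md}]) #|Om|)).
  apply: leq_trans (leq_mul cov (leqnn _)) _; rewrite big_distrl /=.
  by apply: leq_sum => -[i y] _; exact: card_divisible_combination.
rewrite sum_nat_const cardsT card_prod card_ffun !card_ord.
by rewrite -mulnA [(_ * #|Om|)%N]mulnC mulnA.
Qed.

End UniformFractions.

(** * Cokernels and presentations *)

Section CokernelClass.
Variables (n N : nat) (M : 'M[int]_(n, N)).

Definition cok_class (x : 'cV[int]_n) : cok M :=
  (\pi_(Quotient.quot (col_lattice M)) x)%qT.

Lemma cok_classB : {morph cok_class : x y / x - y}.
Proof. by move=> x y; rewrite /cok_class raddfB. Qed.

Lemma cok_class_eq0 x : cok_class x = 0 <-> exists y, x = M *m y.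
Proof.
have -> : (0 : cok M) = cok_class 0 by rewrite /cok_class raddf0.
split=> [/eqP|[y ->]].
  rewrite /cok_class -Quotient.idealrBE subr0 => /asboolP[y ->].
  by exists y.
apply/eqP; rewrite /cok_class -Quotient.idealrBE subr0.
by apply/asboolP; exists y.
Qed.

Lemma cok_class_onto z : exists x, cok_class x = z.
Proof. by exists (repr (z : Quotient.quot (col_lattice M))); rewrite /cok_class reprK. Qed.

Lemma cok_class0 : cok_class 0 = 0.
Proof. by apply/cok_class_eq0; exists 0; rewrite mulmx0. Qed.

Lemma cok_classN : {morph cok_class : x / - x}.
Proof. by move=> x; have := cok_classB 0 x; rewrite cok_class0 !sub0r. Qed.

Lemma cok_classD : {morph cok_class : x y / x + y}.
Proof. by move=> x y; have := cok_classB x (- y); rewrite cok_classN !opprK. Qed.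

Lemma cok_classMn x k : cok_class (x *+ k) = cok_class x *+ k.
Proof.
elim: k => [|k IH]; first by rewrite !mulr0n cok_class0.
by rewrite !mulrS cok_classD IH.
Qed.

Lemma cok_classMz x (k : int) : cok_class (x *~ k) = cok_class x *~ k.
Proof.
by case: k => k; rewrite ?NegzE -?nmulrn -?pmulrn ?cok_classN cok_classMn.
Qed.

End CokernelClass.

Section PrimaryParts.
Variable A : zmodType.

Lemma mulrn_gcdn (x : A) m n : x *+ m = 0 -> x *+ n = 0 -> x *+ gcdn m n = 0.
Proof.
move=> xm xn; case: (posnP m) => [->|m0]; first by rewrite gcd0n.
case: (egcdnP n m0) => km kn E _.
have := congr1 (fun k => x *+ k) E.
rewrite /= mulrnDr [(km * m)%N]mulnC [(kn * n)%N]mulnC !mulrnA xm xn !mul0rn.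
by rewrite add0r => <-.
Qed.

Lemma ppart_bounded (x : A) p j m k : coprime p m ->
  x *+ (m * p ^ j) = 0 -> x *+ (p ^ k) = 0 -> x *+ (p ^ j) = 0.
Proof.
move=> pm xc xk; have := mulrn_gcdn xk xc.
rewrite Gauss_gcdr ?coprimeXl // => xg.
by have /dvdnP[q ->] := dvdn_gcdr (p ^ k) (p ^ j); rewrite mulnC mulrnA xg mul0rn.
Qed.

Lemma ppartB p (x y : A) : ppart A p x -> ppart A p y -> ppart A p (x - y).
Proof.
case=> k xk [l yl]; exists (k + l)%N; rewrite expnD mulrnBl mulrnA xk mul0rn.
by rewrite mulnC mulrnA yl mul0rn subrr.
Qed.

Lemma ppart0 p : ppart A p 0. Proof. by exists 0%N; rewrite mul0rn. Qed.

Lemma mulrn_eqmod (x : A) (m u v : nat) : x *+ m = 0 -> u = v %[mod m] ->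
  x *+ u = x *+ v.
Proof.
move=> xm uv; rewrite (divn_eq u m) (divn_eq v m) uv !mulrnDr.
by rewrite ![(_ * m)%N]mulnC !mulrnA xm !mul0rn.
Qed.

End PrimaryParts.

Section PresentsIso.
Variables (a a' Qd : nat) (T : seq nat).
Hypothesis a1 : (1 < a)%N.
Hypothesis T_prime : forall p, p \in T -> prime p.
Variable G : finZmodType.
Hypothesis aE : a = (a' * Qd)%N.
Hypothesis a'G : forall y : G, y *+ a' = 0.
Hypothesis T_Qd : forall p, p \in T -> (p %| Qd)%N.
Variables (n N : nat) (M : 'M[int]_(n, N)).

(* With [C] the cokernel, [a' C] is a finitely generated module satisfying
   [a' C = Qd a' C], so the determinant trick kills it by some [s = 1 mod Qd]. *)
Lemma presents_exponent (g : {ffun 'I_n -> G}) : presents a g M ->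
  exists s : int, (forall p, p \in T -> ~~ (p %| s)%Z) /\
    forall z : cok M, z *+ a' *~ s = 0.
Proof.
case=> _ gk.
have /choice[uv Huv] : forall j : 'I_n, exists uv : 'cV[int]_N * 'cV[int]_n,
    a'%:Z *: delta_mx j 0 = M *m uv.1 + a%:Z *: uv.2.
  move=> j; have /gk[u [v E]] : lin g (a'%:Z *: delta_mx j 0) = 0.
    by rewrite linZ -pmulrn a'G.
  by exists (u, v).
pose U := \matrix_(i, j) (uv j).1 i 0; pose V := \matrix_(i, j) (uv j).2 i 0.
pose W : 'M[int]_n := 1%:M - Qd%:Z *: V.
have EW : a'%:Z *: W = M *m U.
  apply/matrixP => i j; have := congr1 (fun x : 'cV[int]_n => x i 0) (Huv j).
  rewrite !mxE eqxx andbT => E.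
  have -> : \sum_k M i k * U k j = \sum_j0 M i j0 * (uv j).1 j0 0.
    by apply: eq_bigr => k _; rewrite mxE.
  rewrite mulrBr mulrA -PoszM -aE; apply/eqP; rewrite subr_eq; apply/eqP.
  by rewrite -E mulr_natr.
exists (\det W); split=> [p pT|z].
  have pp := T_prime pT; rewrite -(intr_Fp_eq0 _ pp).
  have -> : (\det W)%:~R = \det (map_mx intr W : 'M['F_p]_n) by rewrite det_map_mx.
  have -> : map_mx intr W = 1%:M :> 'M['F_p]_n.
    rewrite /W map_mxB map_mx1 map_mxZ /= -[Qd%:Z%:~R]pmulrn.
    have /eqP -> : Qd%:R == 0 :> 'F_p by rewrite -(dvdn_pcharf (pchar_Fp pp)) T_Qd.
    by rewrite scale0r subr0.
  by rewrite det1 oner_eq0.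
have [x <-] := cok_class_onto z; rewrite -cok_classMn -cok_classMz.
apply/cok_class_eq0; exists (U *m (\adj W *m x)).
rewrite mulmxA -EW -scalemxAl mulmxA mul_mx_adj mul_scalar_mx.
by rewrite scalerA pmulrn -!scaler_int !intz scalerA mulrC.
Qed.


Lemma lin_cok (g : {ffun 'I_n -> G}) : presents a g M ->
  exists f : cok M -> G, [/\ {morph f : x y / x - y},
    forall x, f (cok_class M x) = lin g x &
    forall z, f z = 0 -> exists z', z = z' *+ a].
Proof.
case=> _ gk; have /choice[rp Hrp] := @cok_class_onto n N M.
have Hlin x y : cok_class M x = cok_class M y -> lin g x = lin g y.
  move=> E; apply/eqP; rewrite -subr_eq0 -linB; apply/eqP/gk.
  have /cok_class_eq0[u ->] : cok_class M (x - y) = 0 by rewrite cok_classB E subrr.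
  by exists u, 0; rewrite scaler0 addr0.
exists (fun z => lin g (rp z)); split.
- by move=> x y; rewrite -linB; apply: Hlin; rewrite cok_classB !Hrp.
- by move=> x; apply: Hlin; rewrite Hrp.
move=> z /gk[u [v E]]; exists (cok_class M v).
rewrite -[LHS]Hrp E cok_classD -cok_classMn.
have -> : cok_class M (M *m u) = 0 by apply/cok_class_eq0; exists u.
by rewrite add0r -scaler_nat natz.
Qed.

(** The kernel of the map induced by [lin g] is [a] times the cokernel. It is killed by [s], prime
    to [p], so it meets the [p]-part trivially. For surjectivity, a preimage of [y] is multiplied by
    [s] and by the prime-to-[p] part [m] of [a'], which brings it into the [p]-part, and [u] undoes
    this on [y]. *)
Lemma presents_subgroup_iso (g : {ffun 'I_n -> G}) p : presents a g M -> p \in T ->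
  subgroup_iso (ppart (cok M) p) (ppart G p).
Proof.
move=> Hg pT; have pp := T_prime pT.
have [s [sT sC]] := presents_exponent Hg.
have [f [fB fcl fker]] := lin_cok Hg.
have f0 : f 0 = 0 by have := fB 0 0; rewrite !subrr.
have fN x : f (- x) = - f x by have := fB 0 x; rewrite f0 !sub0r.
have fD x y : f (x + y) = f x + f y by have := fB x (- y); rewrite fN !opprK.
have fn x k : f (x *+ k) = f x *+ k.
  by elim: k => [|k IH]; rewrite ?mulr0n // !mulrS fD IH.
have fz x (k : int) : f (x *~ k) = f x *~ k.
  by case: k => k; rewrite ?NegzE -?nmulrn -?pmulrn ?fN fn.
have cop (m : int) k : ~~ (p %| m)%Z -> coprimez m (p ^ k)%N.
  move=> pm; apply: coprimez_primes => [|p' pp']; first by rewrite expn_gt0 prime_gt0.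
  by rewrite Euclid_dvdX // dvdn_prime2 // => /andP[/eqP ->].
have bez (A : zmodType) (x : A) (m u v : int) k : u * m + v * (p ^ k)%N = 1 ->
    x *+ (p ^ k) = 0 -> x *~ (u * m) = x.
  move=> uv xk; rewrite -[RHS]mulr1z -uv mulrzDr [v * _]mulrC [x *~ (_ * v)]mulrzA.
  by rewrite -pmulrn xk mul0rz addr0.
exists f; first by move=> x y _ _; exact: fD.
split.
- by move=> z [k zk]; exists k; rewrite -fn zk f0.
- move=> x y /set_mem xp /set_mem yp fxy; apply/eqP; rewrite -subr_eq0; apply/eqP.
  have [k zk] := ppartB xp yp.
  have [z' Ez] : exists z', x - y = z' *+ a by apply: fker; rewrite fB fxy subrr.
  have /coprimezP[[u v] /= uv] := cop s k (sT p pT).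
  have zs : (x - y) *~ s = 0.
    rewrite Ez aE mulrnA [_ *+ Qd]pmulrn -mulrzA [Qd%:Z * s]mulrC mulrzA sC.
    exact: mul0rz.
  by rewrite -(bez _ _ _ _ _ _ uv zk) [u * s]mulrC mulrzA zs mul0rz.
move=> y [k yk]; have [x Ex] := Hg.1 y.
have a'0 : (0 < a')%N by move: a1; rewrite aE; case: (a').
have [m pm Ea'] := pfactor_coprime pp a'0.
have npm : ~~ (p %| m%:Z * s)%Z.
  rewrite dvdzE abszM Euclid_dvdM // negb_or -prime_coprime // pm /=.
  by have := sT p pT; rewrite dvdzE.
have /coprimezP[[u v] /= uv] := cop _ k npm.
exists (cok_class M x *~ (u * (m%:Z * s))); last by rewrite fz fcl Ex (bez _ _ _ _ _ _ uv).
exists (logn p a').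
have -> : cok_class M x *~ (u * (m%:Z * s)) *+ p ^ logn p a' =
    cok_class M x *+ a' *~ s *~ u.
  rewrite {2}Ea' !pmulrn -!mulrzA; congr (_ *~ _); rewrite PoszM; ring.
by rewrite sC mul0rz.
Qed.

End PresentsIso.

Section IsoPresents.
Variables (a : nat) (T : seq nat).
Hypothesis a1 : (1 < a)%N.
Hypothesis T_uniq : uniq T.
Hypothesis T_prime : forall p, p \in T -> prime p.
Hypothesis T_dvd : forall p, p \in T -> (p %| a)%N.
Hypothesis T_all : forall p, prime p -> (p %| a)%N -> p \in T.
Variable G : finZmodType.
Hypothesis aG : forall y : G, y *+ a = 0.
Variables (n N : nat) (M : 'M[int]_(n, N)).

(** A zero row in the Smith form gives a row of [invmx L] that kills [M] and is nonzero modulo every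
    prime. Without such rows the product of the diagonal entries kills the cokernel. *)
Lemma nondegenerate_exponent p0 : prime p0 -> ~ degenerate a p0 M ->
  exists2 c : nat, (0 < c)%N & forall z : cok M, z *+ c = 0.
Proof.
move=> pp0 nd; have [L Lu [Q Qu [d _ EM]]] := int_Smith_normal_form M.
set D := \matrix_(i, j) _ in EM.
have HD (i : 'I_n) : (i < N)%N /\ d`_i != 0.
  have [rowD|nz] := pselect (row i D = 0).
    exfalso; apply: nd; exists (row i (invmx L)); split.
      exists 0; rewrite scaler0 -row_mul EM -mulmxA mulKmx // row_mul rowD.
      by rewrite mul0mx.
    case=> w Ew; have := congr1 (fun x : 'rV[int]_n => (x *m L) 0 i) Ew.
    rewrite -row_mul mulVmx // -scalemxAl row1 mxE !eqxx [RHS]mxE => E1.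
    have : (p0 %| 1)%Z by apply/dvdzP; exists ((w *m L) 0 i); rewrite mulrC -E1.
    by rewrite dvdzE /= dvdn1 => /eqP E; rewrite E in pp0.
  have /rV0Pn[j] : row i D != 0 by apply/eqP.
  rewrite !mxE; case: (nat_of_ord i =P j) => [E|]; last by rewrite mulr0n eqxx.
  by rewrite mulr1n; split=> //; rewrite E.
pose c := (\prod_(i < n) absz (d`_i)%R)%N.
have c0 : (0 < c)%N.
  by rewrite prodn_gt0 // => i; rewrite absz_gt0; exact: (HD i).2.
exists c => // z; have [x <-] := cok_class_onto z; rewrite -cok_classMn.
have /choice[k Hk] : forall i : 'I_n, exists k : int, c%:Z = d`_i * k.
  move=> i; have : (d`_i %| c%:Z)%Z by rewrite dvdzE /= /c (bigD1 i) //= dvdn_mulr.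
  by case/dvdzP => k ->; exists k; rewrite mulrC.
pose y : 'cV[int]_N := \col_j \sum_(i < n | (i == j :> nat)) k i * (invmx L *m x) i 0.
apply/cok_class_eq0; exists (invmx Q *m y).
rewrite EM -!mulmxA mulKVmx //.
have -> : D *m y = c%:Z *: (invmx L *m x).
  rewrite /y; move: (invmx L *m x) => v.
  apply/colP => i; rewrite mxE (bigD1 (Ordinal (HD i).1)) //= big1 => [|j ji].
    rewrite !mxE /= eqxx mulr1n addr0 (big_pred1 i) => [|i']; last by rewrite val_eqE.
    by rewrite (Hk i) mulrA.
  rewrite !mxE; case: eqP => [E|]; last by rewrite mulr0n mul0r.
  by case/eqP: ji; apply: val_inj.
by rewrite -scalemxAr mulKVmx // -scaler_nat natz.
Qed.


(** The isomorphisms of the [p]-parts, composed with the projections, add up to a surjection [F]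
    onto [G]. It remains to see that its kernel is exactly [a] times the cokernel. *)
Lemma iso_presentable p0 : p0 \in T -> ~ degenerate a p0 M ->
  (forall p, p \in T -> subgroup_iso (ppart (cok M) p) (ppart G p)) ->
  presentable a G M.
Proof.
move=> p0T nd Hiso; have [c0 c0_gt0 c0C] := nondegenerate_exponent (T_prime p0T) nd.
(* The factor [a] makes [c] kill [G] as well, and makes [a] a divisor of [c]. *)
pose c := (c0 * a)%N.
have c_gt0 : (0 < c)%N by rewrite muln_gt0 c0_gt0 ltnW.
have cC (z : cok M) : z *+ c = 0 by rewrite /c mulrnA c0C mul0rn.
have cG (y : G) : y *+ c = 0 by rewrite /c mulnC mulrnA aG mul0rn.
pose j p := logn p c.
(* On a group killed by [c], multiplication by [u p] is the projection onto the [p]-part. *)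
pose u p := chinese (p ^ j p) (c %/ p ^ j p) 1 0.
have uP p : p \in T -> u p = 1 %[mod p ^ j p] /\ (c %/ p ^ j p %| u p)%N.
  move=> pT; have pp := T_prime pT; have [m pm Ec] := pfactor_coprime pp c_gt0.
  have Em : (c %/ p ^ j p = m)%N by rewrite {1}Ec mulnK // expn_gt0 prime_gt0.
  have cop : coprime (p ^ j p) m by rewrite coprimeXl.
  split; first by rewrite /u Em chinese_modl.
  by rewrite /dvdn /u Em chinese_modr // mod0n.
have pj_dvd p : (p ^ j p %| c)%N by apply: pfactor_dvdnn.
have u_id (A : zmodType) p (x : A) : p \in T -> x *+ c = 0 -> ppart A p x ->
    x *+ u p = x.
  move=> pT xc [k xk]; have pp := T_prime pT.
  have [m pm Ec] := pfactor_coprime pp c_gt0.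
  rewrite Ec in xc; have xj := ppart_bounded pm xc xk.
  by rewrite (mulrn_eqmod xj (uP p pT).1).
have u_ppart (A : zmodType) p (x : A) : p \in T -> x *+ c = 0 -> ppart A p (x *+ u p).
  move=> pT xc; exists (j p); have /dvdnP[q ->] := (uP p pT).2.
  by rewrite -mulrnA -mulnA divnK // mulnC mulrnA xc mul0rn.
have u_dvd p p' : p \in T -> p' \in T -> p != p' -> (p' ^ j p' %| u p)%N.
  move=> pT p'T ne; have pp := T_prime pT; have pp' := T_prime p'T.
  apply: dvdn_trans (uP p pT).2.
  rewrite -(@Gauss_dvdl _ _ (p ^ j p)); first by rewrite divnK // pfactor_dvdnn.
  by rewrite coprimeXl // coprimeXr // prime_coprime // dvdn_prime2 // eq_sym.
have u_0 (A : zmodType) p p' (x : A) : p \in T -> p' \in T -> p != p' -> x *+ c = 0 ->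
    ppart A p' x -> x *+ u p = 0.
  move=> pT p'T ne xc [k xk]; have pp' := T_prime p'T.
  have [m pm Ec] := pfactor_coprime pp' c_gt0.
  have xj : x *+ (p' ^ j p') = 0.
    by move: xc; rewrite {1}Ec => xc; exact: ppart_bounded pm xc xk.
  by have /dvdnP[q ->] := u_dvd p p' pT p'T ne; rewrite mulnC mulrnA xj mul0rn.
(* The projections add up over [T] only, since [c] may have other prime divisors. The sum is still 1
   modulo [a], so it is the identity on [G], and an element that it kills is [a] times another. *)
pose Us := (\sum_(p <- T) u p)%N.
have Us_mod p : p \in T -> Us = 1 %[mod p ^ j p].
  move=> pT; rewrite /Us (big_rem p) //= -modnDmr.
  have -> : ((\sum_(y <- rem p T) u y) %% p ^ j p = 0)%N.
    apply/eqP; rewrite -/(dvdn _ _) big_seq.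
    apply: (big_ind (fun x => p ^ j p %| x)%N) => //.
    - by move=> x y; exact: dvdn_add.
    move=> y; rewrite mem_rem_uniq // inE => /andP[yp yT].
    exact: u_dvd.
  by rewrite addn0 (uP p pT).1.
have p_dvd_pj p : p \in T -> (p %| p ^ j p)%N.
  move=> pT; rewrite dvdn_exp // logn_gt0 mem_primes T_prime // c_gt0 /=.
  by rewrite /c dvdn_mull // T_dvd.
have Us1 : (1 <= Us)%N.
  rewrite lt0n; apply/eqP => U0; have := Us_mod p0 p0T; rewrite U0 mod0n.
  have := p_dvd_pj p0 p0T; have := prime_gt1 (T_prime p0T).
  move=> p01 /dvdn_leq; rewrite expn_gt0 prime_gt0 ?T_prime // => /(_ isT) le_pj.
  by rewrite modn_small // (leq_trans p01).
have a_Us : (a %| Us - 1)%N.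
  apply/dvdn_partP; first exact: ltnW.
  move=> p; rewrite mem_primes => /and3P[pp _ pa]; have pT := T_all pp pa.
  rewrite p_part; apply: (@dvdn_trans (p ^ j p)).
    rewrite dvdn_exp2l // /j /c lognM ?(ltnW a1) //; exact: leq_addl.
  by rewrite -eqn_mod_dvd //; apply/eqP/Us_mod.
have [q Eq] := dvdnP a_Us.
have UsE : Us = (q * a + 1)%N by rewrite -Eq subnK.
have Us_id (y : G) : y *+ Us = y.
  by rewrite UsE mulrnDr mulnC mulrnA aG mul0rn add0r.
have /choice[f Hf] : forall p, exists f : cok M -> G, p \in T ->
    {in ppart (cok M) p &, {morph f : x y / x + y}} /\
    set_bij (ppart (cok M) p) (ppart G p) f.
  move=> p; have [pT|npT] := boolP (p \in T); last by exists (fun=> 0).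
  by have [f fD fb] := Hiso p pT; exists f.
pose F z := \sum_(p <- T) f p (z *+ u p).
have uin p (z : cok M) : p \in T -> z *+ u p \in ppart (cok M) p.
  by move=> pT; apply/mem_set/u_ppart.
have FD x y : F (x + y) = F x + F y.
  rewrite /F -big_split /= big_seq [RHS]big_seq; apply: eq_bigr => p pT.
  by rewrite mulrnDl (Hf p pT).1 ?uin.
have F0 : F 0 = 0 by apply: (addIr (F 0)); rewrite -FD !add0r.
have FN x : F (- x) = - F x by apply: (addIr (F x)); rewrite -FD !addNr F0.
have Fn x k : F (x *+ k) = F x *+ k.
  by elim: k => [|k IH]; rewrite ?mulr0n // !mulrS FD IH.
have Fz x (k : int) : F (x *~ k) = F x *~ k.
  by case: k => k; rewrite ?NegzE -?nmulrn -?pmulrn ?FN Fn.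
have fG p z : p \in T -> ppart G p (f p (z *+ u p)).
  by move=> pT; have [ff _ _] := (Hf p pT).2; apply: ff; apply: u_ppart.
have F_u p z : p \in T -> F z *+ u p = f p (z *+ u p).
  move=> pT; rewrite /F -sumrMnl (bigD1_seq p) //= big_seq_cond big1 ?addr0.
    by rewrite (u_id G p _ pT (cG _) (fG p z pT)).
  move=> p' /andP[p'T ne]; apply: (u_0 G p p' _ pT p'T _ (cG _) (fG p' z p'T)).
  by rewrite eq_sym.
have f0 p : p \in T -> f p 0 = 0.
  move=> pT; apply: (addIr (f p 0)); rewrite -(Hf p pT).1 ?add0r //;
  by apply/mem_set/ppart0.
have F_onto y : exists z, F z = y.
  have /choice[x Hx] : forall p, exists x, p \in T ->
      ppart (cok M) p x /\ f p x = y *+ u p.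
    move=> p; have [pT|npT] := boolP (p \in T); last by exists 0.
    have [_ _ fs] := (Hf p pT).2.
    by have [x xp fx] := fs _ (u_ppart G p y pT (cG y)); exists x.
  exists (\sum_(p <- T) x p); rewrite -[RHS]Us_id /Us -sumrMnr.
  rewrite /F big_seq [RHS]big_seq; apply: eq_bigr => p pT.
  rewrite -(Hx p pT).2; congr (f p _).
  rewrite -sumrMnl (bigD1_seq p) //= big_seq_cond big1 ?addr0.
    by rewrite (u_id _ p _ pT (cC _) (Hx p pT).1).
  move=> p' /andP[p'T ne]; apply: (u_0 _ p p' _ pT p'T _ (cC _) (Hx p' p'T).1).
  by rewrite eq_sym.
have F_ker z : F z = 0 -> exists z', z = z' *+ a.
  move=> Fz0; have zu p : p \in T -> z *+ u p = 0.
    move=> pT; have := F_u p z pT; rewrite Fz0 mul0rn -(f0 p pT) => E.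
    have [_ fi _] := (Hf p pT).2; apply/esym; apply: fi => //; last exact: uin.
    exact/mem_set/ppart0.
  have : z *+ Us = 0.
    by rewrite /Us -sumrMnr big_seq big1 // => p pT; rewrite zu.
  rewrite UsE mulrnDr mulr1n => /eqP; rewrite addrC addr_eq0 => /eqP ->.
  by exists (- (z *+ q)); rewrite mulNrn mulrnA.
pose g : {ffun 'I_n -> G} := [ffun i => F (cok_class M (delta_mx i 0))].
have gE x : lin g x = F (cok_class M x).
  have Ex : x = \sum_i delta_mx i 0 *~ x i 0.
    rewrite [LHS]matrix_sum_delta; apply: eq_bigr => i _.
    by rewrite big_ord1 -scaler_int intz.
  rewrite [in RHS]Ex (big_morph (cok_class M) (@cok_classD _ _ M) (@cok_class0 _ _ M)).
  rewrite (big_morph F FD F0) /lin; apply: eq_bigr => i _.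
  by rewrite ffunE cok_classMz Fz.
exists g; split.
  move=> y; have [z <-] := F_onto y; have [x <-] := cok_class_onto z.
  by exists x; rewrite gE.
move=> x; rewrite gE; split=> [/F_ker[z']|[v [w ->]]].
  have [w <-] := cok_class_onto z'; rewrite -cok_classMn => E.
  have /cok_class_eq0[v Ev] : cok_class M (x - w *+ a) = 0.
    by rewrite cok_classB E subrr.
  by exists v, w; rewrite -Ev -scaler_nat natz subrK.
have -> : cok_class M (M *m v + a%:Z *: w) = cok_class M w *+ a.
  rewrite cok_classD -cok_classMn -scaler_nat natz.
  have -> : cok_class M (M *m v) = 0 by apply/cok_class_eq0; exists v.
  by rewrite add0r.
by rewrite Fn aG.
Qed.

End IsoPresents.

(** * Random matrices and the limit *)

Import classical_sets.
Local Open Scope classical_set_scope.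

Section LawOfReduction.
Context (R : realType) (d : measure_display) (Omega : measurableType d).
Variable P : probability Omega R.

Lemma measurable_preimage_count (V : countType) (X : Omega -> V) (B : set V) :
  (forall v, measurable [set w | X w = v]) -> measurable [set w | B (X w)].
Proof.
move=> mX.
have -> : [set w | B (X w)] =
    \bigcup_(v in [set: V]) [set w | X w = v /\ B v].
  by apply/seteqP; split=> [w Bw|w [v _ [<-]]//]; exists (X w).
apply: countable_bigcupT_measurable => [|v]; first exact: countableP.
have [Bv|nBv] := pselect (B v).
  by have -> : [set w | X w = v /\ B v] = [set w | X w = v]
    by apply/seteqP; split=> w //= [].
by have -> : [set w | X w = v /\ B v] = set0 by apply/seteqP; split=> w //= [].
Qed.

Definition prob (A : set Omega) : R := fine (P A).

Lemma probE A : measurable A -> P A = (prob A)%:E.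
Proof. by move=> mA; rewrite fineK // fin_num_measure. Qed.

Lemma le_prob A B : measurable A -> measurable B -> A `<=` B -> prob A <= prob B.
Proof.
by move=> mA mB AB; rewrite -lee_fin -!probE // le_measure ?inE.
Qed.

Lemma prob_ge0 A : 0 <= prob A. Proof. exact: fine_ge0. Qed.

Lemma prob_orD A B : measurable A -> measurable B ->
  prob (A `|` B) <= prob A + prob B.
Proof.
move=> mA mB; rewrite -lee_fin EFinD -!probE ?measureU2 //.
exact: measurableU.
Qed.

Lemma sum_prob_seq (V : countType) (X : Omega -> V) (s : seq V) :
  (forall v, measurable [set w | X w = v]) -> uniq s ->
  prob [set w | X w \in s] = \sum_(v <- s) prob [set w | X w = v].
Proof.
move=> mX; elim: s => [_|v s IH /= /andP[vs us]].
  rewrite big_nil /prob; have -> : [set w | X w \in [::]] = set0.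
    by apply/seteqP; split=> w.
  by rewrite measure0.
rewrite big_cons -IH //; apply: EFin_inj; rewrite EFinD -!probE //; last 2 first.
- exact: (measurable_preimage_count [set v' | v' \in s] mX).
- exact: (measurable_preimage_count [set v' | v' \in v :: s] mX).
rewrite -measureU //; last 2 first.
- exact: (measurable_preimage_count [set v' | v' \in s] mX).
- by apply/seteqP; split=> w //= [-> ]; rewrite (negbTE vs).
congr (P _); apply/seteqP; split=> w /=; rewrite inE.
  by case/orP => [/eqP|]; [left|right].
by case=> [->|->]; rewrite ?eqxx ?orbT.
Qed.

Lemma sum_prob (V : finType) (X : Omega -> V) (D : V -> Prop) :
  (forall v, measurable [set w | X w = v]) ->
  prob [set w | D (X w)] = \sum_(v | `[< D v >]) prob [set w | X w = v].
Proof.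
move=> mX; rewrite -big_filter -(sum_prob_seq mX); last first.
  by rewrite filter_uniq // index_enum_uniq.
congr prob; apply/seteqP; split=> w /=; rewrite mem_filter mem_index_enum andbT.
  by move=> Dw; apply/asboolP.
by move/asboolP.
Qed.

Variables (eps : R) (k m N : nat) (alpha beta : nat -> nat).
Variable M : Omega -> 'M[int]_(m, N).
Hypothesis HM : balanced_stairs_matrix P eps k alpha beta M.
Notation I := ('I_m * 'I_N)%type.

Let entry (ij : I) (w : Omega) : int := M w ij.1 ij.2.

Lemma measurable_entry ij (B : set int) : measurable [set w | B (entry ij w)].
Proof.
have [Hz Hm _ _] := HM.
have [ijZ|ijZ] := boolP (ij \in stairs_zeros k m N alpha beta); last first.
  have := Hm _ ijZ measurableT B; rewrite classical_sets.setTI; exact.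
have [B0|nB0] := pselect (B 0).
  have -> : [set w | B (entry ij w)] = classical_sets.setT; last exact: measurableT.
  by apply/seteqP; split=> w //= _; rewrite /entry (Hz _ ijZ w).
have -> : [set w | B (entry ij w)] = classical_sets.set0; last exact: measurable0.
by apply/seteqP; split=> w //=; rewrite /entry (Hz _ ijZ w).
Qed.

Lemma measurable_matrix (Phi : 'M[int]_(m, N) -> Prop) : measurable [set w | Phi (M w)].
Proof.
apply: (measurable_preimage_count Phi) => A.
have -> : [set w | M w = A] =
    \bigcap_(ij in [set: I]) [set w | entry ij w = A ij.1 ij.2].
  apply/seteqP; split=> [w <- ij _ //|w H].
  by apply/matrixP => i j; exact: (H (i, j)).
apply: fin_bigcap_measurable => [|ij _]; first exact: finite_finset.
exact: (measurable_entry ij ([set z | z = A ij.1 ij.2])).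
Qed.

Variable a : nat.
Hypothesis a1 : (1 < a)%N.

Definition residues (w : Omega) : {ffun I -> 'Z_a} := [ffun ij => (entry ij w)%:~R].

Definition residue_law (ij : I) (x : 'Z_a) : R := prob [set w | (entry ij w)%:~R = x].

Lemma residue_law_weights : weights residue_law.
Proof.
split=> [ij x|ij]; first exact: prob_ge0.
have mX x : measurable [set w | (entry ij w)%:~R = x :> 'Z_a].
  exact: (measurable_entry ij ([set z | z%:~R = x :> 'Z_a])).
transitivity (prob [set w | True]).
  rewrite (sum_prob (fun _ : 'Z_a => True) mX); apply: eq_bigl => x.
  by rewrite asboolT.
rewrite /prob (_ : [set w | True] = classical_sets.setT) ?probability_setT //.
Qed.

(** A fixed zero has its law concentrated at the residue 0, so it fits into the product as one more
    factor; the other entries are mutually independent by hypothesis. *)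
Lemma prob_residues (D : {ffun I -> 'Z_a} -> Prop) :
  prob [set w | D (residues w)] = Pr residue_law D.
Proof.
have [Hz Hm _ Hind] := HM.
have mf f : measurable [set w | residues w = f].
  exact: (measurable_matrix (fun A => [ffun ij : I => (A ij.1 ij.2)%:~R] = f)).
rewrite (sum_prob D mf) /Pr; apply: eq_bigr => f _; rewrite /Wt.
set Z := stairs_zeros k m N alpha beta in Hz Hm Hind.
pose B (ij : I) : set int := [set z | z%:~R = f ij].
have [f0|] := pselect (forall ij, ij \in Z -> f ij = 0); last first.
  (* A nonzero residue prescribed at a fixed zero makes both sides vanish. *)
  move=> /existsNP[ij /not_implyP[ijZ fij]].
  rewrite (bigD1 ij) //= /residue_law.
  have -> : [set w | (entry ij w)%:~R = f ij] = classical_sets.set0.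
    by apply/seteqP; split=> w //=; rewrite /entry (Hz _ ijZ) => E; apply: fij.
  rewrite {2}/prob measure0 mul0r /prob.
  have -> : [set w | residues w = f] = classical_sets.set0; last by rewrite measure0.
  apply/seteqP; split=> w //= E; apply: fij; rewrite -E ffunE.
  by rewrite /entry (Hz _ ijZ).
rewrite (bigID (mem Z)) /= big1 ?mul1r => [|ij ijZ]; last first.
  rewrite /residue_law (_ : [set w | _] = classical_sets.setT).
    by rewrite /prob probability_setT.
  by apply/seteqP; split=> w //= _; rewrite /entry (Hz _ ijZ) f0.
apply: EFin_inj; rewrite -probE // -prodEFin.
have := Hind (~: Z)%SET (fintype.subxx _) B.
have -> : \bigcap_(ij in [set` (~: Z)%SET]) entry ij @^-1` B ij = [set w | residues w = f].
  apply/seteqP; split=> w /= H.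
    apply/ffunP => ij; rewrite ffunE; have [ijZ|ijZ] := boolP (ij \in Z).
      by rewrite /entry (Hz _ ijZ) f0.
    by apply: (H ij); rewrite /= inE.
  by move=> ij _; rewrite /B /= -H ffunE.
move=> ->; apply: eq_big => [ij|ij _]; first by rewrite inE.
rewrite -probE //; exact: (measurable_entry ij (B ij)).
Qed.

Lemma residue_law_balanced (ij : I) p c : prime p -> (p %| a)%N ->
  ij \notin stairs_zeros k m N alpha beta ->
  \sum_(x : 'Z_a | (x %% p == c)%N) residue_law ij x <= 1 - eps.
Proof.
move=> pp pa ijZ; have [_ _ Hb _] := HM.
have mX x : measurable [set w | (entry ij w)%:~R = x :> 'Z_a].
  exact: (measurable_entry ij ([set z | z%:~R = x :> 'Z_a])).
have <- : prob [set w | ((entry ij w)%:~R : 'Z_a) %% p = c]%N =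
    \sum_(x : 'Z_a | (x %% p == c)%N) residue_law ij x.
  rewrite (sum_prob (fun x : 'Z_a => (x %% p)%N = c) mX); apply: eq_bigl => x.
  by apply/asboolP/eqP.
have := Hb _ ijZ p pp c%:R; rewrite probE; last first.
  exact: (measurable_entry ij ([set z | z%:~R = c%:R :> 'F_p])).
rewrite lee_fin; apply: le_trans; apply: le_prob.
- exact: (measurable_entry ij ([set z | (z%:~R : 'Z_a) %% p = c]%N)).
- exact: (measurable_entry ij ([set z | z%:~R = c%:R :> 'F_p])).
move=> w /= <-; rewrite -(Zp_red_intr a1 _ pp pa) /Zp_red.
by apply/eqP; rewrite eq_natr_Fp // modn_mod.
Qed.

End LawOfReduction.

Section Estimate.
Context (R : realType) (d : measure_display) (Omega : measurableType d).
Variables (P : probability Omega R) (eps : R).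
Hypothesis eps0 : 0 < eps.
Hypothesis eps1 : eps < 1.
Variable T : seq nat.
Hypothesis T_uniq : uniq T.
Hypothesis T_prime : forall p, p \in T -> prime p.
Variables (a a' Qd p0 e : nat).
Hypothesis a1 : (1 < a)%N.
Hypothesis T_all : forall p, prime p -> (p %| a)%N -> p \in T.
Hypothesis aE : a = (a' * Qd)%N.
Hypothesis T_Qd : forall p, p \in T -> (p %| Qd)%N.
Hypothesis p0T : p0 \in T.
Hypothesis p0e : (p0 ^ e %| a)%N.
Variable G : finZmodType.
Hypothesis a'G : forall y : G, y *+ a' = 0.

Definition equidistribution_error (r s sigma : nat) : R :=
  let h := #|'M['Z_a]_(r, s)| in
  h%:R * (1 - (eps / #|'Z_a|%:R) ^+ h * h%:R) ^+ sigma.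

(** For each prime: Odlyzko's bound for the columns, then for the rows meeting the zeros, then the
    union bound over vectors of support at most [c]. *)
Definition bad_error (k r b w c : nat) : R :=
  \sum_(p <- T)
    ((1 - (1 - eps))^-1 * ((1 - eps) ^+ r + k%:R * (1 - eps) ^+ w) +
     ((1 - (1 - eps))^-1 * (k%:R * (1 - eps) ^+ (w - r)) +
      (((b + r) * p).+1 ^ c)%:R * (1 - eps) ^+ b)).

Definition main_value (r s : nat) : R :=
  onto_fraction R r G * (#|Aut [set: G]%SET|%:R * #|G|%:R ^+ (s - r))^-1 *
  \prod_(p <- T) free_fraction R r s p.

Let T_dvd p : p \in T -> (p %| a)%N.
Proof. by move=> /T_Qd pQ; rewrite aE dvdn_mull. Qed.

(** The event contains presentability of [G] by [M v] and is contained in its union with degeneracy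
    at [p0]. Both are compared with a uniform matrix at the cost of the same error, whence the
    factor 2. *)
Lemma stairs_estimate (m N b r s k : nat) (alpha beta : nat -> nat) (w sigma : nat)
    (M : Omega -> 'M[int]_(m, N)) :
  m = (b + r)%N -> N = (b + s)%N -> (r <= s)%N -> (r <= w)%N ->
  (forall l, (1 <= l <= k)%N -> (alpha l + beta l + w <= b + r)%N) ->
  balanced_stairs_matrix P eps k alpha beta M ->
  `|prob P [set v | forall p, p \in T ->
      subgroup_iso (ppart (cok (M v)) p) (ppart G p)] - main_value r s| <=
  r%:R / p0%:R ^+ e + 2 * (equidistribution_error r s sigma +
    bad_error k r b w (sigma * #|'M['Z_a]_(r, s)|)).
Proof.
move=> Em EN rs rw gap HM; subst m N.
have pp0 := T_prime p0T.
pose mu := residue_law P M (a := a).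
have muW : weights mu := residue_law_weights HM a.
have bal (ij : 'I_(b + r) * 'I_(b + s)) p c : stairs_free k alpha beta ij.1 ij.2 ->
    p \in T -> \sum_(x : 'Z_a | (x %% p == c)%N) mu ij x <= 1 - eps.
  move=> fij pT; apply: (residue_law_balanced HM a1 c (T_prime pT) (T_dvd pT)).
  by rewrite inE -all_predC.
have bal0 (ij : 'I_(b + r) * 'I_(b + s)) p c :
    ij \in [set ij : 'I_(b + r) * 'I_(b + s) | (b <= ij.2)%N]%SET ->
    p \in T -> \sum_(x : 'Z_a | (x %% p == c)%N) mu ij x <= 1 - eps.
  rewrite inE => bij; apply: bal; apply/allP => l; rewrite mem_iota add1n ltnS => /gap gl.
  by rewrite negb_and -!leqNgt; apply/orP; right; lia.
have q0 : 0 <= 1 - eps by rewrite subr_ge0 ltW.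
have q1 : 1 - eps < 1 by rewrite ltrBlDr ltrDl.
have bad := Pr_not_good a1 T_prime muW q0 q1 rw gap bal (sigma * #|'M['Z_a]_(r, s)|).
have near := presentable_near_uniform a1 T_prime T_dvd T_all muW eps0 (ltW eps1) bal0 G sigma.
have deg := degenerate_near_uniform a1 T_prime T_dvd T_all muW eps0 (ltW eps1) bal0
  sigma (T_dvd p0T).
have degU := ufrac_degenerate R a1 rs pp0 p0e.
rewrite (ufrac_presentable R a1 T_uniq T_prime T_dvd T_all rs aE a'G T_Qd) in near.
have Mres v : exists C, mx_of (residues M a v) = M v + a%:Z *: C.
  have -> : mx_of (residues M a v) = liftmx (map_mx intr (M v) : 'M['Z_a]_(_, _)).
    by congr liftmx; apply/matrixP => i j; rewrite !mxE ffunE.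
  exact: liftmx_intr.
have pres_res v : presentable a G (M v) <-> presentable a G (mx_of (residues M a v)).
  have [C ->] := Mres v; split=> -[g Hg]; exists g; first exact: presents_congr.
  by have := presents_congr (- C) Hg; rewrite scalerN addrK.
have deg_res v : degenerate a p0 (M v) -> degenerate a p0 (mx_of (residues M a v)).
  by have [C ->] := Mres v; exact: degenerate_congr.
set E := [set v | forall p, p \in T -> _].
have mE : measurable E.
  exact: (measurable_matrix HM (fun A => forall p, p \in T ->
    subgroup_iso (ppart (cok A) p) (ppart G p))).
have mres D : measurable [set v | D (residues M a v)].
  exact: (measurable_matrix HM (fun A =>
    D [ffun ij : 'I_(b + r) * 'I_(b + s) => (A ij.1 ij.2)%:~R])).
have low : Pr mu (fun f => presentable a G (mx_of f)) <= prob P E.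
  rewrite -(prob_residues HM); apply: le_prob => //; first exact: (mres (fun f => presentable a G (mx_of f))).
  move=> v /= /pres_res[g Hg] p pT.
  exact: (presents_subgroup_iso a1 T_prime aE a'G T_Qd Hg).
have aG (y : G) : y *+ a = 0 by rewrite aE mulrnA a'G mul0rn.
have up : prob P E <= Pr mu (fun f => presentable a G (mx_of f)) +
    Pr mu (fun f => degenerate a p0 (mx_of f)).
  rewrite -!(prob_residues HM); apply: le_trans (prob_orD P (mres (fun f => presentable a G (mx_of f)))
    (mres (fun f => degenerate a p0 (mx_of f)))).
  apply: le_prob => //; first by apply: measurableU;
    [exact: (mres (fun f => presentable a G (mx_of f)))|exact: (mres (fun f => degenerate a p0 (mx_of f)))].
  move=> v Ev; have [dv|ndv] := pselect (degenerate a p0 (M v)).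
    by right; exact: deg_res.
  left; apply/pres_res.
  exact: (iso_presentable a1 T_uniq T_prime T_dvd T_all aG p0T ndv).
move: near deg degU low up bad; rewrite -/(main_value r s) -/(equidistribution_error r s sigma).
rewrite -/(bad_error k r b w _).
set x := Pr mu (fun f => presentable a G (mx_of f)).
set y := Pr mu (fun f => degenerate a p0 (mx_of f)).
set z := Pr mu (fun f => ~ _).
move=> near deg degU low up bad.
have z0 : 0 <= z by exact: Pr_ge0.
move: near; rewrite !ler_norml => /andP[n1 n2]; apply/andP; split; lra.
Qed.

End Estimate.

(** * Elementary limits and divisibility *)

Lemma near_expr_le (R : realType) (x c eta : R) : 0 <= x -> x < 1 -> 0 < eta ->
  \forall n \near \oo, c * x ^+ n <= eta.
Proof.
move=> x0 x1 eta0.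
have /cvgrPdist_le : (fun n => c * x ^+ n) @ \oo --> (c * 0 : R).
  by apply: cvgMr; apply: cvg_expr; rewrite ger0_norm.
move=> /(_ eta eta0); apply: filterS => n.
by rewrite mulr0 sub0r normrN => /(le_trans (ler_norm _)).
Qed.

Lemma bernoulli_lower (R : realFieldType) (d : R) n : 0 <= d -> d <= 1 ->
  1 - n%:R * d <= (1 - d) ^+ n.
Proof.
move=> d0 d1; elim: n => [|n IH]; first by rewrite mul0r subr0 expr0.
rewrite exprS; apply: le_trans (ler_wpM2l _ IH); last by rewrite subr_ge0.
rewrite -natr1; have : 0 <= n%:R * d * d by rewrite !mulr_ge0.
by lra.
Qed.

Lemma bernoulli_upper (R : realFieldType) (d : R) n : 0 <= d -> d <= 1 ->
  (1 - d) ^+ n * (1 + n%:R * d) <= 1.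
Proof.
move=> d0 d1; elim: n => [|n IH]; first by rewrite mul0r addr0 expr0 mulr1.
apply: le_trans IH; rewrite exprSr -mulrA; apply: ler_wpM2l.
  by rewrite exprn_ge0 // subr_ge0.
rewrite -natr1; have : 0 <= n%:R * d * d by rewrite !mulr_ge0.
by have : 0 <= d * d by [rewrite mulr_ge0]; lra.
Qed.

(* With [y = 1 - (1 - q) / 2m] Bernoulli gives [q <= y ^ 2m], and half of these
   factors absorb the polynomial. *)
Lemma near_poly_expr_le (R : realType) (q eta : R) (p c : nat) :
  0 < q -> q < 1 -> 0 < eta ->
  \forall n \near \oo, ((n * p).+1 ^ c)%:R * q ^+ n <= eta.
Proof.
move=> q0 q1 eta0; pose m := c.+1; pose d := (1 - q) / (2 * m)%:R.
have m0 : 0 < (2 * m)%:R :> R by rewrite ltr0n.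
have d0 : 0 < d by rewrite divr_gt0 // subr_gt0.
have dm : (2 * m)%:R * d = 1 - q by rewrite mulrC divfK // gt_eqF.
have d1 : d < 1.
  apply: (@le_lt_trans _ _ ((2 * m)%:R * d)); last by rewrite dm; lra.
  by rewrite ler_peMl ?(ltW d0) // ler1n.
have y0 : 0 <= 1 - d by rewrite subr_ge0 ltW.
have qy : q <= (1 - d) ^+ (2 * m).
  by have := bernoulli_lower (2 * m) (ltW d0) (ltW d1); rewrite dm; lra.
pose K := p%:R / d + 1.
have K1 : 1 <= K by rewrite lerDr divr_ge0 // ltW.
have Kn n : (n * p).+1%:R * (1 - d) ^+ n <= K.
  have b1 := bernoulli_upper n (ltW d0) (ltW d1).
  have e0 : 0 <= (1 - d) ^+ n by exact: exprn_ge0.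
  have e1 : (1 - d) ^+ n <= 1 by rewrite exprn_ile1 //; lra.
  rewrite -natr1 mulrDl mul1r; apply: lerD => //.
  rewrite natrM ler_pdivlMr //.
  have -> : n%:R * p%:R * (1 - d) ^+ n * d = p%:R * ((1 - d) ^+ n * (n%:R * d)).
    by ring.
  apply: ler_piMr => //.
  by move: b1; rewrite mulrDr mulr1; lra.
have y1 : (1 - d) ^+ m < 1 by rewrite exprn_ilt1 //; lra.
have := near_expr_le (K ^+ m) (exprn_ge0 m y0) y1 eta0.
apply: filterS => n; apply: le_trans.
apply: (@le_trans _ _ (((n * p).+1%:R * (1 - d) ^+ n) ^+ m * ((1 - d) ^+ m) ^+ n)).
  rewrite natrX exprMn -mulrA; apply: ler_pM => //.
  - by apply: exprn_ge0; exact: ltW.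
  - by apply: ler_weXn2l => //; rewrite ler1n.
  apply: (@le_trans _ _ (((1 - d) ^+ (2 * m)) ^+ n)).
    by apply: lerXn2r => //; rewrite nnegrE ?exprn_ge0 // ltW.
  by rewrite -!exprM -exprD mul2n -addnn mulnDl [(n * m)%N]mulnC.
rewrite [leRHS](_ : _ = (K ^+ m) * ((1 - d) ^+ m) ^+ n) //.
apply: ler_wpM2r; first by rewrite !exprn_ge0.
by apply: lerXn2r; rewrite ?nnegrE ?(le_trans ler01 K1) // mulr_ge0 // exprn_ge0.
Qed.

Lemma free_fractionE (R : realFieldType) r t p : (0 < p)%N ->
  free_fraction R r (r + t) p = \prod_(1 <= i < r.+1) (1 - p%:R ^- (i + t)).
Proof.
move=> p0; rewrite big_add1 big_mkord /free_fraction (reindex_inj rev_ord_inj) /=.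
apply: eq_bigr => i _; congr (1 - _).
have pr0 : p%:R != 0 :> R by rewrite pnatr_eq0 -lt0n.
have -> : (r + t = (r - i.+1) + (i.+1 + t))%N by have := ltn_ord i; lia.
by rewrite exprD invfM mulrA divff ?mul1r // expf_neq0.
Qed.

Lemma cvg_euler_product (R : realType) (t p : nat) : (1 < p)%N ->
  (fun r : nat => \prod_(1 <= i < r.+1) (1 - p%:R ^- (i + t)) : R) @ \oo -->
  limn (fun N : nat => \prod_(1 <= i < N.+1) (1 - p%:R ^- (i + t)) : R).
Proof.
move=> p1; have f01 i : 0 <= 1 - (p%:R : R) ^- (i + t) <= 1.
  rewrite subr_ge0 lerBlDr lerDl invr_ge0 exprn_ge0 // andbT.
  by rewrite invf_le1 ?exprn_gt0 ?ltr0n ?(ltnW p1) // exprn_ege1 // ler1n ltnW.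
have u0 n : 0 <= \prod_(1 <= i < n.+1) (1 - p%:R ^- (i + t)) :> R.
  by apply: prodr_ge0 => i _; case/andP: (f01 i).
apply: nonincreasing_is_cvgn.
  apply/nonincreasing_seqP => n; rewrite [X in X <= _]big_nat_recr //=.
  by rewrite ler_piMr //; case/andP: (f01 n.+1).
by exists 0 => _ [n _ <-].
Qed.

Lemma cvg_main_value (R : realType) (T : seq nat) (G : finZmodType) (t : nat) :
  (forall p, p \in T -> prime p) ->
  (fun r => main_value R T G r (r + t)) @ \oo -->
  (#|Aut [set: G]%SET|%:R * #|G|%:R ^+ t)^-1 *
  \prod_(p <- T)
     limn (fun N : nat => \prod_(1 <= i < N.+1) (1 - p%:R ^- (i + t)) : R).
Proof.
move=> Tp; set c := _^-1.
have onto1 : onto_fraction R r G @[r --> \oo] --> (1 : R).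
  have low : 1 - 2 ^+ #|G| * 2^-1 ^+ r @[r --> \oo] --> (1 - 2 ^+ #|G| * 0 : R).
    apply: cvgB; first exact: cvg_cst.
    by apply: cvgMr; apply: cvg_expr; rewrite ger0_norm ?invr_ge0 // invf_lt1 // ltr1n.
  rewrite mulr0 subr0 in low.
  apply: (squeeze_cvgr _ low (cvg_cst (1 : R))); near=> r.
  by rewrite exprVn onto_fraction_ge onto_fraction_le1.
have prod_cvg : \prod_(p <- T) free_fraction R r (r + t) p @[r --> \oo] -->
    \prod_(p <- T)
      limn (fun N : nat => \prod_(1 <= i < N.+1) (1 - p%:R ^- (i + t)) : R).
  elim: T Tp => [|p T' IH] Tp.
    rewrite big_nil (_ : (fun _ => _) = fun=> 1); first exact: cvg_cst.
    by apply/funext => r; rewrite big_nil.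
  have pp : prime p by rewrite Tp ?mem_head.
  rewrite big_cons (_ : (fun _ => _) = fun r =>
      (\prod_(1 <= i < r.+1) (1 - p%:R ^- (i + t))) *
      \prod_(p' <- T') free_fraction R r (r + t) p').
    apply: cvgM; first exact: cvg_euler_product (prime_gt1 pp).
    by apply: IH => x xT; rewrite Tp // inE xT orbT.
  by apply/funext => r; rewrite big_cons (free_fractionE _ _ _ (prime_gt0 pp)).
have -> : (fun r => main_value R T G r (r + t)) = (fun r => onto_fraction R r G *
    (c * \prod_(p <- T) free_fraction R r (r + t) p)).
  by apply/funext => r; rewrite /main_value addKn mulrA.
set L := \prod_(_ <- _) _ in prod_cvg *.
rewrite -[c * L]mul1r; apply: cvgM onto1 _; exact: cvgMr.
Unshelve. all: by end_near.
Qed.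

(** Divergence is given for each step separately; as there are finitely many steps, one threshold
    for [n] serves them all. *)
Lemma near_gap (R : realType) (k W : nat) (alpha beta : nat -> nat -> nat) :
  (forall i : nat, (1 <= i <= k)%N ->
     n%:R - (alpha n i)%:R - (beta n i)%:R @[n --> \oo] --> (+oo : set_system R)) ->
  \forall n \near \oo,
    forall l, (1 <= l <= k)%N -> (alpha n l + beta n l + W <= n)%N.
Proof.
move=> H; suff near_upto j : (j <= k)%N -> \forall n \near \oo,
    forall l, (1 <= l <= j)%N -> (alpha n l + beta n l + W <= n)%N by exact: near_upto.
elim: j => [|j IH] jk; first by near=> n => l; case: l.
have /cvgryPge /(_ W%:R) Hj := H j.+1 jk.
apply: filterS2 (IH (ltnW jk)) Hj => n IHn Hn l /andP[l1].
rewrite leq_eqVlt => /orP[/eqP ->|lj]; last by apply: IHn; rewrite l1.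
by move: Hn; rewrite -addrA -opprD -natrD lerBrDr -natrD ler_nat addnC.
Unshelve. all: by end_near.
Qed.

Lemma prime_dvd_prod (T : seq nat) p : prime p -> {in T, forall p', prime p'} ->
  (p %| \prod_(p' <- T) p')%N -> p \in T.
Proof.
move=> pp; elim: T => [|p' T IH] Tp; first by rewrite big_nil Euclid_dvd1.
rewrite big_cons Euclid_dvdM // inE => /orP[|pT].
  by rewrite dvdn_prime2 ?(Tp p') ?mem_head // => ->.
by rewrite IH ?orbT // => x xT; rewrite Tp // inE xT orbT.
Qed.

Lemma dvd_card_exp (G : finZmodType) (Q : nat) e : (#|G| <= e)%N ->
  (forall p, prime p -> (p %| #|G|)%N -> (p %| Q)%N) -> (#|G| %| Q ^ e)%N.
Proof.
move=> Ge GQ; have G0 : (0 < #|G|)%N by apply/card_gt0P; exists 0.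
apply/dvdn_partP => // p; rewrite mem_primes => /and3P[pp _ pG].
rewrite p_part; apply: (@dvdn_trans (p ^ e)).
  by rewrite dvdn_exp2l // (leq_trans _ Ge) // ltnW // ltn_logl.
exact: dvdn_exp2r (GQ p pp pG).
Qed.

Lemma mulrn_card (G : finZmodType) (y : G) : y *+ #|G| = 0.
Proof.
apply: (addrI (\sum_(z : G) z)); rewrite addr0 -sumr_const -big_split /=.
by rewrite [RHS](reindex_inj (addIr y)).
Qed.

(** * Choice of the parameters *)

Section Limit.
Variables (R : realType) (eps : R) (t k : nat) (alpha beta : nat -> nat -> nat).
Variables (d : nat -> measure_display) (Omega : forall n : nat, measurableType (d n)).
Variables (P : forall n : nat, probability (Omega n) R).
Variables (M : forall n : nat, Omega n -> 'M[int]_(n, n + t)).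
Variables (G : finZmodType) (T : seq nat).
Hypothesis eps0 : 0 < eps.
Hypothesis eps1 : eps < 1.
Hypothesis HM : \forall n \near \oo,
  balanced_stairs_matrix (P n) eps k (alpha n) (beta n) (@M n).
Hypothesis Hgap : forall i : nat, (1 <= i <= k)%N ->
  n%:R - (alpha n i)%:R - (beta n i)%:R @[n --> \oo] --> (+oo : set_system R).
Hypothesis T_uniq : uniq T.
Hypothesis T_prime : forall p, p \in T -> prime p.
Hypothesis T_G : forall p, prime p -> (p %| #|G|)%N -> p \in T.

Let L : R := (#|Aut [set: G]%SET|%:R * #|G|%:R ^+ t)^-1 *
   \prod_(p <- T)
     limn (fun N : nat => \prod_(1 <= i < N.+1) (1 - p%:R ^- (i + t)) : R).

(** [r] is chosen for the main value and the column error, then [e] for degeneracy, which depends on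
    [r]. These determine [a], on which [sigma] depends; [W] controls the rows meeting the zeros, and
    [n] comes last. *)
Lemma prob_cok_limit p0 : p0 \in T ->
  prob (P n) [set w | forall p : nat, p \in T ->
    subgroup_iso (ppart (cok (M w)) p) (ppart G p)] @[n --> \oo] --> L.
Proof.
move=> p0T; apply/cvgrPdist_le => eta eta0; pose q := 1 - eps.
have q0 : 0 < q by rewrite subr_gt0.
have q1 : q < 1 by rewrite ltrBlDr ltrDl.
have sT : 0 < (size T)%:R :> R by rewrite ltr0n; case: (T) p0T.
(* Each of the four terms of [bad_error] gets [tau / 4] per prime, so that the sum over [T] is at
   most [eta / 8]. The total is then [eta / 4 + 2 * (eta / 8 + eta / 8) + eta / 4]. *)
pose tau := eta / (8 * (size T)%:R).
have tau0 : 0 < tau by rewrite divr_gt0 // mulr_gt0.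
have tau4 : 0 < tau / 4 by rewrite divr_gt0.
have eta4 : 0 < eta / 4 by rewrite divr_gt0.
have eta8 : 0 < eta / 8 by rewrite divr_gt0.
pose C : R := (1 - q)^-1.
have C0 : 0 <= C by rewrite invr_ge0 subr_ge0 ltW.
have /cvgrPdist_le/(_ _ eta4) near_r1 := @cvg_main_value R T G t T_prime.
have [r [main_r C_r]] := filter_ex (filterI near_r1 (near_expr_le C (ltW q0) q1 tau4)).
have pp0 := T_prime p0T.
have ip0 : (p0%:R : R)^-1 < 1 by rewrite invf_lt1 ?ltr1n ?ltr0n ?prime_gt1 ?prime_gt0.
have ip0' : 0 <= (p0%:R : R)^-1 by rewrite invr_ge0.
have [e [e_r Ge]] := filter_ex (filterI (near_expr_le r%:R ip0' ip0 eta4)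
  (nbhs_infty_ge #|G|)).
(* [Q ^ e] serves as [a']: as [e >= #|G|], it is a multiple of [#|G|]. It is also a multiple of
   [p0 ^ e], and the last [Q] is the spare factor. *)
pose Q := (\prod_(p <- T) p)%N; pose a := (Q ^ e * Q)%N.
have T_Q p : p \in T -> (p %| Q)%N by move=> pT; rewrite /Q (big_rem p) //= dvdn_mulr.
have Q0 : (0 < Q)%N.
  rewrite /Q big_seq; apply: prodn_cond_gt0 => p pT; exact: prime_gt0 (T_prime pT).
have Q1 : (1 < Q)%N.
  by apply: leq_trans (prime_gt1 pp0) _; apply: dvdn_leq (T_Q _ p0T).
have a1 : (1 < a)%N by apply: leq_trans Q1 _; rewrite leq_pmull // expn_gt0 Q0.
have T_all p : prime p -> (p %| a)%N -> p \in T.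
  move=> pp pa; apply: prime_dvd_prod => //; move: pa.
  by rewrite /a Euclid_dvdM // Euclid_dvdX // => /orP[/andP[]|].
have p0e : (p0 ^ e %| a)%N by rewrite /a dvdn_mulr // dvdn_exp2r // T_Q.
have QG (y : G) : y *+ Q ^ e = 0.
  have /dvdnP[c ->] : (#|G| %| Q ^ e)%N.
    by apply: dvd_card_exp => // p pp pG; apply: T_Q; exact: T_G.
  by rewrite mulnC mulrnA mulrn_card mul0rn.
pose h := #|'M['Z_a]_(r, r + t)|.
pose x : R := 1 - (eps / #|'Z_a|%:R) ^+ h * h%:R.
have x0 : 0 <= x := kappa_card a r (r + t) eps0 (ltW eps1).
have h0 : (0 < h)%N by apply/card_gt0P; exists 0.
have x1 : x < 1.
  rewrite ltrBlDr ltrDl mulr_gt0 ?ltr0n // exprn_gt0 // divr_gt0 // ltr0n.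
  by apply/card_gt0P; exists 0.
have [sigma Hsigma] := filter_ex (near_expr_le h%:R x0 x1 eta8).
have [W HW] := filter_ex (near_expr_le (C * k%:R) (ltW q0) q1 tau4).
(* The union bound only yields the exponent [n - r]; the extra [q ^+ r] turns this into the exponent
   [n] of [near_poly_expr_le]. *)
have qr0 : 0 < q ^+ r * (tau / 4) by rewrite mulr_gt0 // exprn_gt0.
near=> n.
have rn : (r <= n)%N by near: n; exact: nbhs_infty_ge.
have gap : forall l, (1 <= l <= k)%N -> (alpha n l + beta n l + (r + W) <= n)%N.
  by near: n; exact: (@near_gap R k (r + W) alpha beta Hgap).
have Mn : balanced_stairs_matrix (P n) eps k (alpha n) (beta n) (@M n)
  by near: n; exact: HM.
have poly : ((n * Q).+1 ^ (sigma * h))%:R * q ^+ n <= q ^+ r * (tau / 4).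
  by near: n; exact: near_poly_expr_le.
have En : n = ((n - r) + r)%N by rewrite subnK.
have ENt : (n + t = (n - r) + (r + t))%N by rewrite addnA subnK.
have gap' l : (1 <= l <= k)%N -> (alpha n l + beta n l + (r + W) <= n - r + r)%N.
  by rewrite subnK //; exact: gap.
have est := @stairs_estimate R _ _ (P n) eps eps0 eps1 T T_uniq T_prime a (Q ^ e) Q p0 e
  a1 T_all (erefl _) T_Q p0T p0e G QG n (n + t) (n - r) r (r + t) k (alpha n) (beta n)
  (r + W) sigma (@M n) En ENt (leq_addr _ _) (leq_addr _ _) gap' Mn.
have bad : bad_error eps T k r (n - r) (r + W) (sigma * h) <= (size T)%:R * tau.
  apply: sum_seq_le_const => p pT; rewrite subnK // -/q -/C addKn.
  have Hp : (((n * p).+1 ^ (sigma * h))%:R : R) * q ^+ (n - r) <= tau / 4.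
    rewrite -(ler_pM2l (exprn_gt0 r q0)); apply: le_trans poly.
    rewrite mulrCA -exprD subnKC //; apply: ler_wpM2r; first by rewrite exprn_ge0 // ltW.
    rewrite !natrX; apply: lerXn2r; rewrite ?nnegrE ?ler0n // ler_nat ltnS.
    by rewrite leq_mul2l (dvdn_leq Q0) ?orbT // T_Q.
  have w4 : C * (k%:R * q ^+ W) <= tau / 4 by rewrite mulrA.
  have rw4 : C * (k%:R * q ^+ (r + W)) <= tau / 4.
    apply: le_trans w4; apply: ler_wpM2l => //; apply: ler_wpM2l => //.
    by apply: ler_wiXn2l; rewrite ?leq_addl // ltW.
  have -> : tau = (tau / 4 + tau / 4) + (tau / 4 + tau / 4) by field.
  apply: lerD; last exact: lerD w4 Hp.
  by rewrite mulrDr; exact: lerD C_r rw4.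
have e_r' : r%:R / p0%:R ^+ e <= eta / 4 by rewrite -exprVn.
have sTtau : (size T)%:R * tau = eta / 8.
  by rewrite /tau; field; rewrite gt_eqF.
have Heq : equidistribution_error eps a r (r + t) sigma <= eta / 8 by exact: Hsigma.
rewrite sTtau in bad; rewrite distrC; move: est main_r; rewrite -/L.
set y := main_value R T G r (r + t); set z := prob _ _ => est main_r.
have -> : z - L = (z - y) - (L - y) by ring.
have E : eta = eta / 4 + 2 * (eta / 8 + eta / 8) + eta / 4 by field.
rewrite [leRHS]E; apply: le_trans (ler_normB _ _) _; apply: lerD; last exact: main_r.
apply: le_trans est _; apply: lerD; first exact: e_r'.
by apply: ler_wpM2l; [|apply: lerD; [exact: Heq|exact: bad]].
Unshelve. all: by end_near.
Qed.

End Limit.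

Local Open Scope ring_scope.

Theorem theorem10p4 (R : realType) (eps : R) (t k : nat)
  (alpha beta : nat -> nat -> nat)
  (d : nat -> measure_display) (Omega : forall n : nat, measurableType (d n))
  (P : forall n : nat, probability (Omega n) R)
  (M : forall n : nat, Omega n -> 'M[int]_(n, n + t))
  (G : finZmodType) (T : {fset nat}) :
  0 < eps -> eps < 1 -> (0 < k)%N ->
  (\forall n \near \oo, stairs_shape k n (n + t) (alpha n) (beta n)) ->
  (\forall n \near \oo,
     balanced_stairs_matrix (P n) eps k (alpha n) (beta n) (@M n)) ->
  (forall i : nat, (1 <= i <= k)%N ->
     n%:R - (alpha n i)%:R - (beta n i)%:R @[n --> \oo] --> (+oo : set_system R)) ->
  (forall p : nat, p \in T -> prime p) ->
  (forall p : nat, prime p -> (p %| #|G|)%N -> p \in T) ->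
  P n [set w | forall p : nat, p \in T ->
         subgroup_iso (ppart (cok (M n w)) p) (ppart G p)] @[n --> \oo] -->
  ((#|Aut [set: G]%SET|%:R * #|G|%:R ^+ t)^-1 *
   \prod_(p <- T)
     limn (fun N : nat => \prod_(1 <= i < N.+1) (1 - p%:R ^- (i + t)) : R))%:E.
Proof.
move=> eps0 eps1 _ _ HM Hgap T_prime T_G; pose Ts : seq nat := T.
have TsE p : (p \in Ts) = (p \in T) by [].
pose E n := [set w : Omega n | forall p : nat, p \in T ->
  subgroup_iso (ppart (cok (M n w)) p) (ppart G p)].
(* Degeneracy is tested at a prime of [T], so the empty [T] is treated apart: [G] is then trivial
   and the event is everything. *)
rewrite -/(E _); have [T0|T0] := eqVneq Ts [::].
  have G1 : #|G| = 1%N.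
    apply/eqP; rewrite eqn_leq; apply/andP; split; last by apply/card_gt0P; exists 0.
    rewrite leqNgt; apply/negP => G2.
    by have := T_G _ (pdiv_prime G2) (pdiv_dvd _); rewrite -TsE T0.
  have A1 : #|Aut [set: G]%SET| = 1%N.
    apply/eqP; rewrite eqn_leq; apply/andP; split; last first.
      by apply/card_gt0P; exists 1%g; rewrite group1.
    have /fintype_le1P Geq : (#|G| <= 1)%N by rewrite G1.
    apply: leq_trans (max_card _) _; apply/fintype_le1P => u v.
    by apply/permP => y; exact: Geq.
  have ET n : E n = [set: Omega n].
    by apply/seteqP; split=> w // _ p; rewrite -TsE T0.
  rewrite G1 A1 expr1n mulr1 invr1 mul1r -/Ts T0 big_nil.
  rewrite (_ : (fun n => P n (E n)) = fun=> 1%E); first exact: cvg_cst.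
  by apply/funext => n; rewrite ET probability_setT.
have [p0 p0T] : exists p0, p0 \in Ts.
  by move: T0; case: (Ts) => // p0 s _; exists p0; rewrite mem_head.
apply/fine_cvgP; split.
  apply: filterS HM => n HMn; rewrite fin_num_measure //.
  exact: (measurable_matrix HMn (fun A => forall p : nat, p \in T ->
    subgroup_iso (ppart (cok A) p) (ppart G p))).
exact: (prob_cok_limit eps0 eps1 HM Hgap (fset_uniq T) T_prime T_G p0T).
Qed.
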